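(* Let $(N,g)$ be a connected Riemannian manifold of dimension $n>1$, let $D$ be a field of symmetric endomorphisms on $(N,g)$, and let $(M,g^D)$ be the $D$-extension of $(N,g)$. Then $(M,g^D)$ is Einstein if and only if the following two conditions are satisfied: (a) the endomorphism field $D$ has constant eigenvalues and $\operatorname{div} D=0$; (b) the manifold $(N,g)$ is Ricci $D$-stable and $\operatorname{Ric}^u=(\operatorname{Tr} D)\,D-\operatorname{Tr}(D^2)\,\mathrm{id}$ for all $u\in\mathbb{R}$. The Einstein constant of $g^D$ is then $-\operatorname{Tr}(D^2)$.
   Context: Everything is smooth. A field $D$ of symmetric endomorphisms on $(N,g)$ is a smooth field of endomorphisms of $TN$ symmetric with respect to $g$. For $u\in\mathbb{R}$, the $D$-deformation of $g$ is the metric $g^u:=(\exp(uD))^*g$ on $N$, i.e. $g^u(X,Y)=g(e^{uD}X,e^{uD}Y)$. The $D$-extension is the Riemannian manifold $(M:=\mathbb{R}\times N,\ g^D:=du^2+g^u)$, where $u$ is the coordinate on $\mathbb{R}$. $\operatorname{Ric}^u$ denotes the Ricci operator (the $(1,1)$ Ricci tensor) of $(N,g^u)$, an endomorphism field of $TN$. $(N,g)$ is called Ricci $D$-stable if $\operatorname{Ric}^u$ does not depend on $u$. The divergence is relative to $g$: $(\operatorname{div} D)X=\operatorname{Tr}(Y\mapsto(\nabla_Y D)X)$, with $\nabla$ the Levi-Civita connection of $g$. A Riemannian metric is Einstein if its Ricci tensor equals a constant (the Einstein constant) times the metric. *)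

(* Defs.v *)
From HB Require Import structures.
From mathcomp Require Import all_boot all_order all_algebra.
From mathcomp Require Import all_classical all_reals all_analysis.

Set Implicit Arguments.
Unset Strict Implicit.
Unset Printing Implicit Defensive.
Import Order.TTheory GRing.Theory Num.Theory.
Import numFieldNormedType.Exports.
Local Open Scope classical_set_scope.
Local Open Scope ring_scope.

(* Conventions.  As in MathComp, tangent vectors in a chart are row vectors and
   matrices act on the right: an endomorphism with matrix [A] sends [v] to
   [v *m A], a bilinear form with matrix [G] sends [(v, w)] to
   [v *m G *m w^T], and the differential of [f] at [x] is [v |-> v *m 'J f x]. *)

Section LocalGeometry.
Variables (R : realType) (n : nat).
Implicit Types (x v : 'rV[R]_n) (i j : 'I_n).

(* [f] is of class C^k on the open set [U] *)
Fixpoint classC (V : normedModType R) (k : nat) (U : set 'rV[R]_n)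
    (f : 'rV[R]_n -> V) : Prop :=
  if k is k'.+1 then
    (forall x, U x -> differentiable f x) /\
    (forall v, classC k' U (fun x => 'D_v f x))
  else forall x, U x -> {for x, continuous f}.

Definition smooth_on (V : normedModType R) (U : set 'rV[R]_n)
  (f : 'rV[R]_n -> V) : Prop := forall k, classC k U f.

Definition frame (i : 'I_n) : 'rV[R]_n := delta_mx 0 i.

(* [christoffel G x i j k] is the coefficient of the [k]-th coordinate field in
   nabla_{d_i} d_j, for the Levi-Civita connection of the metric [G] *)
Definition christoffel (G : 'rV[R]_n -> 'M[R]_n) x i j (k : 'I_n) : R :=
  2^-1 * \sum_l (('D_(frame i) G x) j l + ('D_(frame j) G x) i l
                 - ('D_(frame l) G x) i j) * invmx (G x) l k.

(* nabla_v Z at [x], for a tangent vector [v] at [x] and a vector field [Z] *)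
Definition levi_civita (G : 'rV[R]_n -> 'M[R]_n) v
    (Z : 'rV[R]_n -> 'rV[R]_n) x : 'rV[R]_n :=
  'D_v Z x +
  \row_k \sum_i \sum_j v 0 i * Z x 0 j * christoffel G x i j k.

(* (nabla_v D) Z = nabla_v (D Z) - D (nabla_v Z) *)
Definition levi_civita_endo (G : 'rV[R]_n -> 'M[R]_n) v
    (D : 'rV[R]_n -> 'M[R]_n) (Z : 'rV[R]_n -> 'rV[R]_n) x : 'rV[R]_n :=
  levi_civita G v (fun y => Z y *m D y) x - levi_civita G v Z x *m D x.

(* (div D)(d_j), the trace of Y |-> (nabla_Y D) d_j *)
Definition divergence (G D : 'rV[R]_n -> 'M[R]_n) x j : R :=
  \sum_k levi_civita_endo G (frame k) D (cst (frame j)) x 0 k.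

(* R(d_i, d_j) d_k, with R(X, Y) = [nabla_X, nabla_Y] - nabla_[X, Y]; the
   last term vanishes because coordinate fields commute *)
Definition riemann (G : 'rV[R]_n -> 'M[R]_n) x i j (k : 'I_n) : 'rV[R]_n :=
  levi_civita G (frame i) (levi_civita G (frame j) (cst (frame k))) x -
  levi_civita G (frame j) (levi_civita G (frame i) (cst (frame k))) x.

(* Ric(Y, Z) is the trace of X |-> R(X, Y) Z *)
Definition ricci_tensor (G : 'rV[R]_n -> 'M[R]_n) x : 'M[R]_n :=
  \matrix_(j, k) \sum_i riemann G x i j k 0 i.

(* the endomorphism Ric with g(Ric Y, Z) = Ric(Y, Z) *)
Definition ricci_operator (G : 'rV[R]_n -> 'M[R]_n) x : 'M[R]_n :=
  ricci_tensor G x *m invmx (G x).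

Definition expmx (A : 'M[R]_n) : 'M[R]_n :=
  limn (series (fun k => (k`!%:R)^-1 *: A ^+ k)).

End LocalGeometry.

(* [chart] and [chart_inv] are only meaningful on [chart_dom i] and its image;
   the axioms of a smooth atlas are in [smooth_manifold] *)
Record atlas (R : realType) (n : nat) (T : topologicalType) := Atlas {
  chart_index : Type;
  chart_dom : chart_index -> set T;
  chart : chart_index -> T -> 'rV[R]_n;
  chart_inv : chart_index -> 'rV[R]_n -> T }.

Section Manifold.
Variables (R : realType) (n : nat) (T : topologicalType) (A : atlas R n T).

Definition chart_img (i : chart_index A) : set 'rV[R]_n :=
  chart i @` chart_dom i.

Definition overlap (i j : chart_index A) : set 'rV[R]_n :=
  chart i @` (chart_dom i `&` chart_dom j).

Definition transition (i j : chart_index A) (x : 'rV[R]_n) : 'rV[R]_n :=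
  chart j (chart_inv i x).

Definition smooth_manifold : Prop :=
  hausdorff_space T /\ @second_countable T /\
  (forall p, exists i : chart_index A, chart_dom i p) /\
  (forall i : chart_index A,
     [/\ open (chart_dom i), open (chart_img i),
         {within chart_dom i, continuous (chart i)},
         {within chart_img i, continuous (chart_inv i)} &
         forall p, chart_dom i p -> chart_inv i (chart i p) = p]) /\
  (forall i j : chart_index A, smooth_on (overlap i j) (transition i j)).

(* a tensor field of rank two, given by its matrix in each chart; only the
   values of the [i]-th component on [chart_img i] are meaningful *)
Definition tensor2 : Type := chart_index A -> 'rV[R]_n -> 'M[R]_n.

Definition smooth_tensor2 (t : tensor2) : Prop :=
  forall i, smooth_on (chart_img i) (t i).

Definition riemannian_metric (g : tensor2) : Prop :=
  [/\ smooth_tensor2 g,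
      forall i j x, overlap i j x ->
        g i x = 'J (transition i j) x *m g j (transition i j x)
                *m ('J (transition i j) x)^T,
      forall i x, chart_img i x -> (g i x)^T = g i x &
      forall i x (v : 'rV[R]_n), chart_img i x -> v != 0 ->
        0 < (v *m g i x *m v^T) 0 0].

Definition endomorphism_field (D : tensor2) : Prop :=
  smooth_tensor2 D /\
  forall i j x, overlap i j x ->
    D i x *m 'J (transition i j) x =
    'J (transition i j) x *m D j (transition i j x).

Definition symmetric_endomorphism_field (g D : tensor2) : Prop :=
  endomorphism_field D /\
  forall i x (v w : 'rV[R]_n), chart_img i x ->
    (v *m D i x) *m g i x *m w^T = v *m g i x *m (w *m D i x)^T.

(* the eigenvalues of [D], listed with their multiplicities, are the same at
   all points; [a] is an eigenvalue iff its eigenspace has nonzero rank *)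
Definition constant_eigenvalues (D : tensor2) : Prop :=
  forall (i j : chart_index A) (x y : 'rV[R]_n) (a : R),
    chart_img i x -> chart_img j y ->
    \rank (eigenspace (D i x) a) = \rank (eigenspace (D j y) a).

Definition divergence_free (g D : tensor2) : Prop :=
  forall i x k, chart_img i x -> divergence (g i) (D i) x k = 0.

Definition einstein_with (g : tensor2) (c : R) : Prop :=
  forall i x, chart_img i x -> ricci_tensor (g i) x = c *: g i x.

Definition einstein (g : tensor2) : Prop := exists c, einstein_with g c.

(* g^u(X, Y) = g(e^{uD} X, e^{uD} Y) *)
Definition deformation (g D : tensor2) (u : R) : tensor2 := fun i x =>
  expmx (u *: D i x) *m g i x *m (expmx (u *: D i x))^T.

Definition deformed_ricci (g D : tensor2) (u : R) : tensor2 := fun i x =>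
  ricci_operator (deformation g D u i) x.

Definition ricci_stable (g D : tensor2) : Prop :=
  forall (u u' : R) i x, chart_img i x ->
    deformed_ricci g D u i x = deformed_ricci g D u' i x.

(* the product atlas on R * N, the coordinate u of R coming first *)
Definition extension_atlas : atlas R (1 + n) (R * T)%type :=
  @Atlas R (1 + n) (R * T)%type (chart_index A)
    (fun i => [set p | chart_dom i p.2])
    (fun i p => row_mx p.1%:M (chart i p.2))
    (fun i y => (lsubmx y 0 0, chart_inv i (rsubmx y))).

End Manifold.

(* g^D = du^2 + g^u *)
Definition extension_metric (R : realType) (n : nat) (T : topologicalType)
    (A : atlas R n T) (g D : tensor2 A) : tensor2 (extension_atlas A) :=
  fun i y =>
    block_mx 1%:M 0 0 (deformation g D (lsubmx y 0 0) i (rsubmx y)).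

(* Main.v *)
(* The Ricci tensor of du^2 + g^u has uu-component - Tr D^2, mixed component
   div^u D - d(Tr D), and tangential part Ric^u - (Tr D) D (as an endomorphism).
   This gives the "if" direction and the value of the Einstein constant, and
   reduces the converse to showing that an Einstein g^D forces the eigenvalues
   of D to be constant.

   Assume g^D Einstein, and put tau = d(Tr D).  The form div^u D is affine in u
   with slope D tau - d(Tr D^2) / 2, so Tr D^2 is constant and D tau = 0; moreover
   the scalar curvature of g^u at a given point does not depend on u.  With t = 2u
   that scalar curvature is a finite sum of p_m(t) exp(m t) with p_m polynomial of
   degree at most 2; such an expression determines sum_m p_m.  Let X_i be the part
   of d_i D commuting with D (the rest is a commutator [D, W_i]) and let
   sigma_b = sum_i (X_i)^i_b be its contraction.  The coefficient of t^2 in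
   sum_m p_m is
     - (|X|^2 + 2 |sigma|^2 + |tau|^2 - 4 <sigma, tau>) / 4,
   and it must vanish.  Differentiating D tau = 0 yields X_i tau = 0, whence
   <sigma, tau> = 0 and X = 0.  Thus d_i D = [D, W_i], every Tr D^k is locally
   constant, and connectedness of N concludes. *)
Require Import Defs.
From HB Require Import structures.
From mathcomp Require Import all_boot all_order all_algebra.
From mathcomp Require Import all_classical all_reals all_analysis.
From mathcomp Require Import complex ring lra.

Set Implicit Arguments.
Unset Strict Implicit.
Unset Printing Implicit Defensive.
Import Order.TTheory GRing.Theory Num.Theory.
Import numFieldNormedType.Exports.
Local Open Scope classical_set_scope.
Local Open Scope ring_scope.

(** Eigenvalues of [D] may collide, so a smooth eigenframe need not exist. Only the matrix [D x] at
    a single point is diagonalized; the derivatives of [expmx (t *: D)] there are corners of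
    exponentials of block matrices built from [D x] and its partial derivatives, and the nilpotent
    parts of these blocks produce the powers of [t]. Replacing all exponentials by 1 is a ring
    homomorphism on exponential polynomials, so the coefficient of t^2 can be counted factor by
    factor without sorting exponents. It also removes the uncontrolled data: a commutator [D, W]
    enters through e^{tD} W - W e^{tD}, which becomes W - W = 0. In the resulting quadratic form
    <sigma, tau> is the only term without a sign, hence the detour through D tau = 0. Its derivative
    puts X_i tau in the image of D; X_i commutes with D, so X_i tau is also in the kernel, and for
    diagonalizable D the two meet in 0. Self-adjointness of X_i then moves it onto tau inside
    <sigma, tau>. The traces Tr D^k replace the eigenvalues because they stay smooth where
    eigenvalues collide. *)

HB.instance Definition _ (R : realType) m n := Complete.on 'M[R]_(m, n).

(** * The matrix exponential *)

Section Expmx.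
Context {R : realType}.

Lemma normr_mxE m n (M : 'M[R]_(m, n)) i j : `|M i j| <= `|M|.
Proof.
rewrite [leRHS]/Num.Def.normr/= mx_normrE.
exact: (le_bigmax _ (fun ij => `|M ij.1 ij.2|) (i, j)).
Qed.

Lemma normr_mx_le m n (M : 'M[R]_(m, n)) (e : R) : 0 <= e ->
  (forall i j, `|M i j| <= e) -> `|M| <= e.
Proof.
by move=> e0 Me; rewrite [leLHS]/Num.Def.normr/= mx_normrE bigmax_le.
Qed.

Lemma cvg_mxP (T : Type) (F : set_system T) {FF : Filter F} m n
    (f : T -> 'M[R]_(m, n)) (M : 'M[R]_(m, n)) :
  f @ F --> M <-> forall i j, (fun x => f x i j) @ F --> M i j.
Proof.
split=> [fM i j|fM].
  apply/cvgrPdist_le => e e0.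
  move/cvgrPdist_le : fM => /(_ _ e0); apply: filterS => x; apply: le_trans.
  by have := normr_mxE (M - f x) i j; rewrite !mxE.
apply/cvgrPdist_le => /= e e0.
near=> x; apply: normr_mx_le (ltW e0) _ => i j; rewrite !mxE.
move: i j; near: x; apply: filter_forall => i; apply: filter_forall => j.
exact: ((cvgrPdist_le _ _).1 (fM i j)).
Unshelve. all: by end_near. Qed.

Lemma mx_linear_continuous m n p q (f : {linear 'M[R]_(m, n) -> 'M[R]_(p, q)}) :
  continuous f.
Proof.
move=> M; have -> : (f : _ -> _) =
    fun N : 'M[R]_(m, n) => \sum_i \sum_j N i j *: f (delta_mx i j).
  apply/funext => N; rewrite {1}[N]matrix_sum_delta linear_sum.
  by apply: eq_bigr => i _; rewrite linear_sum; apply: eq_bigr => j _; rewrite linearZ.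
apply/(@cvg_mxP _ _ (nbhs_filter M)) => a b.
rewrite [X in X @ _ --> _](_ : _ =
  (fun N : 'M[R]_(m, n) => \sum_i \sum_j N i j * f (delta_mx i j) a b)); last first.
  apply/funext => N; rewrite summxE; apply: eq_bigr => i _.
  by rewrite summxE; apply: eq_bigr => j _; rewrite mxE.
rewrite summxE; apply: cvg_big => [|i _]; first exact: add_continuous.
rewrite summxE; apply: cvg_big => [|j _]; first exact: add_continuous.
rewrite mxE; apply: cvgMr_tmp.
exact: coord_continuous.
Qed.

(** The norm is the largest absolute value of an entry, which is submultiplicative only up to the
    inner dimension; hence the factor [n%:R] in the bounds on [expmx]. *)
Lemma mulmx_norm m n p (A : 'M[R]_(m, n)) (B : 'M[R]_(n, p)) :
  `|A *m B| <= n%:R * `|A| * `|B|.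
Proof.
apply: normr_mx_le => [|i j]; first by rewrite !mulr_ge0.
rewrite mxE (le_trans (ler_norm_sum _ _ _))// -mulrA mulr_natl.
rewrite -[X in _ *+ X]card_ord -sumr_const ler_sum// => k _.
by rewrite normrM ler_pM ?normr_mxE.
Qed.

Lemma exprmx_norm n (A : 'M[R]_n) k : `|A ^+ k| <= (n%:R * `|A|) ^+ k.
Proof.
elim: k => [|k IH].
  apply: normr_mx_le => // i j; rewrite !expr0 mxE.
  by case: (i == j); rewrite ?normr1 ?normr0.
rewrite !exprS (le_trans (mulmx_norm _ _))// ler_wpM2l// mulr_ge0//.
Qed.

Definition expmx_coeff n (A : 'M[R]_n) k := (k`!%:R)^-1 *: A ^+ k.

Lemma expmx_coeff_norm n (A : 'M[R]_n) k :
  `|expmx_coeff A k| <= exp_coeff (n%:R * `|A|) k.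
Proof.
rewrite normrZ /exp_coeff /= ger0_norm ?invr_ge0// mulrC ler_wpM2r ?invr_ge0//.
exact: exprmx_norm.
Qed.

Lemma is_cvg_expmx n (A : 'M[R]_n) : cvgn (series (expmx_coeff A)).
Proof.
apply: normed_cvg; apply: series_le_cvg (is_cvg_series_exp_coeff (n%:R * `|A|)).
- by move=> k; exact: normr_ge0.
- by move=> k; rewrite exp_coeff_ge0// mulr_ge0.
- exact: expmx_coeff_norm.
Qed.

Lemma cvg_expmx n (A : 'M[R]_n) : series (expmx_coeff A) @ \oo --> expmx A.
Proof. exact: is_cvg_expmx. Qed.

Lemma expmx_norm n (A : 'M[R]_n) : `|expmx A| <= expR (n%:R * `|A|).
Proof.
rewrite /expmx -/(expmx_coeff A).
apply: le_trans (_ : limn (series (exp_coeff (n%:R * `|A|))) <= _); last by [].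
have cA := is_cvg_series_exp_coeff (n%:R * `|A|).
have cN : cvgn (series (fun k => `|expmx_coeff A k|)).
  apply: series_le_cvg cA => [k|k|k]; first exact: normr_ge0.
    by rewrite exp_coeff_ge0// mulr_ge0.
  exact: expmx_coeff_norm.
apply: le_trans (lim_series_norm cN) _.
apply: lim_series_le => // k; exact: expmx_coeff_norm.
Qed.

(** Linear maps are continuous, so agreement on all powers passes to the limit of the series.
    Multiplication by a fixed matrix, transposition and block extraction as [f] and [g] give the
    rules that follow. *)
Lemma expmx_intertwine m n p q (f : {linear 'M[R]_m -> 'M[R]_(p, q)})
    (g : {linear 'M[R]_n -> 'M[R]_(p, q)}) (A : 'M[R]_m) (B : 'M[R]_n) :
  (forall k, f (A ^+ k) = g (B ^+ k)) -> f (expmx A) = g (expmx B).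
Proof.
move=> fg.
have cf : (fun k => f (series (expmx_coeff A) k)) @ \oo --> f (expmx A).
  by apply: continuous_cvg; [exact: mx_linear_continuous|exact: cvg_expmx].
have cg : (fun k => g (series (expmx_coeff B) k)) @ \oo --> g (expmx B).
  by apply: continuous_cvg; [exact: mx_linear_continuous|exact: cvg_expmx].
have E : (fun k => f (series (expmx_coeff A) k)) = (fun k => g (series (expmx_coeff B) k)).
  apply/funext => k; rewrite /= /series /= !linear_sum; apply: eq_bigr => l _.
  by rewrite /expmx_coeff !linearZ/= fg.
by rewrite E in cf; rewrite -(cvg_lim _ cf)// -(cvg_lim _ cg).
Qed.

Lemma exprmx_comm m n (A : 'M[R]_m) (B : 'M[R]_n) (G : 'M[R]_(m, n)) k :
  A *m G = G *m B -> A ^+ k *m G = G *m B ^+ k.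
Proof.
move=> AG; elim: k => [|k IH]; first by rewrite !expr0 mul1mx mulmx1.
by rewrite !exprSr -[LHS]mulmxA AG mulmxA IH -[LHS]mulmxA.
Qed.

Lemma expmx_comm m n (A : 'M[R]_m) (B : 'M[R]_n) (G : 'M[R]_(m, n)) :
  A *m G = G *m B -> expmx A *m G = G *m expmx B.
Proof.
move=> AG; apply: (@expmx_intertwine _ _ _ _ (mulmxr G) (mulmx G)) => k.
exact: exprmx_comm.
Qed.

Lemma expmx_tr n (A : 'M[R]_n) : expmx A^T = (expmx A)^T.
Proof.
apply: (@expmx_intertwine _ _ _ _ idfun trmx) => k /=.
elim: k => [|k IH]; first by rewrite !expr0 trmx1.
by rewrite exprS exprSr trmx_mul IH.
Qed.

Lemma exprmx_block m n (A : 'M[R]_m) (B : 'M[R]_n) k :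
  (block_mx A 0 0 B : 'M[R]_(m + n)) ^+ k = block_mx (A ^+ k) 0 0 (B ^+ k).
Proof.
elim: k => [|k IH]; first by rewrite !expr0 -scalar_mx_block.
by rewrite !exprS IH [LHS]mulmx_block !mulmx0 !mul0mx !addr0 add0r.
Qed.

Lemma expmx_block m n (A : 'M[R]_m) (B : 'M[R]_n) :
  expmx (block_mx A 0 0 B : 'M[R]_(m + n)) = block_mx (expmx A) 0 0 (expmx B).
Proof.
rewrite -[LHS]submxK; congr block_mx.
- apply: (@expmx_intertwine (m + n) m m m (lsubmx \o usubmx) idfun _ A) => k.
  by rewrite exprmx_block/= -[LHS]/(ulsubmx _) block_mxKul.
- apply: (@expmx_intertwine (m + n) m _ _ (rsubmx \o usubmx) \0 _ A) => k.
  by rewrite exprmx_block/= -[LHS]/(ursubmx _) block_mxKur.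
- apply: (@expmx_intertwine (m + n) m _ _ (lsubmx \o dsubmx) \0 _ A) => k.
  by rewrite exprmx_block/= -[LHS]/(dlsubmx _) block_mxKdl.
- apply: (@expmx_intertwine (m + n) n n n (rsubmx \o dsubmx) idfun _ B) => k.
  by rewrite exprmx_block/= -[LHS]/(drsubmx _) block_mxKdr.
Qed.

(* This divided difference is bounded for c = |B - A|^-1, which makes expmx
   continuous, hence (with c the inverse of the increment) differentiable, its
   derivative being an upper right block of expmx again. *)
Lemma expmx_divided_difference m (A B : 'M[R]_m) c :
  ursubmx (expmx (block_mx A (c *: (B - A)) 0 B : 'M[R]_(m + m))) =
  c *: (expmx B - expmx A).
Proof.
(* The unipotent block matrix with corner [c] conjugates [block_mx A 0 0 B] into the matrix at hand:
   the corner [c *: (B - A)] is what this conjugation creates. *)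
have := @expmx_comm _ _ (block_mx A (c *: (B - A)) 0 B) (block_mx A 0 0 B)
  (block_mx 1%:M c%:M 0 1%:M).
rewrite !mulmx_block !mulmx0 !mul0mx !mul1mx !mulmx1 !addr0 !add0r.
rewrite mul_mx_scalar mul_scalar_mx scalerBr addrC subrK => /(_ erefl).
rewrite expmx_block -[X in X *m _]submxK !mulmx_block.
rewrite !mulmx0 !mul0mx !mul1mx !mulmx1 !addr0 !add0r => /eq_block_mx[-> E _ _].
move: E; rewrite mul_mx_scalar mul_scalar_mx => E.
by rewrite scalerBr -E [X in _ = X - _]addrC addrK.
Qed.

Lemma normr_ursubmx m1 m2 n1 n2 (M : 'M[R]_(m1 + m2, n1 + n2)) : `|ursubmx M| <= `|M|.
Proof. by apply: normr_mx_le => // i j; rewrite !mxE normr_mxE. Qed.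

Lemma expmx_continuous n : continuous (@expmx R n).
Proof.
move=> A; apply/(@cvgrPdist_le _ _ _ _ (nbhs_filter A)) => e e0; near=> B.
have BA1 : `|A - B| <= 1 by near: B; exact: cvgr_dist_le.
have [->|AB] := eqVneq B A; first by rewrite subrr normr0 ltW.
have BA0 : 0 < `|B - A| by rewrite normr_gt0 subr_eq0.
pose M : 'M[R]_(n + n) := block_mx A (`|B - A|^-1 *: (B - A)) 0 B.
have M1 : `|M| <= `|A| + 1.
  apply: normr_mx_le => [|i j]; first by rewrite addr_ge0.
  rewrite /M; case: (splitP i) => i' ei.
    rewrite (_ : i = lshift n i'); last exact/val_inj.
    case: (splitP j) => j' ej.
      rewrite (_ : j = lshift n j'); last exact/val_inj.
      by rewrite block_mxEul (le_trans (normr_mxE _ _ _))// lerDl.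
    rewrite (_ : j = rshift n j'); last exact/val_inj.
    rewrite block_mxEur (le_trans (normr_mxE _ _ _))// normrZ normfV normr_id.
    by rewrite mulVf ?gt_eqF// lerDr.
  rewrite (_ : i = rshift n i'); last exact/val_inj.
  case: (splitP j) => j' ej.
    rewrite (_ : j = lshift n j'); last exact/val_inj.
    by rewrite block_mxEdl mxE normr0 addr_ge0.
  rewrite (_ : j = rshift n j'); last exact/val_inj.
  rewrite block_mxEdr (le_trans (normr_mxE _ _ _))//.
  by rewrite -[B](subrK A) [B - A + A]addrC (le_trans (ler_normD _ _))// lerD2l distrC.
have := expmx_divided_difference A B `|B - A|^-1; rewrite -/M => E.
rewrite distrC.
have -> : expmx B - expmx A = `|B - A| *: ursubmx (expmx M).
  by rewrite E scalerA divff ?gt_eqF// scale1r.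
rewrite normrZ normr_id.
apply: (@le_trans _ _ (`|A - B| * expR ((n + n)%:R * (`|A| + 1)))).
  rewrite distrC ler_wpM2l// (le_trans (normr_ursubmx _))//.
  rewrite (le_trans (expmx_norm _))// ler_expR ler_wpM2l//.
rewrite -ler_pdivlMr ?expR_gt0//.
near: B; apply: cvgr_dist_le; first exact: cvg_id.
by rewrite divr_gt0// expR_gt0.
Unshelve. all: by end_near. Qed.

Lemma is_derive_expmx (V : normedModType R) n (X : V -> 'M[R]_n) (x v : V) :
  derivable X x v ->
  is_derive x v (fun y => expmx (X y))
    (ursubmx (expmx (block_mx (X x) ('D_v X x) 0 (X x) : 'M[R]_(n + n)))).
Proof.
move=> dX.
pose dq h := h^-1 *: (X (h *: v + x) - X x).
have cdq : dq @ 0^' --> 'D_v X x by [].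
have cX : (fun h => X (h *: v + x)) @ 0^' --> X x.
  have : (fun h : R => X x + h *: dq h) @ 0^' --> X x + 0 *: 'D_v X x.
    apply: cvgD; first exact: cvg_cst.
    apply: cvgZ => //; exact: nbhs_dnbhs.
  rewrite scale0r addr0; apply: cvg_trans; apply: near_eq_cvg.
  near=> h; rewrite /dq scalerA divff ?scale1r; first by rewrite addrC subrK.
  by near: h; exact: nbhs_dnbhs_neq.
pose M h : 'M[R]_(n + n) := block_mx (X x) (dq h) 0 (X (h *: v + x)).
have cM : M @ 0^' --> (block_mx (X x) ('D_v X x) 0 (X x) : 'M[R]_(n + n)).
  apply/cvg_mxP => i j; rewrite /M.
  case: (splitP i) => i' ei.
    rewrite (_ : i = lshift n i'); last exact/val_inj.
    case: (splitP j) => j' ej.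
      rewrite (_ : j = lshift n j'); last exact/val_inj.
      under eq_fun do rewrite block_mxEul.
      by rewrite block_mxEul; exact: cvg_cst.
    rewrite (_ : j = rshift n j'); last exact/val_inj.
    under eq_fun do rewrite block_mxEur.
    by rewrite block_mxEur; move/cvg_mxP : cdq; exact.
  rewrite (_ : i = rshift n i'); last exact/val_inj.
  case: (splitP j) => j' ej.
    rewrite (_ : j = lshift n j'); last exact/val_inj.
    under eq_fun do rewrite block_mxEdl.
    by rewrite block_mxEdl; exact: cvg_cst.
  rewrite (_ : j = rshift n j'); last exact/val_inj.
  under eq_fun do rewrite block_mxEdr.
  by rewrite block_mxEdr; move/cvg_mxP : cX; exact.
pose f : {linear 'M[R]_(n + n) -> 'M[R]_n} := rsubmx \o usubmx.
have : (fun h => f (expmx (M h))) @ 0^' -->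
    f (expmx (block_mx (X x) ('D_v X x) 0 (X x) : 'M[R]_(n + n))).
  apply: continuous_cvg; first exact: mx_linear_continuous.
  by apply: continuous_cvg; [exact: expmx_continuous|exact: cM].
rewrite [X in X @ _ --> _ -> _](_ : _ = fun h : R =>
  h^-1 *: (expmx (X (h *: v + x)) - expmx (X x))); last first.
  by apply/funext => h /=; rewrite -expmx_divided_difference.
move=> cE; apply: DeriveDef; first by apply/cvg_ex; eexists; exact: cE.
exact: cvg_lim.
Unshelve. all: by end_near. Qed.

End Expmx.

(** * Diagonalization of self-adjoint endomorphisms *)

Section Spectral.
Context {R : realType}.

Definition posdefmx n (G : 'M[R]_n) :=
  G^T = G /\ forall v : 'rV[R]_n, v != 0 -> 0 < (v *m G *m v^T) 0 0.

(** Algebraic closure gives a complex eigenvector [x + iy] for some [a + ib]. Comparing the inner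
    products of [x *m D] with [y] and of [x] with [y *m D] yields [b * (ip x x + ip y y) = 0], so
    [b = 0] and whichever of [x], [y] is nonzero is a real eigenvector. *)
Lemma selfadjoint_eigenvector n (G D : 'M[R]_n.+1) : posdefmx G ->
  D *m G = G *m D^T -> exists a (v : 'rV[R]_n.+1), v != 0 /\ v *m D = a *: v.
Proof.
move=> [Gsym Gpos] DG.
pose C := (complex R); pose f := real_complex R.
pose Dc : 'M[C]_n.+1 := map_mx f D.
have [[a b] rz] : exists z, root (char_poly Dc) z.
  by apply/closed_rootP; rewrite size_char_poly.
have /eigenvalueP[w wD w0] : eigenvalue Dc (Complex a b) by rewrite eigenvalue_root_char.
pose x : 'rV[R]_n.+1 := map_mx (@complex.Re R) w.
pose y : 'rV[R]_n.+1 := map_mx (@complex.Im R) w.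
have ReM (u : C) (r : R) : complex.Re (u * f r) = complex.Re u * r.
  by case: u => u1 u2 /=; rewrite mulr0 subr0.
have ImM (u : C) (r : R) : complex.Im (u * f r) = complex.Im u * r.
  by case: u => u1 u2 /=; rewrite mulr0 add0r.
have xD : x *m D = a *: x - b *: y.
  apply/rowP => j; have := congr1 (fun u : 'rV[C]_n.+1 => complex.Re (u 0 j)) wD.
  rewrite !mxE raddf_sum /= (eq_bigr (fun k => x 0 k * D k j)) => [->|k _].
    by case: (w 0 j).
  by rewrite !mxE ReM.
have yD : y *m D = b *: x + a *: y.
  apply/rowP => j; have := congr1 (fun u : 'rV[C]_n.+1 => complex.Im (u 0 j)) wD.
  rewrite !mxE raddf_sum /= (eq_bigr (fun k => y 0 k * D k j)) => [->|k _].
    by case: (w 0 j) => *; rewrite /= addrC.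
  by rewrite !mxE ImM.
pose ip (u v : 'rV[R]_n.+1) := (u *m G *m v^T) 0 0.
have ipC u v : ip u v = ip v u.
  by rewrite /ip -[u *m G *m v^T]trmxK [LHS]mxE !trmx_mul trmxK Gsym mulmxA.
have ipD u v : ip (u *m D) v = ip u (v *m D).
  by rewrite /ip trmx_mul !mulmxA -(mulmxA _ D) DG !mulmxA.
have xy0 : (x != 0) || (y != 0).
  rewrite -negb_and; apply: contra w0 => /andP[/eqP x0 /eqP y0].
  apply/eqP/rowP => j; move/rowP/(_ j) : x0; move/rowP/(_ j) : y0.
  by rewrite !mxE; case: (w 0 j) => w1 w2 /= -> ->.
have ge0 u : 0 <= ip u u.
  have [->|/Gpos/ltW//] := eqVneq u 0.
  by rewrite /ip !mul0mx mxE.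
have b0 : b = 0.
  have := ipD x y; rewrite xD yD /ip.
  have addE (M N : 'M[R]_1) : (M + N) 0 0 = M 0 0 + N 0 0 by rewrite mxE.
  have oppE (M : 'M[R]_1) : (- M) 0 0 = - M 0 0 by rewrite mxE.
  have sclE c (M : 'M[R]_1) : (c *: M) 0 0 = c * M 0 0 by rewrite mxE.
  rewrite mulmxBl mulmxBl linearD/= mulmxDr !linearZ/= -!scalemxAl.
  rewrite !addE oppE !sclE -/(ip x y) -/(ip y y) -/(ip x x) => E.
  have {}E : b * (ip x x + ip y y) = 0 by rewrite mulrDr; move: E; lra.
  move/eqP : E; rewrite mulf_eq0 => /orP[/eqP//|].
  by rewrite paddr_eq0// => /andP[/eqP xx /eqP yy]; case/orP: xy0 => /Gpos;
    rewrite -/(ip _ _) ?xx ?yy ltxx.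
exists a; rewrite b0 !scale0r ?subr0 ?add0r in xD yD.
by case/orP: xy0 => ?; [exists x|exists y].
Qed.

(** The rows of [Q] form a [G]-orthonormal eigenbasis. Induction on the dimension: a unit
    eigenvector [v] is split off, and [D] preserves its [G]-orthogonal complement, with basis [B],
    on which it is the self-adjoint matrix [D']. *)
Lemma selfadjoint_diagonalizable n (G D : 'M[R]_n) : posdefmx G ->
  D *m G = G *m D^T ->
  exists (Q : 'M[R]_n) (l : 'rV[R]_n), Q *m G *m Q^T = 1%:M /\ Q *m D = diag_mx l *m Q.
Proof.
elim: n G D => [|n IH] G D Gpd DG.
  by exists 0, 0; split; apply/matrixP => -[].
have [a [v0 [v0n0 v0D]]] := selfadjoint_eigenvector Gpd DG.
have [Gsym Gpos] := Gpd.
pose s := Num.sqrt ((v0 *m G *m v0^T) 0 0).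
have s0 : s != 0 by rewrite gt_eqF// sqrtr_gt0 Gpos.
pose v := s^-1 *: v0.
have vD : v *m D = a *: v by rewrite /v -scalemxAl v0D !scalerA mulrC.
have vGv : v *m G *m v^T = 1%:M.
  rewrite [LHS]mx11_scalar /v linearZ/= -!scalemxAl -scalemxAr scalerA mxE.
  have -> : (v0 *m G *m v0^T) 0 0 = s * s.
    by rewrite -expr2 sqr_sqrtr// ltW// Gpos.
  by rewrite mulrA mulfVK// mulVf.
pose K := kermx (G *m v^T).
have rK : \rank K = n.
  rewrite mxrank_ker.
  suff -> : \rank (G *m v^T) = 1%N by rewrite subn1.
  apply/eqP; rewrite eqn_leq rank_leq_col lt0n mxrank_eq0; apply/eqP => /(congr1 (mulmx v)).
  rewrite mulmxA vGv mulmx0 => /matrixP/(_ 0 0)/eqP.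
  by rewrite !mxE/= oner_eq0.
have [B [Bfree BK]] : exists B : 'M[R]_(n, n.+1), row_free B /\ (B :=: K)%MS.
  (* The rank is generalized so that the number of rows of [row_base] can become [n]. *)
  suff : forall m k (M : 'M[R]_m), \rank M = k ->
    exists B : 'M[R]_(k, m), row_free B /\ (B :=: M)%MS by exact.
  by move=> m k M <-; exists (row_base M); split; [exact: row_base_free|exact: eq_row_base].
have BGv : B *m G *m v^T = 0.
  by apply/eqP; rewrite -mulmxA -sub_kermx BK.
have vGB : v *m G *m B^T = 0.
  by apply: trmx_inj; rewrite !trmx_mul trmxK Gsym mulmxA BGv trmx0.
pose D' := B *m D *m pinvmx B.
have D'B : D' *m B = B *m D.
  rewrite mulmxKpV// BK sub_kermx mulmxA -(mulmxA _ D) DG -!mulmxA -trmx_mul.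
  by rewrite vD linearZ/= -!scalemxAr mulmxA BGv scaler0.
have G'pd : posdefmx (B *m G *m B^T).
  split; first by rewrite !trmx_mul trmxK Gsym mulmxA.
  move=> u u0; have uB : u *m B != 0 by rewrite mulmx_free_eq0.
  by have := Gpos _ uB; rewrite trmx_mul !mulmxA.
have D'G' : D' *m (B *m G *m B^T) = B *m G *m B^T *m D'^T.
  rewrite -[RHS]mulmxA -[in RHS]trmx_mul !mulmxA D'B trmx_mul !mulmxA.
  by rewrite -(mulmxA _ D) DG !mulmxA.
have [Q' [l' [Q'G Q'D]]] := IH _ _ G'pd D'G'.
have E1 : col_mx v (Q' *m B) *m G *m (col_mx v (Q' *m B))^T = 1%:M :> 'M[R]_(1 + n).
  rewrite tr_col_mx mul_col_mx mul_col_row vGv [RHS]scalar_mx_block; congr block_mx.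
  - by rewrite trmx_mul mulmxA vGB mul0mx.
  - by rewrite -!mulmxA !(mulmxA B) BGv mulmx0.
  - by rewrite -Q'G trmx_mul !mulmxA.
have E2 : col_mx v (Q' *m B) *m D =
    diag_mx (row_mx a%:M l') *m col_mx v (Q' *m B).
  rewrite mul_col_mx vD -(mulmxA Q') -D'B mulmxA Q'D diag_mx_row.
  rewrite mul_block_col !mul0mx addr0 add0r mulmxA; congr col_mx.
  rewrite -mul_scalar_mx; congr (_ *m _).
  by apply/matrixP => i j; rewrite !ord1 !mxE eqxx mulr1n.
by exists (col_mx v (Q' *m B)), (row_mx a%:M l').
Qed.

End Spectral.

Lemma addmxE (R : nmodType) m n (A B : 'M[R]_(m, n)) i j : (A + B) i j = A i j + B i j.
Proof. by rewrite mxE. Qed.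

Lemma submxE (R : zmodType) m n (A B : 'M[R]_(m, n)) i j : (A - B) i j = A i j - B i j.
Proof. by rewrite !mxE. Qed.

(** * The commutant of a diagonalizable matrix *)

Section Commutant.
Context {R : realType} {n : nat}.
Variables (Q D : 'M[R]_n) (l : 'rV[R]_n).
Hypotheses (Qu : Q \in unitmx) (QD : Q *m D = diag_mx l *m Q).

Let conj (Z : 'M[R]_n) := Q *m Z *m invmx Q.

Let conjK (Z : 'M[R]_n) : invmx Q *m conj Z *m Q = Z.
Proof. by rewrite /conj !mulmxA mulVmx// mul1mx mulmxKV. Qed.

Let conj_invK (Z : 'M[R]_n) : conj (invmx Q *m Z *m Q) = Z.
Proof. by rewrite /conj !mulmxA mulmxV// mul1mx mulmxK. Qed.

Let conj_inj : injective conj.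
Proof. exact: (@can_inj _ _ conj (fun Z => invmx Q *m Z *m Q) conjK). Qed.

Let conjD : conj D = diag_mx l.
Proof. by rewrite /conj QD mulmxK. Qed.

Let conjM (A B : 'M[R]_n) : conj (A *m B) = conj A *m conj B.
Proof. by rewrite /conj !mulmxA mulmxKV. Qed.

Let conjDl (A : 'M[R]_n) i j : conj (D *m A) i j = l 0 i * conj A i j.
Proof. by rewrite conjM conjD mul_diag_mx mxE. Qed.

Let conjDr (A : 'M[R]_n) i j : conj (A *m D) i j = l 0 j * conj A i j.
Proof. by rewrite conjM conjD mul_mx_diag mxE mulrC. Qed.

Let conj_add (A B : 'M[R]_n) : conj (A + B) = conj A + conj B.
Proof. by rewrite /conj mulmxDr mulmxDl. Qed.

Let conj_opp (A : 'M[R]_n) : conj (- A) = - conj A.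
Proof. by rewrite /conj mulmxN mulNmx. Qed.

(** In an eigenbasis, bracketing with [D] multiplies the entry [(i, j)] by [l 0 i - l 0 j]. The
    entries where this factor vanishes make up [X]; the others are divided by it to make up [W]. *)
Lemma commutant_split (Z : 'M[R]_n) : exists X W : 'M[R]_n,
  X *m D = D *m X /\ Z = X + (D *m W - W *m D).
Proof.
pose X : 'M[R]_n := \matrix_(i, j) if l 0 i == l 0 j then conj Z i j else 0.
pose W : 'M[R]_n := \matrix_(i, j) if l 0 i == l 0 j then 0 else conj Z i j / (l 0 i - l 0 j).
exists (invmx Q *m X *m Q), (invmx Q *m W *m Q); split; apply: conj_inj; apply/matrixP => i j.
  by rewrite conjDl conjDr conj_invK !mxE; case: eqP => [->|_]; rewrite ?mulr0.
rewrite !conj_add conj_opp addmxE submxE conjDl conjDr.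
rewrite !conj_invK !mxE; case: eqP => [->|/eqP ll]; first by rewrite !mulr0 subrr addr0.
by rewrite -mulrBl add0r mulrC divfK// subr_eq0.
Qed.

(** The operator [ad D] is diagonalizable along with [D], so its kernel and its image meet in 0. *)
Lemma commutant_ad0 (X W : 'M[R]_n) : X *m D = D *m X ->
  X = D *m W - W *m D -> X = 0.
Proof.
move=> XD XW; apply: conj_inj; apply/matrixP => i j.
rewrite {2}/conj mulmx0 mul0mx [RHS]mxE.
have E1 : (l 0 j - l 0 i) * conj X i j = 0.
  by rewrite mulrBl -conjDr -conjDl XD subrr.
have E2 : conj X i j = (l 0 i - l 0 j) * conj W i j.
  by rewrite {1}XW conj_add conj_opp submxE conjDr conjDl mulrBl.
move/eqP : E1; rewrite mulf_eq0 => /orP[|/eqP//]; rewrite subr_eq0 => /eqP ll.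
by rewrite E2 ll subrr mul0r.
Qed.

Lemma ker_img0 m (s r : 'M[R]_(n, m)) : s = D *m r -> D *m s = 0 -> s = 0.
Proof.
move=> sr Ds.
have QDm (t : 'M[R]_(n, m)) i j : (Q *m (D *m t)) i j = l 0 i * (Q *m t) i j.
  by rewrite mulmxA QD -mulmxA mul_diag_mx mxE.
suff : Q *m s = 0 by move/(congr1 (mulmx (invmx Q))); rewrite mulKmx// mulmx0.
apply/matrixP => i j; rewrite [RHS]mxE.
have := QDm s i j; rewrite Ds mulmx0 mxE => /esym/eqP.
rewrite mulf_eq0 => /orP[/eqP l0|/eqP//].
by rewrite sr QDm l0 mul0r.
Qed.

(** The last hypothesis is the derivative of [D *m G = G *m D^T], with [Z] and [A] standing for the
    derivatives of [D] and [G]. It makes [Z - adj Z] a commutator with [D]; then [X - adj X] is one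
    too, and it commutes with [D], so it is 0. *)
Lemma adjoint_commutant (G A X W Z : 'M[R]_n) : G \in unitmx ->
  D *m G = G *m D^T -> X *m D = D *m X -> Z = X + (D *m W - W *m D) ->
  Z *m G + D *m A = A *m D^T + G *m Z^T -> X *m G = G *m X^T.
Proof.
move=> Gu DG XD ZE ZG.
have DtG : D^T *m invmx G = invmx G *m D.
  apply: (can_inj (mulKmx Gu)); rewrite mulmxA -DG mulmxK// mulKVmx//.
pose adj Y := G *m Y^T *m invmx G.
have adjM Y Y' : adj (Y *m Y') = adj Y' *m adj Y.
  by rewrite /adj trmx_mul !mulmxA mulmxKV.
have adjDD Y Y' : adj (Y + Y') = adj Y + adj Y'.
  by rewrite /adj linearD/= mulmxDr mulmxDl.
have adjN Y : adj (- Y) = - adj Y by rewrite /adj linearN/= mulmxN mulNmx.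
have adjD : adj D = D by rewrite /adj -DG mulmxK.
have XadjX : X = adj X.
  apply/eqP; rewrite -subr_eq0; apply/eqP.
  apply: (@commutant_ad0 _ (- (A *m invmx G) - W - adj W)).
    by rewrite mulmxBl mulmxBr XD -{2}adjD -adjM -XD adjM adjD.
  have E : Z - adj Z = (A *m invmx G) *m D - D *m (A *m invmx G).
    have := congr1 (mulmx^~ (invmx G)) ZG; rewrite /= !mulmxDl mulmxK// => E.
    rewrite -(mulmxA A) DtG mulmxA -/(adj Z) -(mulmxA D) in E.
    by apply/eqP; rewrite subr_eq addrAC -E addrK.
  have E2 : adj Z = adj X + (adj W *m D - D *m adj W).
    by rewrite ZE !adjDD adjN !adjM adjD.
  rewrite mulmxBr mulmxBr mulmxN mulmxBl mulmxBl mulNmx.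
  move: E; rewrite E2 ZE.
  move: (adj X) (D *m W) (W *m D) (D *m adj W) (adj W *m D) (D *m (A *m _)) (_ *m D).
  move=> X' a b c d e f E; apply/matrixP => i j.
  by have := congr1 (fun M : 'M[R]_n => M i j) E; rewrite !mxE; lra.
by rewrite [in LHS]XadjX /adj mulmxKV.
Qed.

End Commutant.

(** * Positivity of the quadratic forms defined by the metric *)

Section Positivity.
Context {R : realType} {n : nat}.
Variables (Q G : 'M[R]_n).
Hypothesis (QG : Q *m G *m Q^T = 1%:M).

Lemma orthonormal_unit : Q \in unitmx /\ G \in unitmx.
Proof.
have Qu : Q \in unitmx by move: QG; rewrite -mulmxA => /mulmx1_unit[].
split=> //; move: QG => /mulmx1_unit[]; rewrite unitmx_mul => /andP[].
by [].
Qed.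

Lemma orthonormal_inv : invmx G = Q^T *m Q.
Proof.
have [Qu Gu] := orthonormal_unit.
apply: (can_inj (mulKmx Gu)); rewrite mulmxV//.
apply: (can_inj (mulKmx Qu)); rewrite mulmx1 mulmxA mulmxA QG mul1mx//.
Qed.

(** Conjugation by an orthonormal frame turns a self-adjoint matrix into a symmetric one, whose
    square has the sum of the squared entries as trace. *)
Lemma trace_selfadjoint_sqr (X : 'M[R]_n) : X *m G = G *m X^T ->
  \tr (X *m X) = \sum_i \sum_j (Q *m X *m invmx Q) i j ^+ 2.
Proof.
move=> XG; have [Qu Gu] := orthonormal_unit.
pose Y := Q *m X *m invmx Q.
have QGQ : invmx Q = G *m Q^T.
  by apply: (can_inj (mulKmx Qu)); rewrite mulmxV// mulmxA QG.
have Gsym : G^T = G.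
  have := congr1 trmx QG; rewrite trmx1 !trmx_mul trmxK -QG mulmxA.
  move=> /(congr1 (mulmx (invmx Q))); rewrite -!mulmxA !mulKmx//.
  by move/(congr1 (mulmx^~ (invmx Q^T))); rewrite !mulmxK// unitmx_tr.
have Ysym : Y^T = Y.
  rewrite /Y QGQ !trmx_mul trmxK Gsym -[RHS]mulmxA (mulmxA X) XG.
  by rewrite !mulmxA.
transitivity (\tr (Y *m Y)).
  have -> : Y *m Y = Q *m (X *m X) *m invmx Q by rewrite /Y -!mulmxA mulKmx.
  by rewrite [RHS]mxtrace_mulC mulKmx.
rewrite -{2}Ysym; apply: eq_bigr => i _; rewrite mxE.
by apply: eq_bigr => j _; rewrite [Y^T _ _]mxE expr2.
Qed.

Lemma invmx_form_ge0 (s : 'I_n -> R) :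
  0 <= \sum_i \sum_j invmx G i j * (s i * s j).
Proof.
suff -> : \sum_i \sum_j invmx G i j * (s i * s j) = \sum_a (\sum_i Q a i * s i) ^+ 2.
  by apply: sumr_ge0 => a _; exact: sqr_ge0.
rewrite [RHS](eq_bigr (fun a => \sum_i \sum_j (Q a i * s i) * (Q a j * s j))); last first.
  move=> a _; rewrite expr2 mulr_suml; apply: eq_bigr => i _.
  by rewrite mulr_sumr.
rewrite [RHS]exchange_big; apply: eq_bigr => i _.
rewrite [RHS]exchange_big; apply: eq_bigr => j _.
rewrite orthonormal_inv mxE mulr_suml; apply: eq_bigr => a _.
by rewrite mxE; ring.
Qed.

(** This form is |X|^2. Passing to the orthonormal frame in the index of the family as well, with
    [Y a] the resulting matrices, makes it the sum of the [\tr (Y a *m Y a)], a sum of squares. *)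
Lemma invmx_trace_form (X : 'I_n -> 'M[R]_n) :
  (forall i, X i *m G = G *m (X i)^T) ->
  0 <= \sum_i \sum_j invmx G i j * \tr (X i *m X j) /\
  (\sum_i \sum_j invmx G i j * \tr (X i *m X j) = 0 -> forall i, X i = 0).
Proof.
move=> XG; have [Qu Gu] := orthonormal_unit.
pose Y a := \sum_i Q a i *: X i.
have YG a : Y a *m G = G *m (Y a)^T.
  rewrite /Y mulmx_suml linear_sum mulmx_sumr; apply: eq_bigr => i _.
  by rewrite linearZ/= -scalemxAl -scalemxAr XG.
have E : \sum_i \sum_j invmx G i j * \tr (X i *m X j) = \sum_a \tr (Y a *m Y a).
  rewrite [RHS](eq_bigr (fun a => \sum_i \sum_j (Q a i * Q a j) * \tr (X i *m X j))); last first.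
    move=> a _; rewrite /Y mulmx_suml linear_sum; apply: eq_bigr => i _.
    rewrite mulmx_sumr linear_sum; apply: eq_bigr => j _.
    by rewrite -scalemxAl -scalemxAr /= !mxtraceZ mulrA.
  rewrite [RHS]exchange_big; apply: eq_bigr => i _.
  rewrite [RHS]exchange_big; apply: eq_bigr => j _.
  by rewrite orthonormal_inv mxE mulr_suml; apply: eq_bigr => a _; rewrite mxE.
have T0 a : 0 <= \tr (Y a *m Y a).
  rewrite trace_selfadjoint_sqr//.
  by apply: sumr_ge0 => i _; apply: sumr_ge0 => j _; exact: sqr_ge0.
split; first by rewrite E sumr_ge0.
rewrite E => /eqP; rewrite psumr_eq0// => /allP Y0.
have {}Y0 a : Y a = 0.
  have := Y0 a; rewrite mem_index_enum => /(_ isT)/implyP/(_ isT).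
  rewrite trace_selfadjoint_sqr// psumr_eq0; last first.
    by move=> i _; apply: sumr_ge0 => j _; exact: sqr_ge0.
  move=> /allP Ya; have {}Ya : Q *m Y a *m invmx Q = 0.
    apply/matrixP => i j; have := Ya i; rewrite mem_index_enum => /(_ isT)/implyP/(_ isT).
    rewrite psumr_eq0; last by move=> k _; exact: sqr_ge0.
    move=> /allP/(_ j); rewrite mem_index_enum => /(_ isT)/implyP/(_ isT).
    by rewrite expf_eq0/= => /eqP ->; rewrite mxE.
  move/(congr1 (fun M => invmx Q *m M *m Q)) : Ya.
  by rewrite !mulmxA mulVmx// mul1mx mulmxKV// mulmx0 mul0mx.
move=> i; have -> : X i = \sum_a invmx Q i a *: Y a.
  rewrite /Y (eq_bigr (fun a => \sum_j (invmx Q i a * Q a j) *: X j)); last first.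
    by move=> a _; rewrite scaler_sumr; apply: eq_bigr => j _; rewrite scalerA.
  rewrite exchange_big/= (eq_bigr (fun j => (invmx Q *m Q) i j *: X j)); last first.
    by move=> j _; rewrite -scaler_suml mxE.
  rewrite mulVmx// (bigD1 i)//= mxE eqxx scale1r big1 ?addr0// => j ji.
  by rewrite mxE eq_sym (negbTE ji) scale0r.
by rewrite big1// => a _; rewrite Y0 scaler0.
Qed.

End Positivity.

(** * Multiplicities of eigenvalues and power sums *)

Lemma mxrank_diag_mx (F : fieldType) n (d : 'rV[F]_n) :
  \rank (diag_mx d) = #|[pred i | d 0 i != 0]|.
Proof.
rewrite -sum1_card big_mkcond/=.
elim: n d => [|n IH] d; first by rewrite big_ord0 (flatmx0 (diag_mx d)) mxrank0.
suff H (c : 'rV[F]_(1 + n)) : \rank (diag_mx c) =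
    (\sum_(i < 1 + n) if (c 0 i != 0)%R then 1 else 0)%N by exact: H.
rewrite -[c]hsubmxK diag_mx_row rank_diag_block_mx IH big_split_ord big_ord1 /=.
congr addn; last by apply: eq_bigr => i _; rewrite row_mxEr.
have -> : diag_mx (lsubmx c) = (lsubmx c 0 0)%:M.
  by rewrite {1}[lsubmx c]mx11_scalar; apply/matrixP => i j; rewrite !mxE !ord1.
rewrite row_mxEl; case: eqP => [->|/eqP c0]; first by rewrite raddf0 mxrank0.
by rewrite -scalemx1 mxrank_scale_nz// mxrank1.
Qed.

Section Eigenvalues.
Context {R : realType} {n : nat}.

Lemma rank_eigenspace (Q D : 'M[R]_n) (l : 'rV[R]_n) a : Q \in unitmx ->
  Q *m D = diag_mx l *m Q ->
  \rank (eigenspace D a) = #|[pred i | l 0 i == a]|.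
Proof.
move=> Qu QD; rewrite /eigenspace mxrank_ker.
have -> : \rank (D - a%:M) = \rank (diag_mx (l - const_mx a)).
  have E : Q *m (D - a%:M) = diag_mx (l - const_mx a) *m Q.
    by rewrite mulmxBr QD linearB/= mulmxBl diag_const_mx mul_mx_scalar mul_scalar_mx.
  have fQ : row_full Q by rewrite row_full_unit.
  rewrite -(eqmxMfull (D - a%:M) fQ).
  by rewrite E mxrankMfree// row_free_unit.
have -> : \rank (diag_mx (l - const_mx a)) = #|[pred i | l 0 i != a]|.
  rewrite mxrank_diag_mx; apply: eq_card => i.
  by rewrite !inE !mxE subr_eq0.
by rewrite -[X in (X - _)%N]card_ord -(cardC [pred i | l 0 i == a]) addnK.
Qed.

Lemma trace_diagonalizable_exp (Q D : 'M[R]_n) (l : 'rV[R]_n) k : Q \in unitmx ->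
  Q *m D = diag_mx l *m Q -> \tr (D ^+ k) = \sum_i l 0 i ^+ k.
Proof.
move=> Qu QD.
have E : Q *m D ^+ k = diag_mx (\row_i (l 0 i ^+ k)) *m Q.
  elim: k => [|k IH].
    rewrite expr0 mulmx1 (_ : \row__ _ = const_mx 1) ?diag_const_mx ?mul1mx//.
    by apply/rowP => i; rewrite !mxE expr0.
  rewrite exprSr [LHS]mulmxA IH -mulmxA QD mulmxA mulmx_diag.
  by congr (diag_mx _ *m _); apply/rowP => i; rewrite !mxE exprSr.
transitivity (\tr (diag_mx (\row_i (l 0 i ^+ k)))).
  by rewrite -(mulKmx Qu (D ^+ k)) E mxtrace_mulC mulmxK.
by rewrite mxtrace_diag; apply: eq_bigr => i _; rewrite mxE.
Qed.

(** Equal power sums give equal sums of values of every polynomial. For a [p] vanishing at all the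
    entries of [l] and [m] other than [a], the sum is [p.[a]] times the multiplicity of [a], and
    [p.[a]] is nonzero. *)
Lemma power_sums_card (l m : 'rV[R]_n) :
  (forall k, \sum_i l 0 i ^+ k = \sum_i m 0 i ^+ k) ->
  forall a, #|[pred i | l 0 i == a]| = #|[pred i | m 0 i == a]|.
Proof.
move=> lm a.
have P (p : {poly R}) : \sum_i p.[l 0 i] = \sum_i p.[m 0 i].
  transitivity (\sum_(k < size p) p`_k * \sum_i l 0 i ^+ k).
    rewrite (eq_bigr _ (fun i _ => horner_coef p (l 0 i))) exchange_big.
    by apply: eq_bigr => k _; rewrite mulr_sumr.
  rewrite (eq_bigr _ (fun i _ => horner_coef p (m 0 i))) exchange_big.
  by apply: eq_bigr => k _; rewrite lm mulr_sumr.
pose s := [seq b <- [seq l 0 i | i <- enum 'I_n] ++ [seq m 0 i | i <- enum 'I_n] | b != a].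
pose p := \prod_(b <- s) ('X - b%:P).
have pa : p.[a] != 0.
  by apply/negP => /eqP/rootP; rewrite root_prod_XsubC mem_filter eqxx.
have sums (q : 'rV[R]_n) : (forall i, q 0 i \in [seq l 0 i | i <- enum 'I_n] ++
  [seq m 0 i | i <- enum 'I_n]) ->
    \sum_i p.[q 0 i] = p.[a] * #|[pred i | q 0 i == a]|%:R.
  move=> qs; rewrite (bigID (fun i => q 0 i == a))/= [X in _ + X]big1 ?addr0.
    rewrite (eq_bigr (fun=> p.[a])) => [|i /eqP ->//].
    by rewrite sumr_const mulr_natr.
  move=> i qa; apply/rootP; rewrite root_prod_XsubC mem_filter qa /=.
  exact: qs.
have := P p; rewrite !sums; last first.
- by move=> i; rewrite mem_cat map_f ?mem_enum.
- by move=> i; rewrite mem_cat orbC map_f ?mem_enum.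
by move/(mulfI pa)/eqP; rewrite eqr_nat => /eqP.
Qed.

Lemma card_power_sums (l m : 'rV[R]_n) :
  (forall a, #|[pred i | l 0 i == a]| = #|[pred i | m 0 i == a]|) ->
  forall k, \sum_i l 0 i ^+ k = \sum_i m 0 i ^+ k.
Proof.
move=> lm k.
have E (q : 'rV[R]_n) : \sum_i q 0 i ^+ k = \sum_(b <- [seq q 0 i | i <- enum 'I_n]) b ^+ k.
  by rewrite big_map big_enum.
rewrite !E; apply: perm_big; apply/allP => a _ /=.
have C (q : 'rV[R]_n) : count_mem a [seq q 0 i | i <- enum 'I_n] = #|[pred i | q 0 i == a]|.
  rewrite count_map cardE /enum_mem size_filter -enumT.
  by rewrite count_filter; apply: eq_count => i /=; rewrite andbT.
by rewrite !C lm.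
Qed.

End Eigenvalues.

(** * Exponential polynomials *)

Section ExponentialPolynomials.
Context {R : realType}.
Implicit Types (p : {poly R}) (s : seq (R * {poly R})) (h : R -> R).

Lemma horner_all_eq0 p : (forall t, p.[t] = 0) -> p = 0.
Proof.
move=> p0; apply: (@roots_geq_poly_eq0 _ _ [seq i%:R | i <- iota 0 (size p)]).
- by apply/allP => x _; apply/rootP.
- by rewrite map_inj_uniq ?iota_uniq//; exact: (mulrIn (oner_neq0 R)).
- by rewrite size_map size_iota.
Qed.

Lemma lead_coef_shift p : lead_coef (p \Po ('X + 1)) = lead_coef p.
Proof.
by rewrite lead_coef_comp ?size_XaddC// lead_coefXaddC expr1n mulr1.
Qed.

Lemma size_shift p : size (p \Po ('X + 1)) = size p.
Proof. by rewrite size_comp_poly2 ?size_XaddC. Qed.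

(** The operator sending h(t) to e^{-m0} h(t + 1) - h(t) replaces each [p m] by [q m]: no size grows
    and that of [p m0] drops, so induction on the total size gives [q = 0] on [mu]. For [m != m0]
    the leading coefficient of [p m] is then fixed by the factor e^{m - m0}, which is not 1, so
    [p m = 0]; the term at [m0] is left alone. *)
Lemma expR_poly_free (mu : seq R) (p : R -> {poly R}) : uniq mu ->
  (forall t, \sum_(m <- mu) (p m).[t] * expR (m * t) = 0) ->
  forall m, m \in mu -> p m = 0.
Proof.
move=> mu_uniq; have [k] := ubnP (\sum_(m <- mu) size (p m)).
elim: k p => // k IH p pk p0.
have [/hasP[m0 m0mu pm0]|/hasPn mu0] := boolP (has (fun m => p m != 0) mu); last first.
  by move=> m /mu0/negPn/eqP.
pose q m := expR (m - m0) *: (p m \Po ('X + 1)) - p m.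
have szq m : (size (q m) <= size (p m))%N.
  by rewrite (leq_trans (size_polyD _ _))// geq_max size_polyN leqnn andbT
             (leq_trans (size_scale_leq _ _))// size_shift.
have szq0 : (size (q m0) < size (p m0))%N.
  have p0gt : (0 < size (p m0))%N by rewrite size_poly_gt0.
  rewrite /q subrr expR0 scale1r -(prednK p0gt) ltnS; apply/leq_sizeP => j.
  rewrite leq_eqVlt => /orP[/eqP <-|]; last first.
    move=> pj; apply/(leq_sizeP _ _ _ _ (leqnn j)).
    by rewrite (leq_trans (size_polyD _ _))// geq_max size_polyN size_shift -(prednK p0gt) pj.
  by rewrite coefB -{1}(size_shift (p m0)) -!lead_coefE lead_coef_shift subrr.
have q0 t : \sum_(m <- mu) (q m).[t] * expR (m * t) = 0.
  transitivity (expR (- m0) * \sum_(m <- mu) (p m).[t + 1] * expR (m * (t + 1)) -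
                \sum_(m <- mu) (p m).[t] * expR (m * t)); last by rewrite !p0 mulr0 subr0.
  rewrite mulr_sumr -sumrB; apply: eq_bigr => m _.
  rewrite /q hornerD hornerN hornerZ horner_comp !hornerE mulrBl; congr (_ - _).
  by rewrite [m * (_ + _)]mulrDr mulr1 !expRD/=; ring.
have {IH}qz := IH q _ q0.
have {}qz m : m \in mu -> q m = 0.
  apply: qz; rewrite ltnS in pk; apply: leq_trans pk.
  by rewrite !(big_rem m0 m0mu)/= -addSn leq_add// leq_sum.
have pm m : m \in mu -> m != m0 -> p m = 0.
  move=> mmu mm0; apply/eqP; rewrite -lead_coef_eq0.
  have : lead_coef (expR (m - m0) *: (p m \Po ('X + 1))) = lead_coef (p m).
    by congr lead_coef; apply/eqP; rewrite -subr_eq0 -/(q m) qz.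
  rewrite lead_coefZ lead_coef_shift => /eqP.
  rewrite -subr_eq0 -{2}[lead_coef _]mul1r -mulrBl mulf_eq0 subr_eq0 => /orP[|//].
  by rewrite -expR0 (inj_eq (@expR_inj _)) subr_eq0 (negbTE mm0).
suff : p m0 = 0 by move/eqP; rewrite (negbTE pm0).
apply: horner_all_eq0 => t; have := p0 t.
rewrite (bigD1_seq m0)//= big1_seq ?addr0; last first.
  by move=> m /andP[mm0 mmu]; rewrite pm// horner0 mul0r.
by move/eqP; rewrite mulf_eq0 expR_eq0 orbF => /eqP.
Qed.

(* The list s of pairs (m, p) encodes the function sum p(t) exp(m t). *)
Definition expoly s t := \sum_(m <- s) m.2.[t] * expR (m.1 * t).

Definition total s := \sum_(m <- s) m.2.

(** A list may repeat an exponent. Grouping by exponent gives polynomials that vanish by freeness,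
    and [total s] is their sum. *)
Lemma expoly_total_eq0 s : (forall t, expoly s t = 0) -> total s = 0.
Proof.
move=> s0; pose mu := undup [seq x.1 | x <- s].
pose p m := \sum_(x <- s | x.1 == m) x.2.
have E (V : nmodType) (f : R * {poly R} -> V) :
    \sum_(m <- mu) \sum_(x <- s | x.1 == m) f x = \sum_(x <- s) f x.
  rewrite (exchange_big_dep predT)//=; apply: eq_big_seq => x xs.
  under eq_bigl do rewrite eq_sym.
  by rewrite -big_filter filter_pred1_uniq ?undup_uniq ?mem_undup ?map_f// big_seq1.
have p0 : forall m, m \in mu -> p m = 0.
  apply: expR_poly_free; first exact: undup_uniq.
  move=> t; rewrite -[RHS](s0 t) /expoly -(E _ (fun x => x.2.[t] * expR (x.1 * t))).
  apply: eq_bigr => m _.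
  rewrite horner_sum mulr_suml; apply: eq_bigr => x /eqP <-; by [].
rewrite /total -(E _ snd) big1_seq// => m /andP[_ /p0]; exact.
Qed.

(* r is the coefficient of t^d left in h(t) = sum p_m(t) exp(m t) once all the
   exponentials are replaced by 1; t^d must be the highest power in sum p_m, but
   not in the individual p_m.  This keeps exp_lead multiplicative. *)
Definition exp_lead d h r := exists s,
  [/\ forall t, h t = expoly s t, (size (total s) <= d.+1)%N & (total s)`_d = r].

(** This is what makes the coefficient depend on the function alone: two different expressions of
    one scalar curvature can be compared. *)
Lemma exp_lead_unique d h r r' : exp_lead d h r -> exp_lead d h r' -> r = r'.
Proof.
move=> [s [hs _ <-]] [s' [hs' _ <-]].
pose s2 := s ++ [seq (x.1, - x.2) | x <- s'].
suff /eqP : total s2 = 0.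
  rewrite /total big_cat big_map /= sumrN subr_eq0 => /eqP.
  by rewrite /total => ->.
apply: expoly_total_eq0 => t; rewrite /expoly big_cat big_map/=.
rewrite [X in _ + X](eq_bigr (fun x => - (x.2.[t] * expR (x.1 * t)))).
  by rewrite sumrN; apply/eqP; rewrite subr_eq0 -[eqbLHS]/(expoly s t) -hs hs'.
by move=> x _; rewrite hornerN mulNr.
Qed.

Lemma exp_lead_ext d h h' r : h =1 h' -> exp_lead d h r -> exp_lead d h' r.
Proof. by move=> hh' [s [hs ? ?]]; exists s; split => // t; rewrite -hh'. Qed.

Lemma exp_leadD d h h' r r' : exp_lead d h r -> exp_lead d h' r' ->
  exp_lead d (fun t => h t + h' t) (r + r').
Proof.
move=> [s [hs sd <-]] [s' [hs' sd' <-]]; exists (s ++ s').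
have E : total (s ++ s') = total s + total s' by rewrite /total big_cat.
split; last by rewrite E coefD.
- by move=> t; rewrite hs hs' /expoly big_cat.
- by rewrite E (leq_trans (size_polyD _ _))// geq_max sd.
Qed.

Lemma exp_leadM d e h h' r r' : exp_lead d h r -> exp_lead e h' r' ->
  exp_lead (d + e) (fun t => h t * h' t) (r * r').
Proof.
move=> [s [hs sd <-]] [s' [hs' sd' <-]].
exists [seq (x.1 + y.1, x.2 * y.2) | x <- s, y <- s'].
have E : total [seq (x.1 + y.1, x.2 * y.2) | x <- s, y <- s'] = total s * total s'.
  rewrite /total big_allpairs_dep/= mulr_suml; apply: eq_bigr => x _.
  by rewrite mulr_sumr.
split; rewrite ?E.
- move=> t; rewrite hs hs' /expoly big_allpairs_dep mulr_suml; apply: eq_bigr => x _.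
  rewrite mulr_sumr; apply: eq_bigr => y _.
  by rewrite /= hornerM mulrDl expRD; ring.
- rewrite (leq_trans (size_polyMleq _ _))//.
  have := leq_add sd sd'; rewrite addSn addnS.
  by case: (_ + _)%N => //= k; rewrite ltnS.
have dde : (d < (d + e).+1)%N by rewrite ltnS leq_addr.
rewrite coefM (bigD1 (Ordinal dde))//= addKn big1 ?addr0// => i.
rewrite -val_eqE/=.
rewrite neq_ltn => /orP[ltid|gtid].
  rewrite [X in _ * X]nth_default ?mulr0// (leq_trans sd')//.
  by rewrite ltn_subRL ltn_add2r.
by rewrite nth_default ?mul0r// (leq_trans sd).
Qed.

Lemma exp_lead_cst r : exp_lead 0 (fun=> r) r.
Proof.
exists [:: (0, r%:P)]; rewrite /total big_seq1/= size_polyC_leq1 coefC; split => // t.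
by rewrite /expoly big_seq1/= hornerC mul0r expR0 mulr1.
Qed.

Lemma exp_lead_expR m : exp_lead 0 (fun t => expR (m * t)) 1.
Proof.
exists [:: (m, 1)]; rewrite /total big_seq1/= size_poly1 coef1; split => // t.
by rewrite /expoly big_seq1/= hornerC mul1r.
Qed.

Lemma exp_lead_id : exp_lead 1 id 1.
Proof.
exists [:: (0, 'X)]; rewrite /total big_seq1/= size_polyX coefX; split => // t.
by rewrite /expoly big_seq1/= hornerX mul0r expR0 mulr1.
Qed.

(** Raising the reference degree turns the coefficient into 0: this is how every contribution of
    lower order is discarded. *)
Lemma exp_leadS d h r : exp_lead d h r -> exp_lead d.+1 h 0.
Proof.
move=> [s [hs sd _]]; exists s; split=> //; first exact: leqW.
by rewrite nth_default.
Qed.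

Lemma exp_lead0 d : exp_lead d (fun=> 0) 0.
Proof. by elim: d => [|d IH]; [exact: exp_lead_cst|exact: exp_leadS IH]. Qed.

Lemma exp_leadZ d c h r : exp_lead d h r -> exp_lead d (fun t => c * h t) (c * r).
Proof. exact: (exp_leadM (exp_lead_cst c)). Qed.

Lemma exp_leadN d h r : exp_lead d h r -> exp_lead d (fun t => - h t) (- r).
Proof.
move=> /(exp_leadZ (-1)); rewrite mulN1r.
by apply: exp_lead_ext => t; rewrite mulN1r.
Qed.

Lemma exp_leadB d h h' r r' : exp_lead d h r -> exp_lead d h' r' ->
  exp_lead d (fun t => h t - h' t) (r - r').
Proof. by move=> hr /exp_leadN; exact: exp_leadD. Qed.

Lemma exp_lead_sum (I : Type) (l : seq I) d (h : I -> R -> R) (r : I -> R) :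
  (forall i, exp_lead d (h i) (r i)) ->
  exp_lead d (fun t => \sum_(i <- l) h i t) (\sum_(i <- l) r i).
Proof.
move=> hr; elim: l => [|i l IH].
  by rewrite big_nil; apply: exp_lead_ext (exp_lead0 d) => t; rewrite big_nil.
rewrite big_cons; apply: exp_lead_ext (exp_leadD (hr i) IH) => t.
by rewrite big_cons.
Qed.

Definition exp_leadmx m n d (M : R -> 'M[R]_(m, n)) (S : 'M[R]_(m, n)) :=
  forall i j, exp_lead d (fun t => M t i j) (S i j).

Lemma exp_leadmx_cst m n (S : 'M[R]_(m, n)) : exp_leadmx 0 (fun=> S) S.
Proof. by move=> i j; exact: exp_lead_cst. Qed.

Lemma exp_leadmxS m n d M (S : 'M[R]_(m, n)) : exp_leadmx d M S -> exp_leadmx d.+1 M 0.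
Proof. by move=> MS i j; rewrite mxE; exact: exp_leadS (MS i j). Qed.

Lemma exp_leadmxD m n d M M' (S S' : 'M[R]_(m, n)) : exp_leadmx d M S ->
  exp_leadmx d M' S' -> exp_leadmx d (fun t => M t + M' t) (S + S').
Proof.
move=> MS MS' i j; rewrite mxE; apply: exp_lead_ext (exp_leadD (MS i j) (MS' i j)) => t.
by rewrite mxE.
Qed.

Lemma exp_leadmxN m n d M (S : 'M[R]_(m, n)) : exp_leadmx d M S ->
  exp_leadmx d (fun t => - M t) (- S).
Proof.
move=> MS i j; rewrite mxE; apply: exp_lead_ext (exp_leadN (MS i j)) => t.
by rewrite mxE.
Qed.

Lemma exp_leadmxB m n d M M' (S S' : 'M[R]_(m, n)) : exp_leadmx d M S ->
  exp_leadmx d M' S' -> exp_leadmx d (fun t => M t - M' t) (S - S').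
Proof. by move=> MS /exp_leadmxN; exact: exp_leadmxD. Qed.

Lemma exp_leadmxT m n d M (S : 'M[R]_(m, n)) : exp_leadmx d M S ->
  exp_leadmx d (fun t => (M t)^T) S^T.
Proof.
by move=> MS i j; rewrite mxE; apply: exp_lead_ext (MS j i) => t; rewrite mxE.
Qed.

Lemma exp_leadmxM m n q d e M M' (S : 'M[R]_(m, n)) (S' : 'M[R]_(n, q)) :
  exp_leadmx d M S -> exp_leadmx e M' S' ->
  exp_leadmx (d + e) (fun t => M t *m M' t) (S *m S').
Proof.
move=> MS MS' i j; rewrite mxE.
apply: exp_lead_ext (exp_lead_sum (index_enum 'I_n)
  (fun k => exp_leadM (MS i k) (MS' k j))) => t.
by rewrite mxE.
Qed.

Lemma exp_leadmx_tr n d M (S : 'M[R]_n) : exp_leadmx d M S ->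
  exp_lead d (fun t => \tr (M t)) (\tr S).
Proof. by move=> MS; apply: exp_lead_sum. Qed.

End ExponentialPolynomials.

(** * Exponentials of diagonal matrices and of commuting nilpotent perturbations *)

Section ExpmxNilpotent.
Context {R : realType}.

Lemma expmx_diag n (l : 'rV[R]_n) : expmx (diag_mx l) = diag_mx (map_mx expR l).
Proof.
have E k : (diag_mx l) ^+ k = diag_mx (map_mx (fun x => x ^+ k) l).
  elim: k => [|k IH].
    rewrite expr0 (_ : map_mx _ l = const_mx 1) ?diag_const_mx//.
    by apply/rowP => i; rewrite !mxE expr0.
  rewrite exprSr IH [LHS]mulmx_diag; congr diag_mx.
  by apply/rowP => i; rewrite !mxE exprSr.
suff : series (expmx_coeff (diag_mx l)) @ \oo --> diag_mx (map_mx expR l).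
  by move=> h; exact: (cvg_unique _ (@cvg_expmx _ _ _) h).
apply/cvg_mxP => i j.
rewrite (_ : (fun k => _) = fun k => series (exp_coeff (l 0 i)) k *+ (i == j)); last first.
  apply/funext => k; rewrite /series/= summxE -sumrMnl; apply: eq_bigr => m _.
  by rewrite /expmx_coeff E !mxE /exp_coeff/= mulrC -mulrnAl; case: eqP => [->|].
rewrite !mxE; apply: cvgMn.
exact: is_cvg_series_exp_coeff.
Qed.

Lemma expmx_coeffS n (A : 'M[R]_n) k :
  k.+1%:R *: expmx_coeff A k.+1 = expmx_coeff A k *m A.
Proof.
rewrite /expmx_coeff scalerA factS natrM invfM mulrA mulfV ?pnatr_eq0// mul1r.
by rewrite exprSr scalemxAl.
Qed.

(** The binomial expansion for commuting matrices stops at [N *m N]. It is proved coefficient by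
    coefficient from the recursion [expmx_coeffS]; the factors [N] and [N *m N] lower the index by
    one and two, hence the formulas at [k.+2]. Index 3 of nilpotency is what second derivatives
    require. *)
Lemma expmx_nil n (S N : 'M[R]_n) : S *m N = N *m S -> N *m N *m N = 0 ->
  expmx (S + N) = expmx S *m (1%:M + N + 2^-1 *: (N *m N)).
Proof.
move=> SN N3.
have cN k : expmx_coeff S k *m N = N *m expmx_coeff S k.
  by rewrite /expmx_coeff -scalemxAl -scalemxAr (exprmx_comm _ SN).
have c0 (A : 'M[R]_n) : expmx_coeff A 0 = 1%:M.
  by rewrite /expmx_coeff fact0 invr1 scale1r.
have c1 (A : 'M[R]_n) : expmx_coeff A 1 = A.
  by rewrite /expmx_coeff factS fact0 muln1 invr1 scale1r.
have cE k : expmx_coeff (S + N) k.+2 =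
    expmx_coeff S k.+2 + expmx_coeff S k.+1 *m N +
    2^-1 *: (expmx_coeff S k *m (N *m N)).
  elim: k => [|k IH].
    apply: (scalerI (_ : 2 != 0 :> R)); first by rewrite pnatr_eq0.
    rewrite expmx_coeffS !c1 !scalerDr expmx_coeffS c1 c0 mul1mx.
    rewrite scalerA mulfV ?pnatr_eq0// scale1r mulmxDl !mulmxDr SN.
    by rewrite scaler_nat mulr2n !addrA.
  apply: (scalerI (_ : k.+3%:R != 0 :> R)); first by rewrite pnatr_eq0.
  rewrite expmx_coeffS IH !scalerDr expmx_coeffS !mulmxDl !mulmxDr.
  have X1 : expmx_coeff S k.+1 *m N *m S = (k.+2%:R : R) *: (expmx_coeff S k.+2 *m N).
    by rewrite -mulmxA -SN mulmxA -expmx_coeffS scalemxAl.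
  have X2 : expmx_coeff S k *m (N *m N) *m S = (k.+1%:R : R) *: (expmx_coeff S k.+1 *m (N *m N)).
    by rewrite -!mulmxA -SN (mulmxA N S) -SN !mulmxA -expmx_coeffS -!scalemxAl.
  have X3 : 2^-1 *: (expmx_coeff S k *m (N *m N)) *m N = 0.
    by rewrite -scalemxAl -mulmxA N3 mulmx0 scaler0.
  have X4 : 2^-1 *: (expmx_coeff S k *m (N *m N)) *m S =
      (2^-1 * k.+1%:R) *: (expmx_coeff S k.+1 *m (N *m N)).
    by rewrite -[LHS]scalemxAl X2 scalerA.
  rewrite X1 X3 X4 -(mulmxA _ N N) addr0 !scalerA.
  move: (expmx_coeff S k.+2 *m S) (expmx_coeff S k.+2 *m N) (expmx_coeff S k.+1 *m (N *m N)).
  move=> a b c; apply/matrixP => i j; rewrite !mxE -[k.+3]addn3 -[k.+2]addn2 -[k.+1]addn1 !natrD.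
  by field.
pose f k := series (expmx_coeff S) k.
have sE k : series (expmx_coeff (S + N)) k.+2 =
    f k.+2 + f k.+1 *m N + 2^-1 *: (f k *m (N *m N)).
  elim: k => [|k IH].
    have s0 (A : 'M[R]_n) : series (expmx_coeff A) 0 = 0 by rewrite /series/= big_geq.
    rewrite /f !seriesSr !s0 !add0r !c0 !c1 mul1mx mul0mx scaler0 addr0.
    by rewrite addrA.
  have fS m : f m.+1 = f m + expmx_coeff S m by rewrite /f seriesSr.
  have E2 : f k.+2 *m N = f k.+1 *m N + expmx_coeff S k.+1 *m N.
    by rewrite fS mulmxDl.
  have E3 : f k.+1 *m (N *m N) = f k *m (N *m N) + expmx_coeff S k *m (N *m N).
    by rewrite fS mulmxDl.
  rewrite seriesSr IH cE (fS k.+2) E2 E3 scalerDr.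
  move: (f _) (_ *m N) (_ *m N) (_ *m (N *m N)) (_ *m (N *m N)) => a b c d e.
  by apply/matrixP => i j; rewrite !mxE; ring.
have cf : f @ \oo --> expmx S := @cvg_expmx _ _ _.
have cfS j : (fun k => f (k + j)%N) @ \oo --> expmx S by apply: (cvg_comp _ _ _ cf); exact:
  cvg_addnr.
suff h : (fun k => series (expmx_coeff (S + N)) (k + 2)%N) @ \oo -->
    expmx S *m (1%:M + N + 2^-1 *: (N *m N)).
  have h2 : (fun k => series (expmx_coeff (S + N)) (k + 2)%N) @ \oo --> expmx (S + N).
    by apply: (cvg_comp _ _ _ (@cvg_expmx _ _ _)); exact: cvg_addnr.
  exact: (cvg_unique _ h2 h).
rewrite !mulmxDr mulmx1 -scalemxAr.
rewrite (_ : (fun k => _) = fun k => f (k + 2)%N + mulmxr N (f (k + 1)%N) +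
   2^-1 *: mulmxr (N *m N) (f (k + 0)%N)); last first.
  by apply/funext => k; rewrite addn2 sE addn1 addn0.
apply: cvgD; first apply: cvgD => //.
  by apply: continuous_cvg; [exact: mx_linear_continuous|exact: cfS].
apply: cvgZl_tmp.
by apply: continuous_cvg; [exact: mx_linear_continuous|exact: cfS].
Qed.

Lemma expmx_conj n (K A B : 'M[R]_n) : K \in unitmx -> K *m A = B *m K ->
  expmx A = invmx K *m expmx B *m K.
Proof.
move=> Ku KA; rewrite -mulmxA; apply: (can_inj (mulKmx Ku)); rewrite mulKVmx//.
by rewrite (@expmx_comm _ _ _ B A K).
Qed.

End ExpmxNilpotent.

(** * Leading coefficients of exponentials of block matrices *)

Section ExpmxLead.
Context {R : realType}.

Definition diagonalizes n (Q D : 'M[R]_n) (l : 'rV[R]_n) :=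
  Q \in unitmx /\ Q *m D = diag_mx l *m Q.

Lemma diagonalizesZ n (Q D : 'M[R]_n) l c :
  diagonalizes Q D l -> diagonalizes Q (c *: D) (c *: l).
Proof. by move=> [Qu QD]; split=> //; rewrite -scalemxAr QD linearZ/= scalemxAl. Qed.

Lemma diagonalizes_block n (Q D : 'M[R]_n) l : diagonalizes Q D l ->
  diagonalizes (block_mx Q 0 0 Q) (block_mx D 0 0 D) (row_mx l l).
Proof.
move=> [Qu QD]; split; first by rewrite unitmxE det_ublock unitrM -unitmxE Qu.
by rewrite diag_mx_row !mulmx_block !(mulmx0, mul0mx, addr0, add0r) QD.
Qed.

(** With the exponentials replaced by 1, the conjugate of [diag_mx (map_mx expR (t *: l))] by [Q]
    becomes the identity. *)
Lemma exp_leadmx_expmx n (Q D : 'M[R]_n) l : diagonalizes Q D l ->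
  exp_leadmx 0 (fun t => expmx (t *: D)) 1%:M.
Proof.
move=> Ql; have [Qu _] := Ql.
have E t : expmx (t *: D) = invmx Q *m diag_mx (map_mx expR (t *: l)) *m Q.
  have [_ QD] := diagonalizesZ t Ql.
  by rewrite -expmx_diag; exact: expmx_conj.
have L : exp_leadmx 0 (fun t => diag_mx (map_mx expR (t *: l))) 1%:M.
  move=> i j; rewrite !mxE; case: (eqVneq i j) => [<-|ij].
    apply: exp_lead_ext (exp_lead_expR (l 0 i)) => t.
    by rewrite !mxE eqxx mulr1n mulrC.
  apply: exp_lead_ext (exp_lead0 0) => t.
  by rewrite !mxE (negbTE ij) mulr0n.
have := exp_leadmxM (exp_leadmxM (exp_leadmx_cst (invmx Q)) L) (exp_leadmx_cst Q).
rewrite mulmx1 mulVmx// => H i j; apply: exp_lead_ext (H i j) => t.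
by rewrite E.
Qed.

Lemma exp_leadmx_ext m n d (M M' : R -> 'M[R]_(m, n)) S :
  M =1 M' -> exp_leadmx d M S -> exp_leadmx d M' S.
Proof. by move=> MM' H i j; apply: exp_lead_ext (H i j) => t; rewrite MM'. Qed.

Lemma exp_leadmxZ m n d e (f : R -> R) r (M : R -> 'M[R]_(m, n)) S :
  exp_lead d f r -> exp_leadmx e M S ->
  exp_leadmx (d + e) (fun t => f t *: M t) (r *: S).
Proof.
move=> fr MS i j; rewrite mxE; apply: exp_lead_ext (exp_leadM fr (MS i j)) => t.
by rewrite mxE.
Qed.

Lemma expmx_nilZ n (S N : 'M[R]_n) t : S *m N = N *m S -> N *m N *m N = 0 ->
  expmx (t *: (S + N)) =
  expmx (t *: S) *m (1%:M + t *: N + (2^-1 * t ^+ 2) *: (N *m N)).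
Proof.
move=> SN N3; rewrite scalerDr expmx_nil.
- by rewrite -scalemxAl -scalemxAr !scalerA expr2 mulrA.
- by rewrite -!scalemxAl -!scalemxAr SN.
- by rewrite -!scalemxAl -!scalemxAr -!scalemxAl N3 !scaler0.
Qed.

Lemma exp_leadmx_nil1 n (Q S N : 'M[R]_n) l : diagonalizes Q S l ->
  S *m N = N *m S -> N *m N = 0 ->
  exp_leadmx 1 (fun t => expmx (t *: (S + N))) N.
Proof.
move=> Ql SN N2.
have H : exp_leadmx 1 (fun t => 1%:M + t *: N) N.
  have := exp_leadmxD (exp_leadmxS (exp_leadmx_cst 1%:M))
    (exp_leadmxZ exp_lead_id (exp_leadmx_cst N)).
  by rewrite scale1r add0r.
have := exp_leadmxM (exp_leadmx_expmx Ql) H; rewrite mul1mx.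
apply: exp_leadmx_ext => t.
by rewrite expmx_nilZ ?N2 ?mul0mx// scaler0 addr0.
Qed.

Lemma exp_leadmx_nil2 n (Q S N : 'M[R]_n) l : diagonalizes Q S l ->
  S *m N = N *m S -> N *m N *m N = 0 ->
  exp_leadmx 2 (fun t => expmx (t *: (S + N))) (2^-1 *: (N *m N)).
Proof.
move=> Ql SN N3.
have H : exp_leadmx 2 (fun t => 1%:M + t *: N + (2^-1 * t ^+ 2) *: (N *m N)) (2^-1 *: (N *m N)).
  have H1 := exp_leadmxD (exp_leadmxS (exp_leadmx_cst 1%:M))
    (exp_leadmxZ exp_lead_id (exp_leadmx_cst N)).
  have H2 := exp_leadmxZ (exp_leadM (exp_lead_cst 2^-1) (exp_leadM exp_lead_id exp_lead_id))
    (exp_leadmx_cst (N *m N)).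
  by have := exp_leadmxD (exp_leadmxS H1) H2; rewrite !mulr1 add0r.
have := exp_leadmxM (exp_leadmx_expmx Ql) H; rewrite mul1mx.
by apply: exp_leadmx_ext => t; rewrite expmx_nilZ.
Qed.

Lemma exp_leadmx_ur m1 m2 n1 n2 d (M : R -> 'M[R]_(m1 + m2, n1 + n2)) S :
  exp_leadmx d M S -> exp_leadmx d (fun t => ursubmx (M t)) (ursubmx S).
Proof. by move=> H i j; rewrite !mxE; apply: exp_lead_ext (H _ _) => t; rewrite !mxE. Qed.

Lemma exp_leadmx_conj n (K A B S : 'M[R]_n) d : K \in unitmx -> K *m A = B *m K ->
  exp_leadmx d (fun t => expmx (t *: B)) S ->
  exp_leadmx d (fun t => expmx (t *: A)) (invmx K *m S *m K).
Proof.
move=> Ku KA H.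
have := exp_leadmxM (exp_leadmxM (exp_leadmx_cst (invmx K)) H) (exp_leadmx_cst K).
rewrite add0n addn0; apply: exp_leadmx_ext => t.
by rewrite -(@expmx_conj _ _ K (t *: A) (t *: B) Ku)// -scalemxAr KA scalemxAl.
Qed.

Lemma block_unipotent_unit n (U W : 'M[R]_n) : U \in unitmx ->
  (block_mx U W 0 U : 'M[R]_(n + n)) \in unitmx.
Proof. by move=> Uu; rewrite unitmxE det_ublock unitrM -unitmxE Uu. Qed.

(** The corner is the derivative of [expmx] at [D] in the direction [X + [D, W]]. Conjugation by the
    unipotent [K] removes the commutator, and what is left is the exponential of a commuting
    nilpotent perturbation. *)
Lemma expmx_block_ur n (D X W : 'M[R]_n) : D *m X = X *m D ->
  ursubmx (expmx (block_mx D (X + (D *m W - W *m D)) 0 D : 'M[R]_(n + n))) =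
  expmx D *m X + (expmx D *m W - W *m expmx D).
Proof.
move=> DX.
pose K : 'M[R]_(n + n) := block_mx 1%:M (- W) 0 1%:M.
have E : block_mx D (X + (D *m W - W *m D)) 0 D *m K = K *m block_mx D X 0 D.
  rewrite /K !mulmx_block !(mulmx0, mul0mx, mul1mx, mulmx1, addr0, add0r).
  by rewrite mulmxN mulNmx addrCA addKr addrC.
have := expmx_comm E.
have -> : expmx (block_mx D X 0 D : 'M[R]_(n + n)) = block_mx (expmx D) (expmx D *m X) 0 (expmx D).
  rewrite (_ : block_mx D X 0 D = block_mx D 0 0 D + block_mx 0 X 0 0); last first.
    by rewrite add_block_mx !addr0 add0r.
  rewrite expmx_nil.
  - rewrite mulmx_block !(mulmx0, mul0mx, addr0) block_mx0 scaler0 addr0.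
    rewrite scalar_mx_block add_block_mx !addr0 !add0r expmx_block mulmx_block.
    by rewrite !(mulmx0, mul0mx, mulmx1, addr0, add0r).
  - by rewrite !mulmx_block !(mulmx0, mul0mx, addr0, add0r) DX.
  - by rewrite !mulmx_block !(mulmx0, mul0mx, addr0) block_mx0.
rewrite -[X in X *m _ = _ -> _]submxK /K !mulmx_block.
rewrite !(mulmx0, mul0mx, mul1mx, mulmx1, addr0, add0r) => /eq_block_mx[-> {}E _ _].
rewrite mulmxN mulNmx in E.
by rewrite [RHS]addrCA -E addNKr.
Qed.

(** The commutator part is removed by conjugation with [K], and [K] fixes the nilpotent block [N] on
    both sides; hence [W] leaves no trace in the coefficient. *)
Lemma exp_leadmx_derive1 n (Q D X W : 'M[R]_n) l : diagonalizes Q D l ->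
  D *m X = X *m D ->
  exp_leadmx 1 (fun t => ursubmx (expmx
    (t *: (block_mx D (X + (D *m W - W *m D)) 0 D : 'M[R]_(n + n))))) X.
Proof.
move=> Ql DX.
pose N : 'M[R]_(n + n) := block_mx 0 X 0 0.
have H : exp_leadmx 1 (fun t => expmx (t *: (block_mx D 0 0 D + N))) N.
  apply: exp_leadmx_nil1 (diagonalizes_block Ql) _ _.
  - by rewrite !mulmx_block !(mulmx0, mul0mx, addr0, add0r) DX.
  - by rewrite !mulmx_block !(mulmx0, mul0mx, addr0) block_mx0.
pose K : 'M[R]_(n + n) := block_mx 1%:M W 0 1%:M.
have Ku : K \in unitmx by apply: block_unipotent_unit; rewrite unitmx1.
have KN : K *m N = N /\ N *m K = N.
  by rewrite /K /N !mulmx_block !mulmx0 !mul0mx mulmx1 mul1mx !addr0 !add0r.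
have E : K *m block_mx D (X + (D *m W - W *m D)) 0 D = (block_mx D 0 0 D + N) *m K.
  rewrite /K /N add_block_mx !addr0 !add0r !mulmx_block !mulmx0 !mul0mx !mulmx1 !mul1mx.
  by rewrite !addr0 !add0r addrA subrK addrC.
have := exp_leadmx_ur (exp_leadmx_conj Ku E H).
by rewrite -mulmxA KN.2 -{1}KN.1 mulKmx// block_mxKur.
Qed.

(* The doubly nested block matrix computes a second partial derivative of
   expmx (t *: D), whose first-order data are X + [D, W] and Y + [D, V]. *)
Lemma exp_leadmx_derive2 n (Q D X Y W V C : 'M[R]_n) l : diagonalizes Q D l ->
  D *m X = X *m D -> D *m Y = Y *m D ->
  exp_leadmx 2 (fun t => ursubmx (ursubmx (expmx
    (t *: (block_mx (block_mx D (X + (D *m W - W *m D)) 0 D)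
            (block_mx (Y + (D *m V - V *m D)) C 0 (Y + (D *m V - V *m D))) 0
            (block_mx D (X + (D *m W - W *m D)) 0 D)
           : 'M[R]_((n + n) + (n + n)))))))
    (2^-1 *: (X *m Y + Y *m X)).
Proof.
move=> Ql DX DY.
set A := X + _; set B := Y + _.
have [Qu QD] := Ql.
(* The terms added to [C] are those created by conjugating with [U] and [V1]. After this splitting
   [C] survives only through [Z], a corner of [L1] that disappears from [N *m N]. *)
have [Z [V2 [ZD E2]]] := commutant_split Qu QD (C + W *m B - B *m W + V *m X - X *m V).
pose O : 'M[R]_n := 0.
pose M : 'M[R]_(n + n) := block_mx D A 0 D.
pose M1 : 'M[R]_(n + n) := block_mx D X 0 D.
pose U : 'M[R]_(n + n) := block_mx 1%:M W 0 1%:M.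
pose L : 'M[R]_(n + n) := block_mx B C 0 B.
pose L1 : 'M[R]_(n + n) := block_mx Y Z 0 Y.
pose V1 : 'M[R]_(n + n) := block_mx V V2 0 V.
pose D2 : 'M[R]_(n + n) := block_mx D 0 0 D.
pose N1 : 'M[R]_(n + n) := block_mx 0 X 0 0.
pose P : 'M[R]_(n + n) := block_mx 0 (X *m Y + Y *m X) 0 0.
pose S : 'M[R]_((n + n) + (n + n)) := block_mx D2 0 0 D2.
pose N : 'M[R]_((n + n) + (n + n)) := block_mx N1 L1 0 N1.
pose NN : 'M[R]_((n + n) + (n + n)) := block_mx 0 P 0 0.
pose K : 'M[R]_((n + n) + (n + n)) := block_mx U (V1 *m U) 0 U.
have simp0 := (mulmx0, mul0mx, mulmx1, mul1mx, addr0, add0r).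
have simp := (simp0, mulmx_block).
have Uu : U \in unitmx by apply: block_unipotent_unit; rewrite unitmx1.
have Ku : K \in unitmx by exact: block_unipotent_unit.
have NNE : N *m N = NN.
  by rewrite /N /NN /P /N1 /L1 !simp add_block_mx !simp block_mx0.
have N3 : N *m N *m N = 0.
  by rewrite NNE /NN /N /P /N1 !simp !block_mx0.
have D2N1 : D2 *m N1 = N1 *m D2 by rewrite /D2 /N1 !simp DX.
have D2L1 : D2 *m L1 = L1 *m D2 by rewrite /D2 /L1 !simp DY ZD.
have SN : S *m N = N *m S.
  by rewrite [S *m N]mulmx_block [N *m S]mulmx_block !simp0 D2N1 D2L1.
have UM : U *m M = M1 *m U.
  by rewrite /U /M /M1 !simp /A addrA subrK addrC.
have UL : U *m L + V1 *m U *m M = (M1 *m V1 + L1) *m U.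
  have -> : V1 *m U *m M = V1 *m M1 *m U by rewrite -mulmxA UM mulmxA.
  rewrite /U /L /V1 /M1 /L1 !simp !add_block_mx !simp; congr block_mx.
  - by rewrite /B addrA subrK addrC.
  - have EV : B + V *m D = D *m V + Y by rewrite /B addrA subrK addrC.
    rewrite -EV mulmxDl.
    have -> : C = Z + (D *m V2 - V2 *m D) - W *m B + B *m W - V *m X + X *m V.
      rewrite -E2; move: (W *m B) (B *m W) (V *m X) (X *m V) => *.
      by apply/matrixP => i j; rewrite !mxE; ring.
    move: (D *m V2) (V2 *m D) (W *m B) (B *m W) (V *m X) (X *m V) (V *m D *m W).
    by move=> *; apply/matrixP => i j; rewrite !mxE; ring.
  - by rewrite /B addrA subrK addrC.
have KM : K *m block_mx M L 0 M = (S + N) *m K.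
  have M1E : D2 + N1 = M1 by rewrite /D2 /N1 add_block_mx !simp0.
  have -> : S + N = block_mx M1 L1 0 M1 by rewrite [LHS]add_block_mx !simp0 M1E.
  rewrite [LHS]mulmx_block [RHS]mulmx_block !simp0 UM; congr block_mx.
  by rewrite UL mulmxDl mulmxA.
have UP : U *m P = P by rewrite /U /P !simp.
have PU : P *m U = P by rewrite /U /P !simp.
have KNN : K *m NN = NN by rewrite [LHS]mulmx_block !simp0 UP.
have NNK : NN *m K = NN by rewrite [LHS]mulmx_block !simp0 PU.
have H := exp_leadmx_nil2 (diagonalizes_block (diagonalizes_block Ql)) SN N3.
have := exp_leadmx_ur (exp_leadmx_ur (exp_leadmx_conj Ku KM H)).
rewrite NNE -mulmxA -scalemxAl NNK -scalemxAr -{1}KNN mulKmx//.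
by rewrite /NN /P !scale_block_mx !block_mxKur.
Qed.

End ExpmxLead.

(** * Partial derivatives of matrix fields *)

Section IsDerive.
Context {R : realType} {V : normedModType R}.
Implicit Types (f g : V -> R) (x v : V).

Lemma is_derive_mulr f g x v df dg : is_derive x v f df -> is_derive x v g dg ->
  is_derive x v (fun y => f y * g y) (df * g x + f x * dg).
Proof.
move=> fx gx; apply: (is_derive_eq (is_deriveM fx gx)).
by rewrite addrC /GRing.scale/= [df * _]mulrC.
Qed.

Lemma is_derive_bigsum (I : Type) (r : seq I) (h : I -> V -> R) x v (dh : I -> R) :
  (forall i, is_derive x v (h i) (dh i)) ->
  is_derive x v (fun y => \sum_(i <- r) h i y) (\sum_(i <- r) dh i).
Proof.
move=> H; elim: r => [|i r IH].
  rewrite big_nil (_ : (fun _ => _) = cst 0); first exact: is_derive_cst.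
  by apply/funext => y; rewrite big_nil.
rewrite big_cons (_ : (fun _ => _) = h i + (fun y => \sum_(j <- r) h j y)).
  exact: is_deriveD.
by apply/funext => y; rewrite big_cons.
Qed.

Lemma is_derive_mxP m n (M : V -> 'M[R]_(m, n)) x v dM :
  is_derive x v M dM <-> forall i j, is_derive x v (fun y => M y i j) (dM i j).
Proof.
split=> [[Mx <-] i j|H].
  by apply: DeriveDef; [exact: (derivable_mxP _ _ _).1|rewrite derive_mx// mxE].
have Mx : derivable M x v by apply/derivable_mxP => i j; have [] := H i j.
apply: DeriveDef => //; rewrite derive_mx//; apply/matrixP => i j; rewrite mxE.
by have [_] := H i j.
Qed.

Lemma is_derive_mulmx m n p (M : V -> 'M[R]_(m, n)) (N : V -> 'M[R]_(n, p)) x v dM dN :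
  is_derive x v M dM -> is_derive x v N dN ->
  is_derive x v (fun y => M y *m N y) (dM *m N x + M x *m dN).
Proof.
move=> /is_derive_mxP Mx /is_derive_mxP Nx; apply/is_derive_mxP => i j.
rewrite mxE [X in X + _]mxE [X in _ + X]mxE -big_split/=.
rewrite (_ : (fun y => _) = fun y => \sum_k M y i k * N y k j); last first.
  by apply/funext => y; rewrite mxE.
by apply: is_derive_bigsum => k; exact: is_derive_mulr.
Qed.

Lemma is_derive_trmx m n (M : V -> 'M[R]_(m, n)) x v dM :
  is_derive x v M dM -> is_derive x v (fun y => (M y)^T) dM^T.
Proof.
move=> /is_derive_mxP Mx; apply/is_derive_mxP => i j; rewrite mxE.
rewrite (_ : (fun y => _) = fun y => M y j i); first exact: Mx.
by apply/funext => y; rewrite mxE.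
Qed.

Lemma is_derive_mxtrace n (M : V -> 'M[R]_n) x v dM :
  is_derive x v M dM -> is_derive x v (fun y => \tr (M y)) (\tr dM).
Proof. by move=> /is_derive_mxP Mx; exact: is_derive_bigsum. Qed.

Lemma is_derive_exp n (M : V -> 'M[R]_n) x v dM k : is_derive x v M dM ->
  is_derive x v (fun y => M y ^+ k) (\sum_(i < k) M x ^+ i *m dM *m M x ^+ (k - i.+1)).
Proof.
move=> Mx; elim: k => [|k IH]; first by rewrite big_ord0; exact: is_derive_cst.
rewrite (_ : (fun y => _) = fun y => M y ^+ k *m M y); last first.
  by apply/funext => y; rewrite exprSr.
apply: (is_derive_eq (is_derive_mulmx IH Mx)).
rewrite big_ord_recr/= subnn mulmx1; congr (_ + _).
rewrite mulmx_suml; apply: eq_bigr => i _.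
by rewrite -!mulmxA; congr (_ *m (_ *m _)); rewrite subSn// exprSr.
Qed.

End IsDerive.

Section Smooth.
Context {R : realType} {n : nat}.
Variable U : set 'rV[R]_n.
Hypothesis oU : open U.
Implicit Types f g : 'rV[R]_n -> R.

(* Only derivatives along coordinate directions are required: weaker than C^k
   smoothness, but enough for Christoffel symbols and curvature. *)
Fixpoint dC k f : Prop := if k is k'.+1 then
  forall i, (forall x, U x -> derivable f x (frame R i)) /\ dC k' (fun x => 'D_(frame R i) f x)
  else True.

Lemma dC_mono k f : dC k.+1 f -> dC k f.
Proof.
elim: k f => //= k IH f H i; have [fd fk] := H i; split=> //; exact: IH.
Qed.

Lemma near_open x : U x -> \forall y \near x, U y.
Proof. by move=> Ux; apply: open_nbhs_nbhs. Qed.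

Lemma dC_ext k f g : (forall x, U x -> f x = g x) -> dC k f -> dC k g.
Proof.
elim: k f g => //= k IH f g fg H i; have [fd fk] := H i.
have fgn x : U x -> {near x, f =1 g}.
  by move=> Ux; near=> y; apply: fg; near: y; exact: near_open.
split=> [x Ux|]; first exact: near_eq_derivable (fgn _ Ux) (fd x Ux).
apply: IH fk => x Ux; exact: near_eq_derive (fgn _ Ux).
Unshelve. all: by end_near. Qed.

Lemma dC_cst k c : dC k (fun=> c).
Proof.
elim: k c => //= k IH c i; split=> [x _|]; first exact: derivable_cst.
by apply: dC_ext (IH 0) => x _; rewrite derive_cst.
Qed.

Lemma dCD k f g : dC k f -> dC k g -> dC k (fun x => f x + g x).
Proof.
elim: k f g => //= k IH f g Hf Hg i; have [fd fk] := Hf i; have [gd gk] := Hg i.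
split=> [x Ux|]; first exact: derivableD (fd x Ux) (gd x Ux).
apply: dC_ext (IH _ _ fk gk) => x Ux.
by rewrite -deriveD; [|exact: fd|exact: gd].
Qed.

Lemma dCM k f g : dC k f -> dC k g -> dC k (fun x => f x * g x).
Proof.
elim: k f g => // k IH f g Hf Hg i; have [fd fk] := Hf i; have [gd gk] := Hg i.
have fx x : U x -> is_derive x (frame R i) f ('D_(frame R i) f x) by move=> /fd/derivableP.
have gx x : U x -> is_derive x (frame R i) g ('D_(frame R i) g x) by move=> /gd/derivableP.
split=> [x Ux|]; first by have [] := is_derive_mulr (fx x Ux) (gx x Ux).
apply: dC_ext (dCD (IH _ _ fk (dC_mono Hg)) (IH _ _ (dC_mono Hf) gk)) => x Ux.
by have [_ ->] := is_derive_mulr (fx x Ux) (gx x Ux).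
Qed.

Lemma dCV k f : (forall x, U x -> f x != 0) -> dC k f -> dC k (fun x => (f x)^-1).
Proof.
move=> f0; elim: k => // k IH Hf i; have [fd fk] := Hf i.
split=> [x Ux|]; first exact: derivableV (f0 x Ux) (fd x Ux).
have Hi := IH (dC_mono Hf).
apply: dC_ext (dCM (dC_cst _ (-1)) (dCM fk (dCM Hi Hi))) => x Ux.
rewrite (deriveV (f0 x Ux) (fd x Ux)) /GRing.scale/= mulN1r mulNr; congr (- _).
by rewrite mulrC expr2 invfM.
Qed.

Lemma dC_sum k (I : Type) (r : seq I) (P : pred I) (h : I -> 'rV[R]_n -> R) :
  (forall i, dC k (h i)) -> dC k (fun x => \sum_(i <- r | P i) h i x).
Proof.
move=> H; elim: r => [|i r IH].
  by apply: dC_ext (dC_cst k 0) => x _; rewrite big_nil.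
case/boolP: (P i) => Pi.
  by apply: dC_ext (dCD (H i) IH) => x _; rewrite big_cons Pi.
by apply: dC_ext IH => x _; rewrite big_cons (negbTE Pi).
Qed.

Lemma dC_prod k (I : Type) (r : seq I) (P : pred I) (h : I -> 'rV[R]_n -> R) :
  (forall i, dC k (h i)) -> dC k (fun x => \prod_(i <- r | P i) h i x).
Proof.
move=> H; elim: r => [|i r IH].
  by apply: dC_ext (dC_cst k 1) => x _; rewrite big_nil.
case/boolP: (P i) => Pi.
  by apply: dC_ext (dCM (H i) IH) => x _; rewrite big_cons Pi.
by apply: dC_ext IH => x _; rewrite big_cons (negbTE Pi).
Qed.

Definition dCmx k p q (M : 'rV[R]_n -> 'M[R]_(p, q)) :=
  forall i j, dC k (fun x => M x i j).

Lemma dCmx_ext k p q (M N : 'rV[R]_n -> 'M[R]_(p, q)) :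
  (forall x, U x -> M x = N x) -> dCmx k M -> dCmx k N.
Proof. by move=> MN H i j; apply: dC_ext (H i j) => x Ux; rewrite MN. Qed.

Lemma dCmx_mono k p q (M : 'rV[R]_n -> 'M[R]_(p, q)) : dCmx k.+1 M -> dCmx k M.
Proof. by move=> H i j; apply: dC_mono; exact: H. Qed.

Lemma dCmxM k p q r (M : 'rV[R]_n -> 'M[R]_(p, q)) (N : 'rV[R]_n -> 'M[R]_(q, r)) :
  dCmx k M -> dCmx k N -> dCmx k (fun x => M x *m N x).
Proof.
move=> HM HN i j; apply: dC_ext (_ : dC k (fun x => \sum_l M x i l * N x l j)).
  by move=> x _; rewrite mxE.
by apply: dC_sum => l; apply: dCM.
Qed.

Lemma dCmxZ k p q f (M : 'rV[R]_n -> 'M[R]_(p, q)) : dC k f -> dCmx k M ->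
  dCmx k (fun x => f x *: M x).
Proof. by move=> Hf H i j; apply: dC_ext (dCM Hf (H i j)) => x _; rewrite mxE. Qed.

Lemma dC_mxtrace k p (M : 'rV[R]_n -> 'M[R]_p) : dCmx k M -> dC k (fun x => \tr (M x)).
Proof. by move=> H; apply: dC_sum. Qed.

Lemma dC_det k p (M : 'rV[R]_n -> 'M[R]_p) : dCmx k M -> dC k (fun x => \det (M x)).
Proof.
by move=> H; apply: dC_sum => s; apply: dCM; [exact: dC_cst|apply: dC_prod].
Qed.

Lemma dCmx_inv k p (M : 'rV[R]_n -> 'M[R]_p) : (forall x, U x -> M x \in unitmx) ->
  dCmx k M -> dCmx k (fun x => invmx (M x)).
Proof.
move=> Mu H i j.
apply: dC_ext (_ : dC k (fun x => (\det (M x))^-1 * cofactor (M x) j i)).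
  by move=> x Ux; rewrite /invmx Mu// !mxE.
apply: dCM; first by apply: dCV (dC_det H) => x /Mu; rewrite unitmxE unitfE.
apply: dCM; first exact: dC_cst.
by apply: dC_det => a b; apply: dC_ext (H _ _) => x _; rewrite !mxE.
Qed.

Lemma dCmx_derivable k p q (M : 'rV[R]_n -> 'M[R]_(p, q)) x i : dCmx k.+1 M -> U x ->
  derivable M x (frame R i).
Proof. by move=> H Ux; apply/derivable_mxP => a b; have [fd _] := H a b i; exact: fd. Qed.

Lemma dCmx_is_derive k p q (M : 'rV[R]_n -> 'M[R]_(p, q)) x i : dCmx k.+1 M -> U x ->
  is_derive x (frame R i) M ('D_(frame R i) M x).
Proof. by move=> H Ux; apply: derivableP; exact: dCmx_derivable H Ux. Qed.

Lemma dCmx_derive k p q (M : 'rV[R]_n -> 'M[R]_(p, q)) i : dCmx k.+1 M ->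
  dCmx k (fun x => 'D_(frame R i) M x).
Proof.
move=> H a b; have [_] := H a b i; apply: dC_ext => x Ux.
by rewrite derive_mx ?mxE//; exact: dCmx_derivable H Ux.
Qed.

Lemma dCmx_block k p1 p2 q1 q2 (A : 'rV[R]_n -> 'M[R]_(p1, q1)) (B : 'rV[R]_n -> 'M[R]_(p1, q2))
   (C : 'rV[R]_n -> 'M[R]_(p2, q1)) (D : 'rV[R]_n -> 'M[R]_(p2, q2)) :
  dCmx k A -> dCmx k B -> dCmx k C -> dCmx k D ->
  dCmx k (fun x => block_mx (A x) (B x) (C x) (D x)).
Proof.
move=> HA HB HC HD i j; case: (split_ordP i) => i' ->; case: (split_ordP j) => j' ->.
- by apply: dC_ext (HA i' j') => x _; rewrite block_mxEul.
- by apply: dC_ext (HB i' j') => x _; rewrite block_mxEur.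
- by apply: dC_ext (HC i' j') => x _; rewrite block_mxEdl.
- by apply: dC_ext (HD i' j') => x _; rewrite block_mxEdr.
Qed.

Lemma dCmx_cst k p q (C : 'M[R]_(p, q)) : dCmx k (fun=> C).
Proof. by move=> i j; exact: dC_cst. Qed.

(** A derivative of [expmx] is a corner of [expmx] of a matrix of twice the size, so the induction
    on [k] runs over all sizes [p] at once. *)
Lemma dCmx_expmx k p (X : 'rV[R]_n -> 'M[R]_p) : dCmx k X -> dCmx k (fun x => expmx (X x)).
Proof.
elim: k p X => [//|k IH] p X H a b i.
have Xd x : U x -> is_derive x (frame R i) (fun y => expmx (X y))
    (ursubmx (expmx (block_mx (X x) ('D_(frame R i) X x) 0 (X x) : 'M[R]_(p + p)))).
  by move=> Ux; apply: is_derive_expmx; exact: dCmx_derivable H Ux.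
split=> [x Ux|]; first by have /is_derive_mxP/(_ a b)[] := Xd x Ux.
have HX := dCmx_mono H.
have := IH _ _ (dCmx_block HX (dCmx_derive i H) (@dCmx_cst _ _ _ 0) HX) (lshift p a) (rshift p b).
apply: dC_ext => x Ux; have /is_derive_mxP/(_ a b)[_ ->] := Xd x Ux.
by rewrite !mxE.
Qed.

End Smooth.

(** * Curvature in a chart *)

Section LocalMetric.
Context {R : realType} {n : nat}.
Variable U : set 'rV[R]_n.
Hypothesis oU : open U.

Lemma classC_dC k p q (M : 'rV[R]_n -> 'M[R]_(p, q)) : classC k U M -> dCmx U k M.
Proof.
elim: k M => // k IH M [Md Mk] a b i.
have Mdd x : U x -> derivable M x (frame R i) by move=> /Md/diff_derivable.
split=> [x Ux|]; first exact: (derivable_mxP _ _ _).1 (Mdd x Ux) a b.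
by apply: dC_ext (IH _ (Mk (frame R i)) a b) => // x Ux; rewrite derive_mx ?mxE//; exact: Mdd.
Qed.

Variable H : 'rV[R]_n -> 'M[R]_n.
Notation d_ i f := (fun x => 'D_(frame R i) f x).

Definition gam i x : 'M[R]_n := \matrix_(j, k) christoffel H x i j k.

(* With dH j the derivative of the metric H along x_j, the entry (j, l) of
   kosz dH i is d_j H_il: one of the two terms of the Christoffel symbols that are
   not d_i H_jl. *)
Definition kosz (dH : 'I_n -> 'M[R]_n) i : 'M[R]_n := \matrix_(j, l) dH j i l.

Lemma gamE i x : gam i x =
  2^-1 *: ('D_(frame R i) H x + kosz (fun j => 'D_(frame R j) H x) i -
    (kosz (fun j => 'D_(frame R j) H x) i)^T) *m invmx (H x).
Proof.
apply/matrixP => j k; rewrite !mxE /christoffel mulr_sumr; apply: eq_bigr => l _.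
by rewrite !mxE mulrA.
Qed.

Lemma levi_civita_frame i (Z : 'rV[R]_n -> 'rV[R]_n) x :
  levi_civita H (frame R i) Z x = 'D_(frame R i) Z x + Z x *m gam i x.
Proof.
rewrite /levi_civita; congr (_ + _); apply/rowP => k; rewrite !mxE.
rewrite (bigD1 i)//= [X in _ + X]big1 ?addr0; last first.
  move=> j ji; rewrite big1// => l _; rewrite !mxE eqxx/= (negbTE ji).
  by rewrite !mul0r.
by apply: eq_bigr => j _; rewrite !mxE !eqxx mul1r.
Qed.

Lemma levi_civita_cst i k : levi_civita H (frame R i) (cst (frame R k)) = fun x => row k (gam i x).
Proof. by apply/funext => x; rewrite levi_civita_frame derive_cst add0r -rowE. Qed.

Hypothesis smoothH : forall k, dCmx U k H.
Hypothesis unitH : forall x, U x -> H x \in unitmx.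
Hypothesis symH : forall x, U x -> (H x)^T = H x.

Lemma smooth_gam k i : dCmx U k (gam i).
Proof.
move=> a b; apply: (dC_ext oU (f := fun x => christoffel H x i a b)) => [x _|].
  by rewrite mxE.
apply: dCM => //; first exact: dC_cst.
apply: dC_sum => // l; apply: dCM => //; last by apply: dCmx_inv.
have sD j c d : dC U k (fun x => ('D_(frame R j) H x) c d).
  by apply: dCmx_derive => //; exact: smoothH.
apply: dCD => //; first exact: dCD.
by apply: dC_ext (dCM oU (dC_cst oU k (-1)) (sD _ _ _)) => // x _; rewrite mulN1r.
Qed.

Let is_derive_gam i j x (Ux : U x) : is_derive x (frame R i) (gam j) ('D_(frame R i) (gam j) x) :=
  @dCmx_is_derive _ _ _ 0 _ _ _ _ i (smooth_gam 1 j) Ux.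

(** The curvature matrix of the connection matrices; the products are in the order opposite to the
    usual formula because matrices act on the right. *)
Definition riem i j x := 'D_(frame R i) (gam j) x - 'D_(frame R j) (gam i) x +
  (gam j x *m gam i x - gam i x *m gam j x).

Lemma riemannE i j k x : U x -> riemann H x i j k = row k (riem i j x).
Proof.
move=> Ux; rewrite /riemann !levi_civita_cst !levi_civita_frame.
have dr a b : 'D_(frame R a) (fun y => row k (gam b y)) x = row k ('D_(frame R a) (gam b) x).
  have [_ <-//] : is_derive x (frame R a) (fun y => row k (gam b y))
    (row k ('D_(frame R a) (gam b) x)).
  apply/is_derive_mxP => c d; rewrite mxE.
  rewrite (_ : (fun y => _) = fun y => gam b y k d); last by apply/funext => y; rewrite mxE.
  by have /is_derive_mxP := is_derive_gam a b Ux; exact.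
rewrite !dr -!row_mul /riem.
move: (_ *m _) (_ *m _) ('D__ _ _) ('D__ _ _) => a b c d.
by apply/rowP => l; rewrite !mxE; ring.
Qed.

Lemma ricciE x j k : U x -> ricci_tensor H x j k = \sum_i riem i j x k i.
Proof. by move=> Ux; rewrite mxE; apply: eq_bigr => i _; rewrite riemannE// mxE. Qed.

Lemma divergenceE (D : 'rV[R]_n -> 'M[R]_n) x j : U x -> dCmx U 1 D ->
  divergence H D x j =
  \sum_k ('D_(frame R k) D x + D x *m gam k x - gam k x *m D x) j k.
Proof.
move=> Ux sD; apply: eq_bigr => k _.
rewrite /levi_civita_endo levi_civita_cst levi_civita_frame.
have -> : 'D_(frame R k) (fun y => cst (frame R j) y *m D y) x = row j ('D_(frame R k) D x).
  have := is_derive_mulmx (is_derive_cst (frame R j) x (frame R k)) (dCmx_is_derive k sD Ux).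
  by move=> [_ ->]; rewrite mul0mx add0r -rowE.
by rewrite -rowE -!row_mul !mxE.
Qed.

Lemma derive_metric_sym i x : U x -> ('D_(frame R i) H x)^T = 'D_(frame R i) H x.
Proof.
move=> Ux.
have [_ <-] := is_derive_trmx (dCmx_is_derive i (smoothH 1) Ux).
apply: near_eq_derive; near=> y; rewrite symH//.
by near: y; exact: near_open.
Unshelve. all: by end_near. Qed.

Lemma gam_torsion i j k x : U x -> gam i x j k = gam j x i k.
Proof.
move=> Ux; rewrite !mxE /christoffel; congr (_ * _); apply: eq_bigr => l _.
congr (_ * _); rewrite [_ j l + _]addrC; congr (_ - _).
by rewrite -{1}derive_metric_sym// mxE.
Qed.

Lemma inv_sym x : U x -> (invmx (H x))^T = invmx (H x).
Proof. by move=> Ux; rewrite trmx_inv symH. Qed.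

Lemma gam_metric i x : U x -> 'D_(frame R i) H x = gam i x *m H x + H x *m (gam i x)^T.
Proof.
move=> Ux; rewrite gamE mulmxKV ?unitH// trmx_mul inv_sym// mulKVmx ?unitH//.
rewrite linearZ/= -scalerDr; apply: (scalerI (_ : 2 != 0 :> R)); first by rewrite pnatr_eq0.
rewrite scalerA mulfV ?pnatr_eq0// scale1r linearB/= linearD/= derive_metric_sym// trmxK.
move: (kosz _ _) => K; move: (K^T) => K'; apply/matrixP => a b; rewrite !mxE; ring.
Qed.

Definition ginv x := invmx (H x).

Lemma smooth_ginv k : dCmx U k ginv.
Proof. exact: dCmx_inv. Qed.

Lemma derive_ginv i x : U x ->
  'D_(frame R i) ginv x = - (ginv x *m 'D_(frame R i) H x *m ginv x).
Proof.
move=> Ux.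
have dH := dCmx_is_derive i (smoothH 1) Ux.
have dP := dCmx_is_derive i (smooth_ginv 1) Ux.
have [_ E] := is_derive_mulmx dH dP.
have E0 : 'D_(frame R i) (fun y => H y *m ginv y) x = 0.
  rewrite -(derive_cst (1%:M : 'M[R]_n) x (frame R i)); apply: near_eq_derive.
  by near=> y; rewrite mulmxV//; apply: unitH; near: y; exact: near_open.
rewrite E0 in E; apply: (can_inj (mulKmx (unitH Ux))).
rewrite mulmxN !mulmxA mulmxV ?unitH// mul1mx; apply/eqP.
by rewrite -addr_eq0 addrC -E.
Unshelve. all: by end_near. Qed.

Lemma derive_ginv_sym i x : U x -> ('D_(frame R i) ginv x)^T = 'D_(frame R i) ginv x.
Proof.
move=> Ux; rewrite derive_ginv// linearN/= !trmx_mul inv_sym// derive_metric_sym//.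
by rewrite mulmxA.
Qed.

Lemma derive_ginv_gam i x : U x ->
  'D_(frame R i) ginv x = - (ginv x *m gam i x + (gam i x)^T *m ginv x).
Proof.
move=> Ux; rewrite derive_ginv// gam_metric// mulmxDr mulmxDl; congr (- (_ + _)).
  by rewrite -!mulmxA mulmxV ?unitH// mulmx1.
by rewrite mulmxA mulVmx ?unitH// mul1mx.
Qed.

Lemma tr_gam i x : U x -> \tr ('D_(frame R i) H x *m ginv x) = 2 * \tr (gam i x).
Proof.
move=> Ux; rewrite gam_metric// mulmxDl mxtraceD mulmxK ?unitH//.
rewrite -mulmxA mxtrace_mulC mulmxKV ?unitH// mxtrace_tr; ring.
Qed.

Lemma sum_gam k x : U x -> \sum_i gam i x k i = \tr (gam k x).
Proof. by move=> Ux; apply: eq_bigr => i _; rewrite gam_torsion. Qed.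

(** Torsion-freeness turns each contraction [\sum_i gam i x k i] into [\tr (gam k x)]. These traces
    are worth isolating: for the metrics e^{tD} g they are affine in [t]. *)
Lemma ricci_contracted x j k : U x ->
  ricci_tensor H x j k =
  \sum_i ('D_(frame R i) (gam j) x) k i - 'D_(frame R j) (fun y => \tr (gam k y)) x +
  \sum_l gam j x k l * \tr (gam l x) - \sum_i (gam i x *m gam j x) k i.
Proof.
move=> Ux; rewrite ricciE//.
rewrite (eq_bigr (fun i => ('D_(frame R i) (gam j) x) k i - ('D_(frame R j) (gam i) x) k i +
   (gam j x *m gam i x) k i - (gam i x *m gam j x) k i)); last first.
  by move=> i _; rewrite /riem addmxE submxE submxE addrA.
rewrite !(sumrB, big_split)/=; congr (_ - _ + _ - _).
  have : is_derive x (frame R j) (fun y => \sum_i gam i y k i)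
    (\sum_i ('D_(frame R j) (gam i) x) k i).
    apply: is_derive_bigsum => i.
    by have /is_derive_mxP := is_derive_gam j i Ux; exact.
  move=> [_ <-]; apply: near_eq_derive; near=> y; rewrite sum_gam//.
  by near: y; exact: near_open.
rewrite (eq_bigr (fun i => \sum_l gam j x k l * gam i x l i)); last by move=> i _; rewrite mxE.
by rewrite exchange_big; apply: eq_bigr => l _; rewrite -mulr_sumr sum_gam.
Unshelve. all: by end_near. Qed.

Definition trgam a y := \tr (gam a y).

Let v l y := \sum_j (ginv y *m gam j y) j l.

(** [v l] is the contraction g^{jk} Gamma^l_{jk}. Written through the divergence of the inverse
    metric and the traces of the connection, it has derivatives that no longer involve those of the
    individual [gam j]. *)
Lemma contracted_gam l x : U x ->
  v l x = - (\sum_i ('D_(frame R i) ginv x) i l) - \sum_a trgam a x * ginv x a l.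
Proof.
move=> Ux; rewrite (eq_bigr (fun i => - (ginv x *m gam i x) i l - ((gam i x)^T *m ginv x) i l));
  last first.
  by move=> i _; rewrite derive_ginv_gam// !(addmxE, submxE, mxE) opprD.
rewrite sumrB sumrN opprB opprK.
rewrite (_ : \sum_i ((gam i x)^T *m ginv x) i l = \sum_a trgam a x * ginv x a l); last first.
  rewrite (eq_bigr (fun i => \sum_a gam i x a i * ginv x a l)); last first.
    by move=> i _; rewrite mxE; apply: eq_bigr => a _; rewrite mxE.
  rewrite exchange_big; apply: eq_bigr => a _.
  by rewrite -mulr_suml sum_gam.
by rewrite [RHS]addrC addKr.
Qed.

(** The quadratic contractions of the connection met in the scalar curvature, beyond those built
    from its traces, all reduce to this one by torsion-freeness. *)
Definition qform x := \sum_j \sum_k ginv x j k * \tr (gam k x *m gam j x).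

Lemma qform1 x : U x -> \sum_i \sum_j (ginv x *m gam i x *m gam j x) j i = qform x.
Proof.
move=> Ux; rewrite /qform.
rewrite (eq_bigr (fun i => \sum_j \sum_k \sum_l ginv x j k * (gam k x i l * gam j x l i))); last
  first.
  move=> i _; apply: eq_bigr => j _; rewrite -mulmxA mxE; apply: eq_bigr => k _.
  rewrite mxE mulr_sumr; apply: eq_bigr => l _.
  by rewrite (gam_torsion i k).
rewrite exchange_big; apply: eq_bigr => j _.
rewrite exchange_big; apply: eq_bigr => k _.
rewrite /mxtrace mulr_sumr; apply: eq_bigr => i _.
by rewrite mxE mulr_sumr.
Qed.

Lemma ginv_symE x i j : U x -> ginv x i j = ginv x j i.
Proof. by move=> Ux; rewrite /ginv -{1}inv_sym// mxE. Qed.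

Lemma qform2 x : U x -> \sum_i \sum_j ((gam i x)^T *m ginv x *m gam j x) j i = qform x.
Proof.
move=> Ux; rewrite /qform.
rewrite (eq_bigr (fun i => \sum_j \sum_k \sum_l ginv x l k * (gam k x i j * gam l x j i))); last
  first.
  move=> i _; apply: eq_bigr => j _; rewrite -mulmxA mxE; apply: eq_bigr => k _.
  rewrite [_^T _ _]mxE [(_ *m gam j x) _ _]mxE mulr_sumr; apply: eq_bigr => l _.
  rewrite (gam_torsion i k j Ux) (gam_torsion j l i Ux) (ginv_symE k l Ux).
  move: (gam _ _ _ _) (gam _ _ _ _) (ginv _ _ _) => a b c; ring.
rewrite (eq_bigr (fun i => \sum_k \sum_j \sum_l ginv x l k * (gam k x i j * gam l x j i))); last
  first.
  by move=> i _; rewrite exchange_big.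
rewrite exchange_big [RHS]exchange_big; apply: eq_bigr => k _ /=.
rewrite (eq_bigr (fun i => \sum_l \sum_j ginv x l k * (gam k x i j * gam l x j i))); last first.
  by move=> i _; rewrite exchange_big.
rewrite exchange_big; apply: eq_bigr => l _ /=.
rewrite /mxtrace mulr_sumr; apply: eq_bigr => i _.
by rewrite mxE mulr_sumr.
Qed.

Lemma smooth_trgam k a : dC U k (trgam a).
Proof. by apply: dC_mxtrace => //; exact: smooth_gam. Qed.

(* Second derivatives occur only on the inverse metric and through the trace of
   the connection, both of which are explicit for the metrics e^{tD} g. *)
Lemma scal_formula x : U x ->
  \tr (ricci_tensor H x *m ginv x) =
  - (\sum_i \sum_l ('D_(frame R i) (fun y => 'D_(frame R l) ginv y) x) l i)
  - 2 * (\sum_i \sum_a ginv x i a * 'D_(frame R i) (trgam a) x)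
  - 2 * (\sum_a \sum_i trgam a x * ('D_(frame R i) ginv x) i a)
  - \sum_i \sum_a ginv x i a * (trgam i x * trgam a x) + qform x.
Proof.
move=> Ux.
have dv i : is_derive x (frame R i) (v i)
    (\sum_j ('D_(frame R i) ginv x *m gam j x + ginv x *m 'D_(frame R i) (gam j) x) j i).
  apply: is_derive_bigsum => j.
  have dP := dCmx_is_derive i (smooth_ginv 1) Ux.
  have := is_derive_mulmx dP (is_derive_gam i j Ux).
  by move/is_derive_mxP; exact.
have dv' i : is_derive x (frame R i)
     (fun y => - (\sum_l ('D_(frame R l) ginv y) l i) - \sum_a trgam a y * ginv y a i)
     (- (\sum_l ('D_(frame R i) (fun y => 'D_(frame R l) ginv y) x) l i) -
      \sum_a ('D_(frame R i) (trgam a) x * ginv x a i + trgam a x * ('D_(frame R i) ginv x) a i)).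
  have h1 : is_derive x (frame R i) (fun y => \sum_l ('D_(frame R l) ginv y) l i)
     (\sum_l ('D_(frame R i) (fun y => 'D_(frame R l) ginv y) x) l i).
    apply: is_derive_bigsum => l.
    have sP : dCmx U 1 (fun y => 'D_(frame R l) ginv y) by apply: dCmx_derive => //; exact:
      smooth_ginv.
    by have /is_derive_mxP := dCmx_is_derive i sP Ux; exact.
  have h2 : is_derive x (frame R i) (fun y => \sum_a trgam a y * ginv y a i)
     (\sum_a ('D_(frame R i) (trgam a) x * ginv x a i + trgam a x * ('D_(frame R i) ginv x) a i)).
    apply: is_derive_bigsum => a; apply: is_derive_mulr.
      by apply: derivableP; have [+ _] := smooth_trgam 1 a i; exact.
    by have /is_derive_mxP := dCmx_is_derive i (smooth_ginv 1) Ux; exact.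
  exact: is_deriveB (is_deriveN h1) h2.
(* Differentiating the two expressions of [v i] and equating them eliminates the derivatives of
   [gam j]. The product rule leaves [- 2 * qform x] on one side ([E2]), which the last quadratic
   term of the Ricci tensor ([E5]) reduces to a single [qform x]. *)
have E1 : \sum_i \sum_j ('D_(frame R i) ginv x *m gam j x + ginv x *m 'D_(frame R i) (gam j) x) j
  i =
  \sum_i (- (\sum_l ('D_(frame R i) (fun y => 'D_(frame R l) ginv y) x) l i) -
      \sum_a ('D_(frame R i) (trgam a) x * ginv x a i + trgam a x * ('D_(frame R i) ginv x) a i)).
  apply: eq_bigr => i _; have [_ <-] := dv i; have [_ <-] := dv' i.
  apply: near_eq_derive; near=> y; rewrite contracted_gam//.
  by near: y; exact: near_open.
have E2 : \sum_i \sum_j ('D_(frame R i) ginv x *m gam j x) j i = - (2 * qform x).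
  rewrite (eq_bigr (fun i => - (\sum_j (ginv x *m gam i x *m gam j x) j i) -
     \sum_j ((gam i x)^T *m ginv x *m gam j x) j i)); last first.
    move=> i _; rewrite -sumrN -sumrB; apply: eq_bigr => j _.
    by rewrite derive_ginv_gam// mulNmx mulmxDl [LHS]mxE addmxE opprD.
  by rewrite sumrB sumrN qform1// qform2//; ring.
have E3 : \sum_i \sum_j (ginv x *m 'D_(frame R i) (gam j) x) j i =
    \sum_j \sum_k \sum_i ('D_(frame R i) (gam j) x) k i * ginv x k j.
  rewrite exchange_big; apply: eq_bigr => j _.
  rewrite exchange_big; apply: eq_bigr => i _.
  by rewrite mxE; apply: eq_bigr => k _; rewrite ginv_symE// mulrC.
have E4 : \sum_j \sum_k (\sum_l gam j x k l * \tr (gam l x)) * ginv x k j =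
    \sum_l v l x * trgam l x.
  rewrite [RHS](eq_bigr (fun l => \sum_j \sum_k gam j x k l * trgam l x * ginv x k j)); last first.
    move=> l _; rewrite mulr_suml; apply: eq_bigr => j _; rewrite mxE mulr_suml.
    by apply: eq_bigr => k _; rewrite (ginv_symE j k)//; ring.
  rewrite [RHS]exchange_big; apply: eq_bigr => j _.
  rewrite [RHS]exchange_big; apply: eq_bigr => k _.
  by rewrite mulr_suml.
have E5 : \sum_j \sum_k (\sum_i (gam i x *m gam j x) k i) * ginv x k j = qform x.
  rewrite -qform1// [RHS]exchange_big; apply: eq_bigr => j _.
  rewrite (eq_bigr (fun k => \sum_i (gam i x *m gam j x) k i * ginv x k j)); last first.
    by move=> k _; rewrite mulr_suml.
  rewrite exchange_big; apply: eq_bigr => i _; rewrite -mulmxA mxE; apply: eq_bigr => k _.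
  by rewrite ginv_symE// mulrC.
have E6 : \sum_l v l x * trgam l x =
    - (\sum_a \sum_i trgam a x * ('D_(frame R i) ginv x) i a) -
    \sum_i \sum_a ginv x i a * (trgam i x * trgam a x).
  rewrite (eq_bigr (fun l => - (\sum_i trgam l x * ('D_(frame R i) ginv x) i l) -
     \sum_a ginv x a l * (trgam a x * trgam l x))); last first.
    move=> l _; rewrite contracted_gam// mulrBl mulNr !mulr_suml; congr (- _ - _).
      by apply: eq_bigr => i _; rewrite mulrC.
    by apply: eq_bigr => a _; ring.
  by rewrite sumrB sumrN [X in _ - X]exchange_big.
have E7 : \sum_i \sum_a ('D_(frame R i) (trgam a) x * ginv x a i + trgam a x *
  ('D_(frame R i) ginv x) a i) =
   \sum_i \sum_a ginv x i a * 'D_(frame R i) (trgam a) x +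
   \sum_a \sum_i trgam a x * ('D_(frame R i) ginv x) i a.
  rewrite [X in _ + X]exchange_big -big_split; apply: eq_bigr => i _ /=.
  rewrite -big_split; apply: eq_bigr => a _ /=.
  rewrite (ginv_symE a i)// mulrC; congr (_ + _ * _).
  by rewrite -{1}(derive_ginv_sym i Ux) mxE.
have -> : \tr (ricci_tensor H x *m ginv x) =
   \sum_j \sum_k \sum_i ('D_(frame R i) (gam j) x) k i * ginv x k j -
   \sum_j \sum_k ginv x j k * 'D_(frame R j) (trgam k) x +
   \sum_j \sum_k (\sum_l gam j x k l * \tr (gam l x)) * ginv x k j -
   \sum_j \sum_k (\sum_i (gam i x *m gam j x) k i) * ginv x k j.
  rewrite -!(sumrB, big_split)/=; apply: eq_bigr => j _; rewrite mxE.
  rewrite -!(sumrB, big_split)/=; apply: eq_bigr => k _.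
  by rewrite ricci_contracted// -mulr_suml (ginv_symE j k)// /trgam; ring.
rewrite E4 E5 E6 -E3.
have : \sum_i \sum_j (ginv x *m 'D_(frame R i) (gam j) x) j i =
   2 * qform x + (- (\sum_i \sum_l ('D_(frame R i) (fun y => 'D_(frame R l) ginv y) x) l i) -
   (\sum_i \sum_a ginv x i a * 'D_(frame R i) (trgam a) x +
   \sum_a \sum_i trgam a x * ('D_(frame R i) ginv x) i a)).
  rewrite -E7 -sumrN -sumrB -E1.
  rewrite -[2 * _]opprK -E2 -sumrN -big_split; apply: eq_bigr => i _ /=.
  rewrite -sumrN -big_split; apply: eq_bigr => j _ /=.
  by rewrite addmxE addKr.
move=> ->; ring.
Unshelve. all: by end_near. Qed.

End LocalMetric.

(** * Algebra of the t^2 coefficient of the scalar curvature *)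

Section SymbolAlgebra.
Context {R : realType} {n : nat}.
Variables (Q G : 'M[R]_n) (X : 'I_n -> 'M[R]_n).
Hypothesis QG : Q *m G *m Q^T = 1%:M.
Hypothesis Gsym : G^T = G.
Hypothesis XG : forall i, X i *m G = G *m (X i)^T.

Let P := invmx G.
Let sig b := \sum_i X i b i.
Let tau a := \tr (X a).

Let Gu : G \in unitmx. Proof. by have [] := orthonormal_unit QG. Qed.

Let Psym : P^T = P. Proof. by rewrite /P trmx_inv Gsym. Qed.

Let PsymE i j : P i j = P j i. Proof. by rewrite -{1}Psym mxE. Qed.

Let PX i : P *m X i = (X i)^T *m P.
Proof. by apply: (can_inj (mulKmx Gu)); rewrite mulKVmx// mulmxA -XG mulmxK. Qed.

Let PXsym i : (P *m X i)^T = P *m X i.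
Proof. by rewrite trmx_mul Psym PX. Qed.

(* The coefficient of t in the connection matrices of e^{tD} g, exponentials
   being replaced by 1; likewise symbol_scal is the coefficient of t^2 in its
   scalar curvature. *)
Definition symbol_gam i :=
  2^-1 *: (X i *m G + kosz (fun j => X j *m G) i - (kosz (fun j => X j *m G) i)^T) *m invmx G.

Let K i := kosz (fun j => X j *m G) i.
Let B i := K i - (K i)^T.

Let trB (M N : 'M[R]_n) : \tr (M - N) = \tr M - \tr N.
Proof. exact: linearB. Qed.

Let tr_sym_anti (M N : 'M[R]_n) : M^T = M -> N^T = - N -> \tr (M *m N) = 0.
Proof.
move=> Ms Ns; have := mxtrace_tr (M *m N); rewrite trmx_mul Ms Ns mulNmx.
by rewrite linearN/= mxtrace_mulC => E; lra.
Qed.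

Let KP k i m : (K k *m P) i m = X i k m.
Proof.
have E : X i = X i *m G *m P by rewrite mulmxK.
by rewrite E [LHS]mxE [RHS]mxE; apply: eq_bigr => l _; rewrite [K k i l]mxE.
Qed.

Let symbol_gamE i : symbol_gam i = 2^-1 *: (X i + B i *m P).
Proof. by rewrite /symbol_gam -scalemxAl -addrA mulmxDl mulmxK. Qed.

Let norm2 := \sum_i \sum_j P i j * \tr (X i *m X j).
Let cross := \sum_i \sum_l (P *m X i *m X l) l i.

(** Since [B] is antisymmetric, [B i *m P] is skew-adjoint and has zero trace against the
    self-adjoint [X], so the mixed terms drop. *)
Let tr_symbol k j : 4 * \tr (symbol_gam k *m symbol_gam j) =
    \tr (X k *m X j) + 2 * \tr (K k *m P *m (K j *m P)) - 2 * \tr (K k *m P *m ((K j)^T *m P)).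
Proof.
have Banti i : (B i)^T = - B i by rewrite /B linearB/= trmxK opprB.
rewrite !symbol_gamE -scalemxAl -scalemxAr !mxtraceZ mulmxDl !mulmxDr !mxtraceD.
have -> : \tr (X k *m (B j *m P)) = 0.
  by rewrite mulmxA mxtrace_mulC mulmxA tr_sym_anti.
have -> : \tr (B k *m P *m X j) = 0.
  by rewrite -mulmxA mxtrace_mulC tr_sym_anti.
have -> : \tr (B k *m P *m (B j *m P)) =
   2 * \tr (K k *m P *m (K j *m P)) - 2 * \tr (K k *m P *m ((K j)^T *m P)).
  rewrite /B !mulmxBl !mulmxBr !trB.
  have -> : \tr ((K k)^T *m P *m ((K j)^T *m P)) = \tr (K k *m P *m (K j *m P)).
    rewrite -[LHS]mxtrace_tr !trmx_mul !trmxK Psym -!mulmxA mxtrace_mulC -!mulmxA.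
    by rewrite mxtrace_mulC -!mulmxA mxtrace_mulC -!mulmxA.
  have -> : \tr ((K k)^T *m P *m (K j *m P)) = \tr (K k *m P *m ((K j)^T *m P)).
    rewrite -[LHS]mxtrace_tr !trmx_mul !trmxK Psym -!mulmxA mxtrace_mulC -!mulmxA.
    by rewrite mxtrace_mulC -!mulmxA mxtrace_mulC -!mulmxA.
  move: (\tr _) (\tr _) => a b; ring.
by move: (\tr _) (\tr _) (\tr _) => a b c; field.
Qed.

Let KK : \sum_j \sum_k P j k * \tr (K k *m P *m (K j *m P)) = cross.
Proof.
have E i l : (P *m X i *m X l) l i = \sum_j \sum_k P j k * (X i k l * X l j i).
  rewrite PX [LHS]mxE; apply: eq_bigr => j _; rewrite mxE mulr_suml.
  by apply: eq_bigr => k _; rewrite mxE (PsymE k j); ring.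
rewrite /cross [RHS](eq_bigr (fun i => \sum_l \sum_j \sum_k P j k * (X i k l * X l j i))); last
  first.
  by move=> i _; apply: eq_bigr => l _; rewrite E.
rewrite [LHS](eq_bigr (fun j => \sum_k \sum_i \sum_l P j k * (X i k l * X l j i))); last first.
  move=> j _; apply: eq_bigr => k _; rewrite /mxtrace mulr_sumr; apply: eq_bigr => i _.
  by rewrite [(_ *m (K j *m P)) i i]mxE mulr_sumr; apply: eq_bigr => l _; rewrite !KP.
rewrite [RHS](eq_bigr (fun i => \sum_j \sum_k \sum_l P j k * (X i k l * X l j i))); last first.
  by move=> i _; rewrite exchange_big; apply: eq_bigr => j _; rewrite exchange_big.
rewrite [RHS]exchange_big; apply: eq_bigr => j _.
by rewrite [RHS]exchange_big.
Qed.

Let KKt : \sum_j \sum_k P j k * \tr (K k *m P *m ((K j)^T *m P)) = norm2.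
Proof.
have E1 i m : \tr (X m *m X i) = \sum_j \sum_k P j k * \sum_l X i k l * (X m *m G) j l.
  have -> : \tr (X m *m X i) = \tr ((X i)^T *m P *m (X m *m G)).
    rewrite -PX [_ *m (X m *m G)]mulmxA [RHS]mxtrace_mulC !mulmxA mulmxV// mul1mx.
    exact: mxtrace_mulC.
  rewrite /mxtrace (eq_bigr (fun l => \sum_j \sum_k P j k * (X i k l * (X m *m G) j l))); last
    first.
    move=> l _; rewrite mxE; apply: eq_bigr => j _; rewrite mxE mulr_suml.
    by apply: eq_bigr => k _; rewrite [_^T _ _]mxE (PsymE k j); ring.
  rewrite exchange_big; apply: eq_bigr => j _; rewrite exchange_big.
  by apply: eq_bigr => k _; rewrite mulr_sumr.
rewrite /norm2 [RHS](eq_bigr (fun i => \sum_m \sum_j \sum_k P j k * \sum_l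
  (X i k l * ((X m *m G) j l * P m i)))); last first.
  move=> i _; apply: eq_bigr => m _; rewrite mxtrace_mulC E1 mulr_sumr.
  apply: eq_bigr => j _; rewrite mulr_sumr; apply: eq_bigr => k _.
  rewrite mulrCA; congr (_ * _); rewrite mulr_sumr; apply: eq_bigr => l _.
  by rewrite (PsymE i m); ring.
rewrite [RHS](eq_bigr (fun i => \sum_j \sum_k \sum_m P j k * \sum_l
  (X i k l * ((X m *m G) j l * P m i)))); last first.
  by move=> i _; rewrite exchange_big; apply: eq_bigr => j _; rewrite exchange_big.
rewrite [RHS]exchange_big; apply: eq_bigr => j _.
rewrite [RHS]exchange_big; apply: eq_bigr => k _.
rewrite /mxtrace mulr_sumr; apply: eq_bigr => i _.
rewrite [(_ *m (_^T *m P)) i i]mxE -mulr_sumr exchange_big; congr (_ * _); apply: eq_bigr => l _.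
rewrite KP [((K j)^T *m P) l i]mxE mulr_sumr; apply: eq_bigr => m _.
by rewrite [_^T _ _]mxE [K j m l]mxE.
Qed.

Lemma symbol_q :
  4 * (\sum_j \sum_k P j k * \tr (symbol_gam k *m symbol_gam j)) = 2 * cross - norm2.
Proof.
rewrite mulr_sumr (eq_bigr (fun j => \sum_k (P j k * \tr (X k *m X j)) +
   2 * (\sum_k P j k * \tr (K k *m P *m (K j *m P))) -
   2 * (\sum_k P j k * \tr (K k *m P *m ((K j)^T *m P))))); last first.
  move=> j _; rewrite !mulr_sumr -big_split -sumrB; apply: eq_bigr => k _ /=.
  by rewrite mulrCA tr_symbol; ring.
rewrite sumrB big_split/= -!mulr_sumr KK KKt.
have -> : \sum_j \sum_k P j k * \tr (X k *m X j) = norm2.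
  by apply: eq_bigr => j _; apply: eq_bigr => k _; rewrite mxtrace_mulC.
ring.
Qed.

Definition symbol_scal :=
  - (\sum_i \sum_l (2^-1 *: (P *m (X l *m X i + X i *m X l))) l i)
  + (\sum_a \sum_i tau a * (P *m X i) i a)
  - \sum_i \sum_a P i a * (2^-1 * tau i * (2^-1 * tau a))
  + \sum_j \sum_k P j k * \tr (symbol_gam k *m symbol_gam j).

(** The indefinite contraction [cross] appears twice, with coefficient [- 2^-1] from the second
    derivatives of the inverse metric and [2^-1] from the quadratic term of the connection
    ([symbol_q]), and cancels. *)
Lemma symbol_scalE : 4 * symbol_scal =
  - (2 * \sum_i \sum_j P i j * (sig i * sig j)) + 4 * (\sum_a tau a * \sum_b P a b * sig b)
  - (\sum_i \sum_j P i j * (tau i * tau j)) - norm2.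
Proof.
have S2 : \sum_i \sum_l (P *m (X l *m X i)) l i = \sum_i \sum_j P i j * (sig i * sig j).
  rewrite exchange_big/= (eq_bigr (fun l => \sum_b (P *m X l) l b * sig b)); last first.
    move=> l _; rewrite (eq_bigr (fun i => \sum_b (P *m X l) l b * X i b i)); last first.
      by move=> i _; rewrite mulmxA mxE.
    by rewrite exchange_big; apply: eq_bigr => b _; rewrite mulr_sumr.
  rewrite exchange_big [RHS]exchange_big; apply: eq_bigr => b _ /=.
  rewrite -mulr_suml (eq_bigr (fun l => \sum_a P b a * X l a l)); last first.
    by move=> l _; rewrite -PXsym !mxE.
  rewrite exchange_big mulr_suml; apply: eq_bigr => a _.
  by rewrite -mulr_sumr (PsymE b a) -/(sig a); ring.
have ST : \sum_a \sum_i tau a * (P *m X i) i a = \sum_a tau a * \sum_b P a b * sig b.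
  apply: eq_bigr => a _; rewrite -mulr_sumr; congr (_ * _).
  rewrite (eq_bigr (fun i => \sum_b P a b * X i b i)); last first.
    by move=> i _; rewrite -PXsym !mxE.
  by rewrite exchange_big; apply: eq_bigr => b _; rewrite mulr_sumr.
have SX : \sum_i \sum_l (2^-1 *: (P *m (X l *m X i + X i *m X l))) l i =
    2^-1 * (\sum_i \sum_j P i j * (sig i * sig j) + cross).
  rewrite -S2 /cross -big_split mulr_sumr; apply: eq_bigr => i _ /=.
  rewrite -big_split mulr_sumr; apply: eq_bigr => l _ /=.
  by rewrite mxE mulmxDr addmxE !mulmxA.
have ST2 : \sum_i \sum_a P i a * (2^-1 * tau i * (2^-1 * tau a)) =
    4^-1 * \sum_i \sum_j P i j * (tau i * tau j).
  rewrite mulr_sumr; apply: eq_bigr => i _; rewrite mulr_sumr; apply: eq_bigr => a _.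
  by field.
by rewrite /symbol_scal SX ST ST2 !mulrDr symbol_q; field.
Qed.

Lemma symbol_scal_eq0 : symbol_scal = 0 ->
  \sum_a tau a * \sum_b P a b * sig b = 0 -> forall i, X i = 0.
Proof.
move=> S0 st0; have := symbol_scalE; rewrite S0 st0 => E.
have [N0 NX] := invmx_trace_form QG XG.
have s0 := invmx_form_ge0 QG sig; have t0 := invmx_form_ge0 QG tau.
by apply: NX; move: E s0 t0 N0; rewrite /norm2 -/P; lra.
Qed.

End SymbolAlgebra.

(** * One-parameter groups and derivatives of exponentials of fields *)

Section ExpDiag.
Context {R : realType} {n : nat}.

Lemma expmx0 : expmx (0 : 'M[R]_n) = 1%:M.
Proof.
have -> : (0 : 'M[R]_n) = diag_mx 0 by rewrite linear0.
rewrite expmx_diag -diag_const_mx; congr diag_mx.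
by apply/rowP => i; rewrite !mxE expR0.
Qed.

Lemma expmxDZ (Q D : 'M[R]_n) l s t : diagonalizes Q D l ->
  expmx (s *: D) *m expmx (t *: D) = expmx ((s + t) *: D).
Proof.
move=> Ql; have E r : expmx (r *: D) = invmx Q *m diag_mx (map_mx expR (r *: l)) *m Q.
  have [Qu QD] := diagonalizesZ r Ql.
  by rewrite -expmx_diag; exact: expmx_conj.
have [Qu _] := Ql.
rewrite !E -!mulmxA mulKVmx//; congr (_ *m _); rewrite mulmxA mulmx_diag.
congr (diag_mx _ *m _); apply/rowP => i.
by rewrite !mxE mulrDl expRD.
Qed.

Lemma expmxNZ (Q D : 'M[R]_n) l t : diagonalizes Q D l ->
  expmx (t *: D) *m expmx (t *: (- D)) = 1%:M.
Proof.
by move=> Ql; rewrite scalerN -scaleNr (expmxDZ _ _ Ql) subrr scale0r expmx0.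
Qed.

(** Tracing against a matrix that commutes with [D] kills the commutator part of the derivative, so
    the exponentials cancel as if [D] and [Z] commuted. This is why connection traces and
    divergences are affine in [t]. *)
Lemma trace_dexp (Q D Z Y : 'M[R]_n) l t : diagonalizes Q D l -> D *m Y = Y *m D ->
  \tr (ursubmx (expmx (t *: (block_mx D Z 0 D : 'M[R]_(n + n))))
       *m expmx (t *: (- D)) *m Y) = t * \tr (Z *m Y).
Proof.
move=> Ql DY; have [Qu QD] := Ql.
have [X [W [XD ->]]] := commutant_split Qu QD Z.
have -> : t *: (block_mx D (X + (D *m W - W *m D)) 0 D : 'M[R]_(n + n)) =
    block_mx (t *: D) (t *: X + (t *: D *m W - W *m (t *: D))) 0 (t *: D).
  rewrite scale_block_mx scaler0; congr block_mx.
  by rewrite scalerDr scalerBr -scalemxAl -scalemxAr.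
rewrite expmx_block_ur; last by rewrite -!scalemxAl -!scalemxAr XD.
set E := expmx (t *: D); set E' := expmx (t *: - D).
have EE' : E *m E' = 1%:M := expmxNZ t Ql.
have E'E : E' *m E = 1%:M by apply: mulmx1C.
have EX : E *m X = X *m E.
  by apply: expmx_comm; rewrite -scalemxAl -scalemxAr XD.
have EY : E *m Y = Y *m E.
  by apply: expmx_comm; rewrite -scalemxAl -scalemxAr DY.
have trB (M N : 'M[R]_n) : \tr (M - N) = \tr M - \tr N by exact: linearB.
have -> : (E *m (t *: X) + (E *m W - W *m E)) *m E' *m Y =
    t *: (X *m Y) + (E *m W *m E' *m Y - W *m Y).
  rewrite mulmxDl mulmxDl mulmxBl mulmxBl -scalemxAr EX -!scalemxAl.
  rewrite -(mulmxA X E) EE' -(mulmxA W E) EE'.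
  by move: (E *m W *m E') => M; rewrite !mulmx1.
rewrite mxtraceD trB mxtraceZ.
have -> : \tr (E *m W *m E' *m Y) = \tr (W *m Y).
  rewrite -!mulmxA mxtrace_mulC -!mulmxA; congr (\tr (_ *m _)).
  by rewrite -EY mulmxA E'E mul1mx.
rewrite subrr addr0 mulmxDl mxtraceD mulmxBl trB.
have -> : \tr (D *m W *m Y) = \tr (W *m D *m Y).
  by rewrite -!mulmxA mxtrace_mulC -!mulmxA DY.
by rewrite subrr addr0.
Qed.

End ExpDiag.

Section ExpField.
Context {R : realType} {n p : nat}.
Variable U : set 'rV[R]_n.
Hypothesis oU : open U.
Variable F : 'rV[R]_n -> 'M[R]_p.
Hypothesis smoothF : forall k, dCmx U k F.

(** This is [F + eps * d_i F] over the dual numbers, written as a block matrix; the corner of its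
    exponential is [d_i] of the exponential of [F]. *)
Definition jetmx i x : 'M[R]_(p + p) := block_mx (F x) ('D_(frame R i) F x) 0 (F x).

Lemma smooth_jetmx k i : dCmx U k (jetmx i).
Proof.
apply: (dCmx_block oU); [exact: smoothF| |exact: dCmx_cst|exact: smoothF].
by apply: (dCmx_derive oU); exact: smoothF.
Qed.

Lemma smooth_expZ k t : dCmx U k (fun x => expmx (t *: F x)).
Proof. by apply: dCmx_expmx => //; apply: dCmxZ => //; exact: dC_cst. Qed.

Lemma is_derive_expZ t i x : U x ->
  is_derive x (frame R i) (fun y => expmx (t *: F y)) (ursubmx (expmx (t *: jetmx i x))).
Proof.
move=> Ux.
have dF : is_derive x (frame R i) (fun y => t *: F y) (t *: 'D_(frame R i) F x).
  exact: (is_deriveZ t (dCmx_is_derive i (smoothF 1) Ux)).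
have [dF1 E] := dF.
rewrite /jetmx scale_block_mx scaler0 -E.
exact: is_derive_expmx.
Qed.

Lemma derive_jetmx i l x : U x ->
  is_derive x (frame R i) (jetmx l)
    (block_mx ('D_(frame R i) F x) ('D_(frame R i) (fun y => 'D_(frame R l) F y) x) 0
              ('D_(frame R i) F x)).
Proof.
move=> Ux.
have /is_derive_mxP dF := dCmx_is_derive i (smoothF 1) Ux.
have /is_derive_mxP ddF := dCmx_is_derive i (dCmx_derive oU l (smoothF 2)) Ux.
apply/is_derive_mxP => a b; rewrite /jetmx.
case: (split_ordP a) => a' ->; case: (split_ordP b) => b' ->.
- rewrite block_mxEul; under eq_fun do rewrite block_mxEul; exact: dF.
- rewrite block_mxEur; under eq_fun do rewrite block_mxEur; exact: ddF.
- rewrite block_mxEdl; under eq_fun do rewrite block_mxEdl.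
  by rewrite mxE; exact: is_derive_cst.
- rewrite block_mxEdr; under eq_fun do rewrite block_mxEdr; exact: dF.
Qed.

End ExpField.

Section ExpField2.
Context {R : realType} {n p : nat}.
Variable U : set 'rV[R]_n.
Hypothesis oU : open U.
Variable F : 'rV[R]_n -> 'M[R]_p.
Hypothesis smoothF : forall k, dCmx U k F.

(** A jet of a jet carries two nilpotent parameters, and the corner of the corner extracts the
    coefficient of their product. *)
Lemma derive2_expZ t i l x : U x ->
  'D_(frame R i) (fun y => 'D_(frame R l) (fun z => expmx (t *: F z)) y) x =
  ursubmx (ursubmx (expmx (t *: (block_mx (jetmx F l x) (block_mx ('D_(frame R i) F x)
    ('D_(frame R i) (fun y => 'D_(frame R l) F y) x) 0 ('D_(frame R i) F x)) 0
    (jetmx F l x) : 'M[R]_((p + p) + (p + p)))))).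
Proof.
move=> Ux.
transitivity ('D_(frame R i) (fun y => ursubmx (expmx (t *: jetmx F l y))) x).
  apply: near_eq_derive; near=> y.
  have [//|_ ->//] := @is_derive_expZ _ _ _ U F smoothF t l y _.
  by near: y; exact: near_open.
have := is_derive_expZ (smooth_jetmx oU smoothF ^~ l) t i Ux.
rewrite /(jetmx (jetmx F l)); have [_ ->] := derive_jetmx oU smoothF i l Ux.
move=> /is_derive_mxP H.
have [_ ->//] : is_derive x (frame R i) (fun y => ursubmx (expmx (t *: jetmx F l y)))
  (ursubmx (ursubmx (expmx (t *: (block_mx (jetmx F l x) (block_mx ('D_(frame R i) F x)
    ('D_(frame R i) (fun y => 'D_(frame R l) F y) x) 0 ('D_(frame R i) F x)) 0
    (jetmx F l x) : 'M[R]_((p + p) + (p + p))))))).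
apply/is_derive_mxP => a b.
under eq_fun do rewrite mxE mxE.
rewrite mxE [X in is_derive _ _ _ X]mxE; exact: H.
Unshelve. all: by end_near. Qed.

Lemma exp_leadmx_dexp (Q : 'M[R]_p) l x (X W : 'I_n -> 'M[R]_p) : U x ->
  diagonalizes Q (F x) l ->
  (forall i, F x *m X i = X i *m F x) ->
  (forall i, 'D_(frame R i) F x = X i + (F x *m W i - W i *m F x)) ->
  (forall i, exp_leadmx 1 (fun t => 'D_(frame R i) (fun y => expmx (t *: F y)) x) (X i)) /\
  (forall i l, exp_leadmx 2 (fun t => 'D_(frame R i)
    (fun y => 'D_(frame R l) (fun z => expmx (t *: F z)) y) x)
     (2^-1 *: (X l *m X i + X i *m X l))).
Proof.
move=> Ux Ql FX FW; split=> [i|i j].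
  have := exp_leadmx_derive1 (W i) Ql (FX i).
  apply: exp_leadmx_ext => t; have [_ ->] := is_derive_expZ smoothF t i Ux.
  by rewrite /jetmx FW.
have := exp_leadmx_derive2 (W j) (W i) ('D_(frame R i) (fun y => 'D_(frame R j) F y) x) Ql (FX j)
  (FX i).
apply: exp_leadmx_ext => t; rewrite (derive2_expZ t i j Ux).
by rewrite /jetmx !FW.
Qed.

End ExpField2.

(** * The deformed metrics in a chart *)

Section Deformation.
Context {R : realType} {n : nat}.
Variable U : set 'rV[R]_n.
Hypothesis oU : open U.
Variables G D : 'rV[R]_n -> 'M[R]_n.
Hypothesis smoothG : forall k, dCmx U k G.
Hypothesis smoothD : forall k, dCmx U k D.
Hypothesis posG : forall x, U x -> posdefmx (G x).
Hypothesis adjD : forall x, U x -> D x *m G x = G x *m (D x)^T.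

(* Since D is self-adjoint, g^u = g(e^{uD} -, e^{uD} -) has matrix hmet (2 * u). *)
Definition hmet t x := expmx (t *: D x) *m G x.

Lemma eigenframe x : U x -> exists Q l,
  [/\ Q *m G x *m Q^T = 1%:M, diagonalizes Q (D x) l & diagonalizes Q (- D x) (- l)].
Proof.
move=> Ux; have [Q [l [QG QD]]] := selfadjoint_diagonalizable (posG Ux) (adjD Ux).
have [Qu _] := orthonormal_unit QG.
exists Q, l; split=> //; split=> //.
by rewrite mulmxN QD linearN/= mulNmx.
Qed.

Lemma unitG x : U x -> G x \in unitmx.
Proof. by move=> /eigenframe[Q [l [QG _ _]]]; have [] := orthonormal_unit QG. Qed.

Lemma symG x : U x -> (G x)^T = G x.
Proof. by move=> /posG[]. Qed.

Lemma expD_inv t x : U x -> expmx (t *: D x) *m expmx (t *: - D x) = 1%:M.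
Proof. by move=> /eigenframe[Q [l [_ Ql _]]]; exact: expmxNZ Ql. Qed.

Lemma expD_unit t x : U x -> expmx (t *: D x) \in unitmx.
Proof. by move=> /(expD_inv t)/mulmx1_unit[]. Qed.

Lemma hmet_unit t x : U x -> hmet t x \in unitmx.
Proof. by move=> Ux; rewrite unitmx_mul expD_unit//= unitG. Qed.

Lemma expD_adj t x : U x -> expmx (t *: D x) *m G x = G x *m (expmx (t *: D x))^T.
Proof.
move=> Ux; rewrite -expmx_tr; apply: expmx_comm.
by rewrite linearZ/= -scalemxAl -scalemxAr adjD.
Qed.

Lemma hmet_sym t x : U x -> (hmet t x)^T = hmet t x.
Proof. by move=> Ux; rewrite /hmet trmx_mul symG// -expD_adj. Qed.

Lemma smooth_hmet k t : dCmx U k (hmet t).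
Proof. by apply: dCmxM => //; exact: smooth_expZ. Qed.

Lemma smooth_oppD k : dCmx U k (fun x => - D x).
Proof.
apply: (dCmx_ext oU (M := fun x => (-1) *: D x)) => [x _|]; first by rewrite scaleN1r.
by apply: dCmxZ => //; exact: dC_cst.
Qed.

Lemma ginv_hmet t x : U x -> ginv (hmet t) x = ginv G x *m expmx (t *: (- D x)).
Proof.
move=> Ux; apply: (can_inj (mulKmx (hmet_unit t Ux))).
rewrite mulmxV ?hmet_unit// /hmet mulmxA -(mulmxA _ (G x)) mulmxV ?unitG// mulmx1.
by rewrite expD_inv.
Qed.

Lemma derive_hmet t i x : U x -> 'D_(frame R i) (hmet t) x =
  'D_(frame R i) (fun y => expmx (t *: D y)) x *m G x +
  expmx (t *: D x) *m 'D_(frame R i) G x.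
Proof.
move=> Ux.
have dE := dCmx_is_derive i (smooth_expZ oU smoothD 1 t) Ux.
by have [_ ->] := is_derive_mulmx dE (dCmx_is_derive i (smoothG 1) Ux).
Qed.

Lemma trace_derive_hmet t i x (Y : 'M[R]_n) : U x -> D x *m Y = Y *m D x ->
  \tr ('D_(frame R i) (hmet t) x *m ginv (hmet t) x *m Y) =
  t * \tr ('D_(frame R i) D x *m Y) + \tr ('D_(frame R i) G x *m ginv G x *m Y).
Proof.
move=> Ux DY; have [Q [l [_ Ql Ql']]] := eigenframe Ux.
rewrite derive_hmet// ginv_hmet// mulmxDl mulmxDl mxtraceD.
congr (_ + _).
  rewrite [_ *m G x *m _]mulmxA mulmxK ?unitG//.
  have [_ ->] := is_derive_expZ smoothD t i Ux.
  by rewrite (trace_dexp _ _ Ql).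
rewrite mulmxA -!mulmxA mxtrace_mulC -!mulmxA.
have -> : expmx (t *: - D x) *m (Y *m expmx (t *: D x)) = Y.
  have <- : expmx (t *: D x) *m Y = Y *m expmx (t *: D x).
    by apply: expmx_comm; rewrite -scalemxAl -scalemxAr DY.
  by rewrite mulmxA (mulmx1C (expD_inv t Ux)) mul1mx.
by rewrite !mulmxA.
Qed.

Lemma trgam_hmet t a x : U x ->
  trgam (hmet t) a x = t / 2 * \tr ('D_(frame R a) D x) + trgam G a x.
Proof.
move=> Ux.
have E1 := tr_gam oU (fun k => smooth_hmet k t) (fun x => @hmet_unit t x)
  (fun x => @hmet_sym t x) a Ux.
have E2 := tr_gam oU smoothG unitG symG a Ux.
have := @trace_derive_hmet t a x 1%:M Ux; rewrite mulmx1 mul1mx => /(_ erefl).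
rewrite !mulmx1 E1 E2 /trgam => E.
by apply: (mulfI (_ : 2 != 0 :> R)); rewrite ?pnatr_eq0// E mulrDr; field.
Qed.

(** The data belong to the single point [x]: multiplicities of eigenvalues may jump nearby, so no
    regularity of [X] and [W] in the point is claimed. Self-adjointness of [X i] comes from
    differentiating [adjD]. *)
Lemma symbol_point x : U x ->
  exists Q l (X W : 'I_n -> 'M[R]_n),
  [/\ Q *m G x *m Q^T = 1%:M, diagonalizes Q (D x) l,
     forall i, X i *m D x = D x *m X i,
     forall i, 'D_(frame R i) D x = X i + (D x *m W i - W i *m D x) &
     forall i, X i *m G x = G x *m (X i)^T].
Proof.
move=> Ux; have [Q [l [QG Ql _]]] := eigenframe Ux.
have [Qu QD] := Ql.
have /choice[X /choice[W XW]] : forall i, exists X W : 'M[R]_n,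
   X *m D x = D x *m X /\ 'D_(frame R i) D x = X + (D x *m W - W *m D x).
  by move=> i; exact: commutant_split Qu QD _.
exists Q, l, X, W; split=> //; [by move=> i; have [] := XW i|by move=> i; have [] := XW i|].
move=> i; have [XD ZE] := XW i.
apply: (adjoint_commutant Qu QD (unitG Ux) (adjD Ux) XD ZE (A := 'D_(frame R i) G x)).
have dD := dCmx_is_derive i (smoothD 1) Ux.
have dG := dCmx_is_derive i (smoothG 1) Ux.
have [_ E1] := is_derive_mulmx dD dG.
have [_ E2] := is_derive_mulmx dG (is_derive_trmx dD).
rewrite -E1 -E2; apply: near_eq_derive; near=> y; apply: adjD.
by near: y; exact: near_open.
Unshelve. all: by end_near. Qed.

Section Symbol.
Variables (x : 'rV[R]_n) (Ux : U x) (Q : 'M[R]_n) (l : 'rV[R]_n) (X W : 'I_n -> 'M[R]_n).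
Hypotheses (Ql : diagonalizes Q (D x) l)
  (XD : forall i, X i *m D x = D x *m X i)
  (ZE : forall i, 'D_(frame R i) D x = X i + (D x *m W i - W i *m D x)).

Let Ql' : diagonalizes Q (- D x) (- l).
Proof. by case: Ql => Qu QD; split=> //; rewrite mulmxN QD linearN/= mulNmx. Qed.

Let P := ginv G x.

Let lP : exp_leadmx 0 (fun t => ginv (hmet t) x) P.
Proof.
have := exp_leadmxM (exp_leadmx_cst P) (exp_leadmx_expmx Ql').
by rewrite mulmx1; apply: exp_leadmx_ext => t; rewrite ginv_hmet.
Qed.

Let dexpD i : exp_leadmx 1 (fun t => 'D_(frame R i) (fun y => expmx (t *: D y)) x) (X i).
Proof. by have [] := exp_leadmx_dexp oU smoothD Ux Ql (fun i => esym (XD i)) ZE. Qed.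

Let deriveN i y : U y -> 'D_(frame R i) (fun z => - D z) y = - 'D_(frame R i) D y.
Proof. by move=> Uy; have [_ ->] := is_deriveN (dCmx_is_derive i (smoothD 1) Uy). Qed.

(** The inverse metric involves the exponential of [- D]. The same [W] serves with [X] negated, and
    the signs cancel at second order. *)
Let dexpN :
  (forall i, exp_leadmx 1 (fun t => 'D_(frame R i) (fun y => expmx (t *: - D y)) x) (- X i)) /\
  (forall i l, exp_leadmx 2 (fun t => 'D_(frame R i)
    (fun y => 'D_(frame R l) (fun z => expmx (t *: - D z)) y) x)
     (2^-1 *: (X l *m X i + X i *m X l))).
Proof.
have [i|i|H1 H2] := @exp_leadmx_dexp _ _ _ U oU (fun z => - D z) smooth_oppD Q (- l) x
  (fun i => - X i) W Ux Ql'.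
- by rewrite !mulmxN !mulNmx XD.
- rewrite deriveN// ZE mulmxN mulNmx opprD; congr (_ + _).
  by rewrite opprB opprK addrC.
split=> // i j; have := H2 i j.
by rewrite !mulmxN !mulNmx !opprK.
Qed.

Let ldH i : exp_leadmx 1 (fun t => 'D_(frame R i) (hmet t) x) (X i *m G x).
Proof.
have := exp_leadmxD (exp_leadmxM (dexpD i) (exp_leadmx_cst (G x)))
  (exp_leadmxS (exp_leadmxM (exp_leadmx_expmx Ql) (exp_leadmx_cst ('D_(frame R i) G x)))).
by rewrite addr0; apply: exp_leadmx_ext => t; rewrite derive_hmet.
Qed.

Let derive_ginv_hmet t i y : U y -> 'D_(frame R i) (ginv (hmet t)) y =
  'D_(frame R i) (ginv G) y *m expmx (t *: - D y) +
  ginv G y *m 'D_(frame R i) (fun z => expmx (t *: - D z)) y.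
Proof.
move=> Uy.
have dE := dCmx_is_derive i (smooth_expZ oU smooth_oppD 1 t) Uy.
have dP := dCmx_is_derive i (smooth_ginv oU smoothG unitG 1) Uy.
have [_ <-] := is_derive_mulmx dP dE.
apply: near_eq_derive; near=> z; apply: ginv_hmet.
by near: z; exact: near_open.
Unshelve. all: by end_near. Qed.

Let ldP i : exp_leadmx 1 (fun t => 'D_(frame R i) (ginv (hmet t)) x) (- (P *m X i)).
Proof.
have := exp_leadmxD (exp_leadmxS (exp_leadmxM (exp_leadmx_cst ('D_(frame R i) (ginv G) x))
  (exp_leadmx_expmx Ql')))
   (exp_leadmxM (exp_leadmx_cst P) (dexpN.1 i)).
by rewrite add0r mulmxN; apply: exp_leadmx_ext => t; rewrite derive_ginv_hmet.
Qed.

Let lddP i j : exp_leadmx 2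
  (fun t => 'D_(frame R i) (fun y => 'D_(frame R j) (ginv (hmet t)) y) x)
  (2^-1 *: (P *m (X j *m X i + X i *m X j))).
Proof.
have E t : 'D_(frame R i) (fun y => 'D_(frame R j) (ginv (hmet t)) y) x =
   ('D_(frame R i) (fun y => 'D_(frame R j) (ginv G) y) x *m expmx (t *: - D x) +
    'D_(frame R j) (ginv G) x *m 'D_(frame R i) (fun z => expmx (t *: - D z)) x) +
   ('D_(frame R i) (ginv G) x *m 'D_(frame R j) (fun z => expmx (t *: - D z)) x +
    P *m 'D_(frame R i) (fun y => 'D_(frame R j) (fun z => expmx (t *: - D z)) y) x).
  have sE k := smooth_expZ oU smooth_oppD k t.
  have sP k := smooth_ginv oU smoothG unitG k.
  have dE := dCmx_is_derive i (sE 1) Ux.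
  have dP := dCmx_is_derive i (sP 1) Ux.
  have ddE := dCmx_is_derive i (dCmx_derive oU j (sE 2)) Ux.
  have ddP := dCmx_is_derive i (dCmx_derive oU j (sP 2)) Ux.
  have [_ <-] := is_deriveD (is_derive_mulmx ddP dE) (is_derive_mulmx dP ddE).
  apply: near_eq_derive; near=> z; apply: derive_ginv_hmet.
  by near: z; exact: near_open.
(* Only [L4], with both derivatives on the exponential, has a t^2 coefficient to contribute;
   [exp_leadS] counts the other three terms as 0. *)
have L1 := exp_leadmxS (exp_leadmxS (exp_leadmxM
  (exp_leadmx_cst ('D_(frame R i) (fun y => 'D_(frame R j) (ginv G) y) x)) (exp_leadmx_expmx Ql'))).
have L2 := exp_leadmxS (exp_leadmxM (exp_leadmx_cst ('D_(frame R j) (ginv G) x)) (dexpN.1 i)).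
have L3 := exp_leadmxS (exp_leadmxM (exp_leadmx_cst ('D_(frame R i) (ginv G) x)) (dexpN.1 j)).
have L4 := exp_leadmxM (exp_leadmx_cst P) (dexpN.2 i j).
have := exp_leadmxD (exp_leadmxD L1 L2) (exp_leadmxD L3 L4).
rewrite !add0r -scalemxAr; apply: exp_leadmx_ext => t.
by rewrite E.
Unshelve. all: by end_near. Qed.

Let ltg a : exp_lead 1 (fun t => trgam (hmet t) a x) (2^-1 * \tr (X a)).
Proof.
have := exp_leadD (exp_leadM exp_lead_id (exp_lead_cst (2^-1 * \tr ('D_(frame R a) D x))))
  (exp_leadS (exp_lead_cst (trgam G a x))).
rewrite addr0 mul1r ZE mxtraceD (_ : \tr (D x *m W a - W a *m D x) = 0); last first.
  by rewrite linearB/= mxtrace_mulC subrr.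
rewrite addr0; apply: exp_lead_ext => t.
by rewrite (trgam_hmet t a Ux) ZE mxtraceD [\tr (D x *m W a - _)]linearB/=
  [\tr (D x *m _)]mxtrace_mulC subrr addr0 /= mulrA.
Qed.

(** By [trgam_hmet] the trace is affine in [t] at every point of [U], and so are its derivatives in
    the point: nothing reaches t^2. *)
Let ldtg i a : exp_lead 2 (fun t => 'D_(frame R i) (trgam (hmet t) a) x) 0.
Proof.
have sT k : dC U k (fun y => \tr ('D_(frame R a) D y)).
  by apply: (dC_mxtrace oU); apply: (dCmx_derive oU); exact: smoothD.
have sTG k : dC U k (trgam G a) := smooth_trgam oU smoothG unitG k a.
have d1 : is_derive x (frame R i) (fun y => \tr ('D_(frame R a) D y))
  ('D_(frame R i) (fun y => \tr ('D_(frame R a) D y)) x).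
  by apply: derivableP; have [+ _] := sT 1 i; exact.
have d2 : is_derive x (frame R i) (trgam G a) ('D_(frame R i) (trgam G a) x).
  by apply: derivableP; have [+ _] := sTG 1 i; exact.
have := exp_leadS (exp_leadD (exp_leadM exp_lead_id
  (exp_lead_cst (2^-1 * 'D_(frame R i) (fun y => \tr ('D_(frame R a) D y)) x)))
  (exp_leadS (exp_lead_cst ('D_(frame R i) (trgam G a) x)))).
apply: exp_lead_ext => t.
have [_ E] := is_deriveD (is_derive_mulr (is_derive_cst (t / 2) x (frame R i)) d1) d2.
transitivity (0 * \tr ('D_(frame R a) D x) + t / 2 * 'D_(frame R i)
  (fun y => \tr ('D_(frame R a) D y)) x +
  'D_(frame R i) (trgam G a) x); first by rewrite /=; ring.
rewrite -E; apply: near_eq_derive; near=> y; rewrite (trgam_hmet t a)//.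
by near: y; exact: near_open.
Unshelve. all: by end_near. Qed.

Let lgam i : exp_leadmx 1 (fun t => gam (hmet t) i x) (symbol_gam (G x) X i).
Proof.
have lK j : exp_leadmx 1 (fun t => kosz (fun a => 'D_(frame R a) (hmet t) x) j)
  (kosz (fun a => X a *m G x) j).
  by move=> a b; rewrite mxE; apply: exp_lead_ext (ldH a j b) => t; rewrite mxE.
have := exp_leadmxM (exp_leadmxZ (exp_lead_cst 2^-1)
  (exp_leadmxB (exp_leadmxD (ldH i) (lK i)) (exp_leadmxT (lK i)))) lP.
by apply: exp_leadmx_ext => t; rewrite gamE.
Qed.

(** A constant has t^2 coefficient 0, and by uniqueness this equals the coefficient counted term by
    term in [scal_formula]. *)
Lemma symbol_scal_lead c :
  (forall t, \tr (ricci_tensor (hmet t) x *m ginv (hmet t) x) = c) ->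
  symbol_scal (G x) X = 0.
Proof.
move=> Hc.
have lc : exp_lead 2 (fun t => \tr (ricci_tensor (hmet t) x *m ginv (hmet t) x)) 0.
  by apply: exp_lead_ext (exp_leadS (exp_leadS (exp_lead_cst c))) => t; rewrite Hc.
apply: (exp_lead_unique _ lc).
have L1 : exp_lead 2 (fun t => - (\sum_i \sum_l
  ('D_(frame R i) (fun y => 'D_(frame R l) (ginv (hmet t)) y) x) l i))
    (- (\sum_i \sum_l (2^-1 *: (P *m (X l *m X i + X i *m X l))) l i)).
  by apply: exp_leadN; apply: exp_lead_sum => i; apply: exp_lead_sum => j; exact: lddP.
have L2 : exp_lead 2 (fun t => 2 * (\sum_i \sum_a ginv (hmet t) x i a * 'D_(frame R i)
  (trgam (hmet t) a) x)) 0.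
  have := exp_leadZ 2 (exp_lead_sum (index_enum 'I_n)
    (fun i => exp_lead_sum (index_enum 'I_n) (fun a => exp_leadM (lP i a) (ldtg i a)))).
  by rewrite big1 ?mulr0// => i _; rewrite big1// => a _; rewrite mulr0.
have L3 : exp_lead 2 (fun t => 2 * (\sum_a \sum_i trgam (hmet t) a x *
  ('D_(frame R i) (ginv (hmet t)) x) i a))
   (- (\sum_a \sum_i \tr (X a) * (P *m X i) i a)).
  have := exp_leadZ 2 (exp_lead_sum (index_enum 'I_n)
    (fun a => exp_lead_sum (index_enum 'I_n) (fun i => exp_leadM (ltg a) (ldP i i a)))).
  congr exp_lead; rewrite mulr_sumr -sumrN; apply: eq_bigr => a _.
  rewrite mulr_sumr -sumrN; apply: eq_bigr => i _.
  have oE (M : 'M[R]_n) a' b' : (- M) a' b' = - M a' b' by rewrite mxE.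
  by rewrite oE; field.
have L4 : exp_lead 2 (fun t => \sum_i \sum_a ginv (hmet t) x i a *
  (trgam (hmet t) i x * trgam (hmet t) a x))
   (\sum_i \sum_a P i a * (2^-1 * \tr (X i) * (2^-1 * \tr (X a)))).
  exact: (exp_lead_sum (index_enum 'I_n) (fun i => exp_lead_sum (index_enum 'I_n)
    (fun a => exp_leadM (lP i a) (exp_leadM (ltg i) (ltg a))))).
have L5 : exp_lead 2 (fun t => qform (hmet t) x)
   (\sum_j \sum_k P j k * \tr (symbol_gam (G x) X k *m symbol_gam (G x) X j)).
  exact: (exp_lead_sum (index_enum 'I_n) (fun j => exp_lead_sum (index_enum 'I_n)
    (fun k => exp_leadM (lP j k) (exp_leadmx_tr (exp_leadmxM (lgam k) (lgam j)))))).
have := exp_leadD (exp_leadB (exp_leadB (exp_leadB L1 L2) L3) L4) L5.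
rewrite subr0 opprK; apply: exp_lead_ext => t.
by rewrite (scal_formula oU (fun k => smooth_hmet k t) (fun x => @hmet_unit t x)
  (fun x => @hmet_sym t x) Ux).
Qed.

End Symbol.

End Deformation.

(** * Rigidity of [D] in a chart under the Einstein equations *)

Section LocalRigidity.
Context {R : realType} {n : nat}.
Variable U : set 'rV[R]_n.
Hypothesis oU : open U.
Variables G D : 'rV[R]_n -> 'M[R]_n.
Hypothesis smoothG : forall k, dCmx U k G.
Hypothesis smoothD : forall k, dCmx U k D.
Hypothesis posG : forall x, U x -> posdefmx (G x).
Hypothesis adjD : forall x, U x -> D x *m G x = G x *m (D x)^T.

Notation hm := (hmet G D).
Let uH t x := @hmet_unit _ _ U G D posG adjD t x.
Let sH t x := @hmet_sym _ _ U G D posG adjD t x.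
Let smH t k := smooth_hmet oU smoothG smoothD k t.

Lemma adj_hmet t x : U x -> D x *m hm t x = hm t x *m (D x)^T.
Proof.
move=> Ux; rewrite /hmet -[RHS]mulmxA -(adjD Ux) !mulmxA; congr (_ *m _).
by apply/esym/expmx_comm; rewrite -scalemxAl -scalemxAr.
Qed.

Lemma tr_gam_adj (H : 'rV[R]_n -> 'M[R]_n) k x :
  (forall k, dCmx U k H) -> (forall x, U x -> H x \in unitmx) ->
  (forall x, U x -> (H x)^T = H x) -> U x -> D x *m H x = H x *m (D x)^T ->
  \tr ('D_(frame R k) H x *m ginv H x *m D x) = 2 * \tr (gam H k x *m D x).
Proof.
move=> smoothH unitH symH Ux DH; rewrite (gam_metric oU)// mulmxDl mulmxK ?unitH// mulmxDl mxtraceD.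
suff -> : \tr (H x *m (gam H k x)^T *m ginv H x *m D x) = \tr (gam H k x *m D x) by ring.
have PD : ginv H x *m D x = (D x)^T *m ginv H x.
  by apply: (can_inj (mulKmx (unitH _ Ux))); rewrite mulKVmx ?unitH// mulmxA -DH mulmxK ?unitH.
rewrite -mulmxA PD mxtrace_mulC -!mulmxA mulKmx ?unitH//.
by rewrite -trmx_mul mxtrace_tr mxtrace_mulC.
Qed.

Lemma divergence_gam (H : 'rV[R]_n -> 'M[R]_n) k x :
  (forall k, dCmx U k H) -> (forall x, U x -> H x \in unitmx) ->
  (forall x, U x -> (H x)^T = H x) -> U x ->
  divergence H D x k = \sum_i ('D_(frame R i) D x) k i + \sum_l D x k l * trgam H l x -
     \tr (gam H k x *m D x).
Proof.
move=> smoothH unitH symH Ux; rewrite (divergenceE (U := U))//.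
rewrite (eq_bigr (fun i => ('D_(frame R i) D x) k i + (D x *m gam H i x) k i - (gam H i x *m D x)
  k i)); last first.
  by move=> i _; rewrite submxE addmxE.
rewrite sumrB big_split/=; congr (_ + _ - _).
  rewrite (eq_bigr (fun i => \sum_l D x k l * gam H i x l i)); last by move=> i _; rewrite mxE.
  rewrite exchange_big; apply: eq_bigr => l _; rewrite -mulr_sumr.
  by rewrite (sum_gam oU).
rewrite /mxtrace; apply: eq_bigr => i _.
by rewrite !mxE; apply: eq_bigr => l _; rewrite (gam_torsion oU smoothH symH i k l Ux).
Qed.

(** By [divergence_gam] the metric enters only through traces of its derivative against the identity
    and against [D]. Both commute with [D], so each trace is affine in [t]. *)
Lemma divergence_hmet t k x : U x ->
  divergence (hm t) D x k = divergence G D x k +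
   t / 2 * (\sum_l D x k l * \tr ('D_(frame R l) D x) - \tr ('D_(frame R k) D x *m D x)).
Proof.
move=> Ux.
have uG := unitG posG adjD; have sG := symG posG.
rewrite !divergence_gam //; try exact: smH; try exact: uH; try exact: sH.
have E1 := @tr_gam_adj G k x smoothG uG sG Ux (adjD Ux).
have E2 := @tr_gam_adj (hm t) k x (smH t) (uH t) (sH t) Ux (adj_hmet t Ux).
rewrite (trace_derive_hmet oU smoothG smoothD posG adjD t k Ux (erefl _)) E1 in E2.
have -> : \sum_l D x k l * trgam (hm t) l x = t / 2 * (\sum_l D x k l * \tr ('D_(frame R l) D x)) +
    \sum_l D x k l * trgam G l x.
  rewrite mulr_sumr -big_split; apply: eq_bigr => l _ /=.
  by rewrite (trgam_hmet oU smoothG smoothD posG adjD t l Ux); ring.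
have -> : \tr (gam (hm t) k x *m D x) = t / 2 * \tr ('D_(frame R k) D x *m D x) + \tr
  (gam G k x *m D x).
  by apply: (mulfI (_ : 2 != 0 :> R)); rewrite ?pnatr_eq0// -E2; field.
ring.
Qed.

Lemma derive_trace_sqr k x : U x ->
  is_derive x (frame R k) (fun y => \tr (D y *m D y)) (2 * \tr ('D_(frame R k) D x *m D x)).
Proof.
move=> Ux; have dD := dCmx_is_derive k (smoothD 1) Ux.
apply: (is_derive_eq (is_derive_mxtrace (is_derive_mulmx dD dD))).
by rewrite mxtraceD [X in _ + X]mxtrace_mulC; ring.
Qed.

Variable c : R.
Hypothesis trD2 : forall x, U x -> \tr (D x *m D x) = - c.
Hypothesis divD : forall t x k, U x -> divergence (hm t) D x k = \tr ('D_(frame R k) D x).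
Hypothesis ricD : forall t x, U x -> ricci_tensor (hm t) x *m ginv (hm t) x =
  \tr (D x) *: D x - (\tr (D x *m D x))%:M.

Lemma tr_dDD k x : U x -> \tr ('D_(frame R k) D x *m D x) = 0.
Proof.
move=> Ux; apply: (mulfI (_ : 2 != 0 :> R)); rewrite ?pnatr_eq0// mulr0.
have [_ <-] := derive_trace_sqr k Ux.
rewrite -(derive_cst (- c) x (frame R k)); apply: near_eq_derive.
near=> y; rewrite trD2//; by near: y; exact: near_open.
Unshelve. all: by end_near. Qed.

(** Since matrices act on row vectors from the right, covectors are columns, and [D x *m tau x] is
    the 1-form [tau] composed with [D]. *)
Let tau x : 'cV[R]_n := \col_l \tr ('D_(frame R l) D x).

Lemma D_grad_trace x : U x -> D x *m tau x = 0.
Proof.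
move=> Ux; apply/matrixP => k j; rewrite [RHS]mxE.
(* The values at [t = 2] and [t = 0] differ by exactly the slope, because [t / 2 = 1]. *)
have := divergence_hmet 2 k Ux; have := divergence_hmet 0 k Ux.
rewrite !divD// mul0r mul0r addr0 => <-.
move/eqP; rewrite eq_sym -subr_eq0 addrAC subrr add0r => /eqP.
rewrite tr_dDD// subr0 mulfV ?pnatr_eq0// mul1r => <-.
by rewrite mxE; apply: eq_bigr => l _; rewrite [tau x l j]mxE.
Qed.

Lemma rigidity_point x : U x -> exists W : 'I_n -> 'M[R]_n,
  forall i, 'D_(frame R i) D x = D x *m W i - W i *m D x.
Proof.
move=> Ux.
have [Q [l [X [W [QG Ql XD ZE XG]]]]] := symbol_point oU smoothG smoothD posG adjD Ux.
have [Qu QD] := Ql.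
exists W => i; rewrite ZE -[RHS]add0r; congr (_ + _); move: i.
have trX i : \tr (X i) = \tr ('D_(frame R i) D x).
  by rewrite ZE mxtraceD [\tr (_ - _)]linearB/= [\tr (D x *m _)]mxtrace_mulC subrr addr0.
have smtau k : dCmx U k tau.
  move=> a b; apply: (dC_ext oU (f := fun y => \tr ('D_(frame R a) D y))) => [y _|].
    by rewrite mxE.
  by apply: (dC_mxtrace oU); apply: (dCmx_derive oU); exact: smoothD.
have Xtau i : X i *m tau x = 0.
  have dD := dCmx_is_derive i (smoothD 1) Ux.
  have dtau := dCmx_is_derive i (smtau 1%N) Ux.
  have [_ E] := is_derive_mulmx dD dtau.
  have E0 : 'D_(frame R i) (fun y => D y *m tau y) x = 0.
    rewrite -(derive_cst (0 : 'cV[R]_n) x (frame R i)); apply: near_eq_derive.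
    by near=> y; apply: D_grad_trace; near: y; exact: near_open.
  rewrite E0 ZE mulmxDl mulmxBl -!mulmxA D_grad_trace// mulmx0 subr0 in E.
  (* The differentiated relation exhibits [X i *m tau x] as [D x] times this [r]; commutation of
     [X i] with [D x] puts it in the kernel as well. *)
  apply: (ker_img0 Qu QD (r := - (W i *m tau x + 'D_(frame R i) tau x))).
    by rewrite mulmxN mulmxDr; apply/eqP; rewrite -addr_eq0 addrA -E.
  by rewrite mulmxA -XD -mulmxA D_grad_trace// mulmx0.
apply: (symbol_scal_eq0 QG (symG posG Ux) XG).
  apply: (symbol_scal_lead oU smoothG smoothD posG adjD Ux Ql XD ZE
    (c := \tr (\tr (D x) *: D x - (\tr (D x *m D x))%:M))) => t.
  by rewrite ricD.
(* The pairing of sigma and tau is the sum over [i] of the [i]-th entries of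
   [(tau x)^T *m ginv G x *m X i]. Self-adjointness rewrites this row as
   [(X i *m tau x)^T *m ginv G x], which is 0. *)
have PX i : ginv G x *m X i = (X i)^T *m ginv G x.
  apply: (can_inj (mulKmx (unitG posG adjD Ux))).
  by rewrite mulKVmx ?(unitG posG adjD Ux)// mulmxA -XG mulmxK ?(unitG posG adjD Ux).
have E i : (tau x)^T *m ginv G x *m X i = 0.
  by rewrite -mulmxA PX mulmxA -trmx_mul Xtau trmx0 mul0mx.
transitivity (\sum_i ((tau x)^T *m ginv G x *m X i) 0 i); last first.
  by rewrite big1// => i _; rewrite E mxE.
rewrite (eq_bigr (fun a => \sum_b \sum_i (tau x)^T 0 a * ginv G x a b * X i b i)); last first.
  move=> a _; rewrite mulr_sumr; apply: eq_bigr => b _; rewrite mulrA mulr_sumr.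
  by apply: eq_bigr => i _; rewrite trX [_^T _ _]mxE [tau x _ _]mxE.
rewrite exchange_big [RHS](eq_bigr (fun i => \sum_b \sum_a (tau x)^T 0 a * ginv G x a b * X i b
  i)); last first.
  move=> i _; rewrite mxE; apply: eq_bigr => b _; rewrite mxE mulr_suml.
  by [].
rewrite [RHS]exchange_big; apply: eq_bigr => b _ /=.
by rewrite exchange_big.
Unshelve. all: by end_near. Qed.

Hypothesis diffD : forall x, U x -> differentiable D x.

Lemma derive_trace_exp x v k : U x -> is_derive x v (fun y => \tr (D y ^+ k)) 0.
Proof.
move=> Ux; have dDv : is_derive x v D ('D_v D x) by apply: derivableP; exact/diff_derivable/diffD.
have [W HW] := rigidity_point Ux.
(* Full differentiability extends the commutator form from the coordinate directions to an arbitrary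
   [v], by linearity of the differential. *)
have EW : 'D_v D x = D x *m (\sum_i v 0 i *: W i) - (\sum_i v 0 i *: W i) *m D x.
  rewrite deriveE; last exact: diffD.
  rewrite [X in 'd D x X]row_sum_delta linear_sum mulmx_sumr mulmx_suml -sumrB.
  apply: eq_bigr => i _; rewrite linearZ/= -deriveE; last exact: diffD.
  by rewrite -/(frame R i) HW -scalemxAl -scalemxAr scalerBr.
apply: (is_derive_eq (is_derive_mxtrace (is_derive_exp k dDv))).
rewrite linear_sum big1//= => i _.
rewrite EW; move: (\sum_i _) => V.
have comm j : D x ^+ j *m D x = D x *m D x ^+ j by rewrite -[LHS]exprSr -[RHS]exprS.
rewrite mulmxBr mulmxBl linearB/= !mulmxA comm -!mulmxA mxtrace_mulC -!mulmxA comm.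
by rewrite subrr.
Qed.

End LocalRigidity.

(** * The extension in a chart *)

Section Product.
Context {R : realType} {n : nat}.

Notation l0 := (lshift n (ord0 : 'I_1)).
Notation rs := (rshift 1).

Lemma frame_lshift : frame R l0 = row_mx 1%:M 0 :> 'rV[R]_(1 + n).
Proof.
apply/rowP => k; rewrite !mxE eqxx; case: (splitP k) => k' ek.
  by rewrite !mxE ord1 -val_eqE/= ek !ord1.
by rewrite mxE -val_eqE/= ek.
Qed.

Lemma frame_rshift i : frame R (rs i) = row_mx 0 (frame R i) :> 'rV[R]_(1 + n).
Proof.
apply/rowP => k; rewrite !mxE eqxx; case: (splitP k) => k' ek.
  by rewrite !mxE -val_eqE/= ek !ord1.
by rewrite !mxE eqxx -!val_eqE/= ek eqSS.
Qed.

Section DeriveSplit.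
Context {W : normedModType R}.
Variable f : 'rV[R]_(1 + n) -> W.

Let quot_rshift i y :
  (fun h : R => h^-1 *: ((f \o shift y) (h *: frame R (rs i)) - f y)) =
  (fun h : R => h^-1 *: (((fun x => f (row_mx (lsubmx y) x)) \o shift (rsubmx y)) (h *: frame R i) -
     f (row_mx (lsubmx y) (rsubmx y)))).
Proof.
apply/funext => h /=; rewrite hsubmxK; congr (_ *: (f _ - _)).
by rewrite frame_rshift -{1}[y]hsubmxK scale_row_mx scaler0 add_row_mx add0r.
Qed.

Let quot_lshift y :
  (fun h : R => h^-1 *: ((f \o shift y) (h *: frame R l0) - f y)) =
  (fun h : R => h^-1 *: (((fun s : R => f (row_mx s%:M (rsubmx y))) \o shift (y 0 l0)) (h *: 1) -
     f (row_mx (y 0 l0)%:M (rsubmx y)))).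
Proof.
have E : (y 0 l0)%:M = lsubmx y by rewrite [RHS]mx11_scalar mxE.
apply/funext => h /=; rewrite E hsubmxK; congr (_ *: (f _ - _)).
rewrite frame_lshift -{1}[y]hsubmxK scale_row_mx scaler0 add_row_mx add0r -E; congr row_mx.
by rewrite scale_scalar_mx raddfD /GRing.scale/=.
Qed.

Lemma derive_rshift i y : 'D_(frame R (rs i)) f y =
  'D_(frame R i) (fun x => f (row_mx (lsubmx y) x)) (rsubmx y).
Proof. by rewrite /derive quot_rshift. Qed.

Lemma derivable_rshift i y : derivable f y (frame R (rs i)) <->
  derivable (fun x => f (row_mx (lsubmx y) x)) (rsubmx y) (frame R i).
Proof. by rewrite /derivable quot_rshift. Qed.

Lemma derive_lshift y : 'D_(frame R l0) f y =
  'D_1 (fun s : R => f (row_mx s%:M (rsubmx y))) (y 0 l0).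
Proof. by rewrite /derive quot_lshift. Qed.

Lemma derivable_lshift y : derivable f y (frame R l0) <->
  derivable (fun s : R => f (row_mx s%:M (rsubmx y))) (y 0 l0) 1.
Proof. by rewrite /derivable quot_lshift. Qed.

End DeriveSplit.

Variable U : set 'rV[R]_n.
Hypothesis oU : open U.

Definition cylinder : set 'rV[R]_(1 + n) := [set y | U (rsubmx y)].

Lemma cylinder_open : open cylinder.
Proof.
apply: open_comp => // y _; exact: (mx_linear_continuous (f := rsubmx)).
Qed.

Lemma dC_rsubmx k f : dC U k f -> dC cylinder k (fun y => f (rsubmx y)).
Proof.
have oV := cylinder_open.
elim: k f => // k IH f H i; case: (split_ordP i) => j ->.
  rewrite (ord1 j); split=> [y Vy|].
    apply/derivable_lshift; under eq_fun do rewrite row_mxKr; exact: derivable_cst.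
  apply: (dC_ext oV) (dC_cst oV k 0) => y _.
  by rewrite derive_lshift; under eq_fun do rewrite row_mxKr; rewrite derive_cst.
have [fd fk] := H j; split=> [y Vy|].
  by apply/derivable_rshift; under eq_fun do rewrite row_mxKr; exact: fd.
apply: (dC_ext oV) (IH _ fk) => y _.
by rewrite derive_rshift; under eq_fun do rewrite row_mxKr.
Qed.

Lemma dC_height k : dC cylinder k (fun y => y 0 l0).
Proof.
have oV := cylinder_open.
case: k => // k i; case: (split_ordP i) => j ->.
  have E y : (fun s : R => (row_mx s%:M (rsubmx y) : 'rV[R]_(1 + n)) 0 l0) = id.
    by apply/funext => s; rewrite row_mxEl mxE eqxx mulr1n.
  rewrite (ord1 j); split=> [y Vy|].
    by apply/derivable_lshift; rewrite E; exact: derivable_id.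
  apply: (dC_ext oV) (dC_cst oV k 1) => y _.
  by rewrite derive_lshift E derive_id.
have E y : (fun x => (row_mx (lsubmx y) x : 'rV[R]_(1 + n)) 0 l0) = cst (y 0 l0).
  by apply/funext => s; rewrite row_mxEl mxE.
split=> [y Vy|]; first by apply/derivable_rshift; rewrite E; exact: derivable_cst.
apply: (dC_ext oV) (dC_cst oV k 0) => y _.
by rewrite derive_rshift E derive_cst.
Qed.

End Product.

(** [deformation] and [extension_metric] agree with [hmet] and [extmet] only on the chart image,
    where [D] is known to be self-adjoint; equality on an open set is enough for the curvature. *)
Lemma ricci_tensor_local (R : realType) n (U : set 'rV[R]_n) (oU : open U)
  (H K : 'rV[R]_n -> 'M[R]_n) x :
  (forall y, U y -> H y = K y) -> U x -> ricci_tensor H x = ricci_tensor K x.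
Proof.
move=> HK Ux.
have gHK i y : U y -> gam H i y = gam K i y.
  move=> Uy; have dHK j : 'D_(frame R j) H y = 'D_(frame R j) K y.
    by apply: near_eq_derive; near=> z; apply: HK; near: z; exact: near_open.
  have dHKf : (fun j => 'D_(frame R j) H y) = (fun j => 'D_(frame R j) K y) by apply: funext.
  by rewrite !gamE (HK y Uy) dHK dHKf.
apply/matrixP => j k; rewrite [LHS]mxE [RHS]mxE; apply: eq_bigr => i _.
rewrite /riemann !levi_civita_cst !levi_civita_frame !(gHK _ x Ux).
suff E a b : 'D_(frame R a) (fun y => row k (gam H b y)) x = 'D_(frame R a)
  (fun y => row k (gam K b y)) x.
  by rewrite (E i j) (E j i).
by apply: near_eq_derive; near=> z; congr (row k _); apply: gHK; near: z; exact: near_open.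
Unshelve. all: by end_near. Qed.

Lemma is_derive_block_mx (R : realType) (V : normedModType R) p1 p2 q1 q2
   (A : V -> 'M[R]_(p1, q1)) (B : V -> 'M[R]_(p1, q2))
   (C : V -> 'M[R]_(p2, q1)) (D : V -> 'M[R]_(p2, q2)) x v dA dB dC dD :
  is_derive x v A dA -> is_derive x v B dB -> is_derive x v C dC -> is_derive x v D dD ->
  is_derive x v (fun y => block_mx (A y) (B y) (C y) (D y)) (block_mx dA dB dC dD).
Proof.
move=> /is_derive_mxP HA /is_derive_mxP HB /is_derive_mxP HC /is_derive_mxP HD.
apply/is_derive_mxP => i j; case: (split_ordP i) => i' ->; case: (split_ordP j) => j' ->.
- by rewrite block_mxEul; under eq_fun do rewrite block_mxEul.
- by rewrite block_mxEur; under eq_fun do rewrite block_mxEur.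
- by rewrite block_mxEdl; under eq_fun do rewrite block_mxEdl.
- by rewrite block_mxEdr; under eq_fun do rewrite block_mxEdr.
Qed.

Section Extension.
Context {R : realType} {n : nat}.
Notation l0 := (lshift n (ord0 : 'I_1)).
Notation rs := (rshift 1).
Variable U : set 'rV[R]_n.
Hypothesis oU : open U.
Variables G D : 'rV[R]_n -> 'M[R]_n.
Hypothesis smoothG : forall k, dCmx U k G.
Hypothesis smoothD : forall k, dCmx U k D.
Hypothesis posG : forall x, U x -> posdefmx (G x).
Hypothesis adjD : forall x, U x -> D x *m G x = G x *m (D x)^T.

Notation hm := (hmet G D).
Let uH t x := @hmet_unit _ _ U G D posG adjD t x.
Let sH t x := @hmet_sym _ _ U G D posG adjD t x.
Let smH t k := smooth_hmet oU smoothG smoothD k t.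
Let V := cylinder U.
Let oV : open V := cylinder_open oU.

Definition extmet (y : 'rV[R]_(1 + n)) : 'M[R]_(1 + n) :=
  block_mx 1%:M 0 0 (hm (2 * y 0 l0) (rsubmx y)).

Lemma smooth_extmet k : dCmx V k extmet.
Proof.
apply: (dCmx_block oV); [exact: dCmx_cst|exact: dCmx_cst|exact: dCmx_cst|].
apply: (dCmxM oV); last first.
  move=> i j; exact: (dC_rsubmx oU (f := fun x => G x i j)) (smoothG k i j).
apply: (dCmx_expmx oV); apply: (dCmxZ oV).
  by apply: (dCM oV); [exact: dC_cst|exact: dC_height].
move=> i j; exact: (dC_rsubmx oU (f := fun x => D x i j)) (smoothD k i j).
Qed.

Lemma extmet_unit y : V y -> extmet y \in unitmx.
Proof. by move=> Vy; rewrite unitmxE det_ublock det1 mul1r -unitmxE; exact: uH. Qed.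

Lemma ginv_extmet y : V y -> ginv extmet y = block_mx 1%:M 0 0 (ginv (hm (2 * y 0 l0)) (rsubmx y)).
Proof.
move=> Vy; apply: (can_inj (mulKmx (extmet_unit Vy))); rewrite mulmxV ?extmet_unit//.
rewrite mulmx_block !(mulmx0, mul0mx, addr0, add0r) mulmx1 mulmxV; last exact: uH.
by rewrite -scalar_mx_block.
Qed.

Lemma lsubmx_l0 (y : 'rV[R]_(1 + n)) x : (row_mx (lsubmx y) x : 'rV[R]_(1 + n)) 0 l0 = y 0 l0.
Proof. by rewrite row_mxEl mxE. Qed.

Lemma scalar_l0 (s : R) x : (row_mx s%:M x : 'rV[R]_(1 + n)) 0 l0 = s.
Proof. by rewrite row_mxEl mxE eqxx mulr1n. Qed.

Lemma derive_extmet_rs i y : V y ->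
  'D_(frame R (rs i)) extmet y = block_mx 0 0 0 ('D_(frame R i) (hm (2 * y 0 l0)) (rsubmx y)).
Proof.
move=> Vy; rewrite derive_rshift.
rewrite (_ : (fun x => _) = fun x => block_mx 1%:M 0 0 (hm (2 * y 0 l0) x)); last first.
  by apply/funext => x; rewrite /extmet lsubmx_l0 row_mxKr.
have dH := dCmx_is_derive i (smH (2 * y 0 l0) 1) Vy.
have cst0 p q (C : 'M[R]_(p, q)) : is_derive (rsubmx y) (frame R i) (fun=> C) 0.
  exact: is_derive_cst.
by have [_] := is_derive_block_mx (cst0 1%N 1%N 1%:M) (cst0 1%N n 0) (cst0 n 1%N 0) dH.
Qed.

Lemma is_derive_expmx_time (A : 'M[R]_n) (u : R) :
  is_derive u 1 (fun s => expmx ((2 * s) *: A)) (2 *: (A *m expmx ((2 * u) *: A))).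
Proof.
have dX : is_derive u 1 (fun s : R => (2 * s) *: A) (2 *: A).
  apply/is_derive_mxP => i j; rewrite mxE.
  rewrite (_ : (fun s => _) = fun s => (2 * A i j) * s); last first.
    by apply/funext => s; rewrite mxE; ring.
  apply: (is_derive_eq (is_derive_mulr (is_derive_cst _ _ _) (is_derive_id _ _))).
  by rewrite mul0r add0r mulr1.
have [dX1 E] := dX.
apply: (is_derive_eq (is_derive_expmx dX1)); rewrite E.
have := @expmx_block_ur _ _ ((2 * u) *: A) (2 *: A) 0 _.
rewrite !mulmx0 !mul0mx subrr !addr0 => -> //; last first.
  by rewrite -!scalemxAl -!scalemxAr !scalerA mulrC.
rewrite -scalemxAr; congr (_ *: _).
by apply: expmx_comm; rewrite -scalemxAl -scalemxAr.
Qed.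

Lemma is_derive_hmet_time x (u : R) :
  is_derive u 1 (fun s => hm (2 * s) x) (2 *: (D x *m hm (2 * u) x)).
Proof.
apply: (is_derive_eq (is_derive_mulmx (is_derive_expmx_time (D x) u) (is_derive_cst (G x) _ _))).
by rewrite mulmx0 addr0 -scalemxAl -mulmxA.
Qed.

Lemma derive_extmet_l0 y : V y ->
  'D_(frame R l0) extmet y =
  block_mx 0 0 0 (2 *: (D (rsubmx y) *m hm (2 * y 0 l0) (rsubmx y))).
Proof.
move=> Vy; rewrite derive_lshift.
rewrite (_ : (fun s => _) = fun s => block_mx 1%:M 0 0 (hm (2 * s) (rsubmx y))); last first.
  by apply/funext => s; rewrite /extmet scalar_l0 row_mxKr.
have dH := is_derive_hmet_time (rsubmx y) (y 0 l0).
have cst0 p q (C : 'M[R]_(p, q)) : is_derive (y 0 l0) (1 : R) (fun=> C) 0.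
  exact: is_derive_cst.
by have [_] := is_derive_block_mx (cst0 1%N 1%N 1%:M) (cst0 1%N n 0) (cst0 n 1%N 0) dH.
Qed.

Lemma gam_extmet_l0 y : V y -> gam extmet l0 y = block_mx 0 0 0 (D (rsubmx y)).
Proof.
move=> Vy; rewrite gamE -/(ginv _ _) ginv_extmet// derive_extmet_l0//.
have -> : kosz (fun j => 'D_(frame R j) extmet y) l0 = 0.
  apply/matrixP => j l; rewrite mxE [RHS]mxE; case: (split_ordP j) => j' ->.
    rewrite (ord1 j') derive_extmet_l0//; case: (split_ordP l) => l' ->.
      by rewrite block_mxEul mxE.
    by rewrite block_mxEur mxE.
  rewrite derive_extmet_rs//; case: (split_ordP l) => l' ->.
    by rewrite block_mxEul mxE.
  by rewrite block_mxEur mxE.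
rewrite trmx0 subr0 addr0 scale_block_mx !scaler0 mulmx_block !(mulmx0, mul0mx, addr0, add0r).
rewrite scalerA mulVf ?pnatr_eq0// scale1r mulmxK//; exact: uH.
Qed.

(** The Gauss and Weingarten formulas for the slices of constant height: the upper row is the
    derivative of the unit normal, given by [D], and the left column is minus the second fundamental
    form. *)
Lemma gam_extmet_rs j y : V y -> gam extmet (rs j) y =
  block_mx 0 (row j (D (rsubmx y)))
   (- (row j (D (rsubmx y) *m hm (2 * y 0 l0) (rsubmx y)))^T)
   (gam (hm (2 * y 0 l0)) j (rsubmx y)).
Proof.
move=> Vy; set H := hm _; set x := rsubmx y.
rewrite gamE -/(ginv _ _) ginv_extmet// derive_extmet_rs// -/H -/x.
have -> : kosz (fun j => 'D_(frame R j) extmet y) (rs j) =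
    block_mx 0 (2 *: row j (D x *m H x)) 0 (kosz (fun j => 'D_(frame R j) H x) j).
  apply/matrixP => k l; rewrite mxE; case: (split_ordP k) => k' ->.
    rewrite (ord1 k') derive_extmet_l0//; case: (split_ordP l) => l' ->.
      by rewrite block_mxEdl block_mxEul !mxE.
    by rewrite block_mxEdr block_mxEur [LHS]mxE [RHS]mxE [row _ _ _ _]mxE.
  rewrite derive_extmet_rs//; case: (split_ordP l) => l' ->.
    by rewrite !block_mxEdl !mxE.
  by rewrite !block_mxEdr [RHS]mxE.
rewrite tr_block_mx !trmx0 opp_block_mx !add_block_mx !(add0r, addr0, oppr0).
rewrite scale_block_mx scaler0 mulmx_block !(mulmx0, mul0mx, addr0, add0r) mulmx1.
congr block_mx.
- rewrite scalerA mulVf ?pnatr_eq0// scale1r -row_mul mulmxK//; exact: uH.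
- by rewrite linearZ/= scalerN scalerA mulVf ?pnatr_eq0// scale1r.
- by rewrite gamE.
Qed.

End Extension.

Lemma riemE (R : realType) n (H : 'rV[R]_n -> 'M[R]_n) i j x k l :
  riem H i j x k l = ('D_(frame R i) (gam H j) x) k l - ('D_(frame R j) (gam H i) x) k l +
    ((gam H j x *m gam H i x) k l - (gam H i x *m gam H j x) k l).
Proof. by rewrite /riem addmxE !submxE. Qed.

(** * The Ricci tensor of the extension, component by component *)

Section ExtensionRicci.
Context {R : realType} {n : nat}.
Notation l0 := (lshift n (ord0 : 'I_1)).
Notation rs := (rshift 1).
Variable U : set 'rV[R]_n.
Hypothesis oU : open U.
Variables G D : 'rV[R]_n -> 'M[R]_n.
Hypothesis smoothG : forall k, dCmx U k G.
Hypothesis smoothD : forall k, dCmx U k D.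
Hypothesis posG : forall x, U x -> posdefmx (G x).
Hypothesis adjD : forall x, U x -> D x *m G x = G x *m (D x)^T.

Notation hm := (hmet G D).
Notation K := (extmet G D).
Let uH t x := @hmet_unit _ _ U G D posG adjD t x.
Let sH t x := @hmet_sym _ _ U G D posG adjD t x.
Let smH t k := smooth_hmet oU smoothG smoothD k t.
Let V := cylinder U.
Let oV : open V := cylinder_open oU.
Let smK k := smooth_extmet oU smoothG smoothD k.
Let uK y := @extmet_unit _ _ U G D posG adjD y.
Let g0 y (Vy : V y) := gam_extmet_l0 oU smoothG smoothD posG adjD Vy.
Let gr j y (Vy : V y) := gam_extmet_rs oU smoothG smoothD posG adjD j Vy.

Variables (y : 'rV[R]_(1 + n)) (Vy : V y).
Let u := y 0 l0.
Let x := rsubmx y.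
Let H := hm (2 * u).
Let Ux : U x. Proof. exact: Vy. Qed.

Let near_V : \forall z \near y, V z.
Proof. exact: near_open. Qed.

Let dgam a c : is_derive y (frame R a) (gam K c) ('D_(frame R a) (gam K c) y) :=
  dCmx_is_derive a (smooth_gam oV smK uK 1%N c) Vy.

Let dgamE a c p q : ('D_(frame R a) (gam K c) y) p q = 'D_(frame R a) (fun z => gam K c z p q) y.
Proof. by have /is_derive_mxP/(_ p q)[_ <-] := dgam a c. Qed.

Let derive_D i : is_derive x (frame R i) D ('D_(frame R i) D x).
Proof. exact: dCmx_is_derive (smoothD 1) Ux. Qed.

Let dgam_l0_rs i : 'D_(frame R (rs i)) (gam K l0) y = block_mx 0 0 0 ('D_(frame R i) D x).
Proof.
transitivity ('D_(frame R (rs i)) (fun z : 'rV[R]_(1 + n) => block_mx (0 : 'M[R]_1) 0 0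
  (D (rsubmx z))) y).
  by apply: near_eq_derive; near=> z; apply: g0; near: z; exact: near_V.
rewrite derive_rshift; under eq_fun do rewrite row_mxKr.
have cst0 p q (C : 'M[R]_(p, q)) : is_derive x (frame R i) (fun=> C) 0 by exact: is_derive_cst.
by have [_] := is_derive_block_mx (cst0 1%N 1%N 0) (cst0 1%N n 0) (cst0 n 1%N 0) (derive_D i).
Unshelve. all: by end_near. Qed.

Let dgam_top c j p : ('D_(frame R c) (gam K (rs j)) y) l0 (rs p) =
  'D_(frame R c) (fun z : 'rV[R]_(1 + n) => D (rsubmx z) j p) y.
Proof.
rewrite dgamE; apply: near_eq_derive; near=> z.
by rewrite gr; [rewrite block_mxEur mxE|near: z; exact: near_V].
Unshelve. all: by end_near. Qed.

Let dD_rs i j p : 'D_(frame R (rs i)) (fun z : 'rV[R]_(1 + n) => D (rsubmx z) j p) y =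
  ('D_(frame R i) D x) j p.
Proof.
rewrite derive_rshift; under eq_fun do rewrite row_mxKr.
by have /is_derive_mxP/(_ j p)[_ ->] := derive_D i.
Qed.

Let dD_l0 j p : 'D_(frame R l0) (fun z : 'rV[R]_(1 + n) => D (rsubmx z) j p) y = 0.
Proof. by rewrite derive_lshift; under eq_fun do rewrite row_mxKr; rewrite derive_cst. Qed.

Let dgam_l0_left j k : ('D_(frame R l0) (gam K (rs j)) y) (rs k) l0 =
  - 2 * (D x *m (D x *m H x)) j k.
Proof.
rewrite dgamE.
transitivity ('D_(frame R l0) (fun z : 'rV[R]_(1 + n) => -
  (D (rsubmx z) *m hm (2 * z 0 l0) (rsubmx z)) j k) y).
  apply: near_eq_derive; near=> z.
  rewrite gr; last by near: z; exact: near_V.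
  by rewrite block_mxEdl mxE [_^T _ _]mxE [row _ _ _ _]mxE.
rewrite derive_lshift.
rewrite (_ : (fun s => _) = fun s => - (D x *m hm (2 * s) x) j k); last first.
  by apply/funext => s; rewrite scalar_l0 row_mxKr.
have := is_derive_mulmx (is_derive_cst (D x) u (1 : R)) (is_derive_hmet_time G D x u).
move=> /is_derive_mxP/(_ j k)/is_deriveN[_ ->].
by rewrite mul0mx add0r -scalemxAr mxE mulNr.
Unshelve. all: by end_near. Qed.

Let dgam_rs_rs i j k m : ('D_(frame R (rs i)) (gam K (rs j)) y) (rs k) (rs m) =
  ('D_(frame R i) (gam H j) x) k m.
Proof.
rewrite dgamE.
transitivity ('D_(frame R (rs i)) (fun z : 'rV[R]_(1 + n) => gam (hm (2 * z 0 l0)) j (rsubmx z) k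
  m) y).
  apply: near_eq_derive; near=> z.
  by rewrite gr; [rewrite block_mxEdr|near: z; exact: near_V].
rewrite derive_rshift.
rewrite (_ : (fun s => _) = fun s => gam H j s k m); last first.
  by apply/funext => s; rewrite lsubmx_l0 row_mxKr.
have dg : is_derive x (frame R i) (gam H j) ('D_(frame R i) (gam H j) x) := dCmx_is_derive i
  (smooth_gam oU (smH _) (@uH _) 1%N j) Ux.
by have /is_derive_mxP/(_ k m)[_ ->] := dg.
Unshelve. all: by end_near. Qed.

Let dgam_left_zero i k : ('D_(frame R (rs i)) (gam K l0) y) (rs k) l0 = 0.
Proof. by rewrite dgam_l0_rs block_mxEdl mxE. Qed.

(** By [sum_gam] on the slices the sum is the height derivative of a connection trace, which
    [trgam_hmet] at [t = 2u] shows to be affine in the height. *)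
Let dgam_trace k : \sum_i ('D_(frame R l0) (gam K (rs i)) y) (rs k) (rs i) =
  \tr ('D_(frame R k) D x).
Proof.
have : is_derive y (frame R l0) (fun z => \sum_i gam K (rs i) z (rs k) (rs i))
    (\sum_i ('D_(frame R l0) (gam K (rs i)) y) (rs k) (rs i)).
  by apply: is_derive_bigsum => i; have /is_derive_mxP := dgam l0 (rs i); exact.
move=> [_ <-].
transitivity ('D_(frame R l0) (fun z : 'rV[R]_(1 + n) => trgam (hm (2 * z 0 l0)) k (rsubmx z)) y).
  apply: near_eq_derive; near=> z.
  have Vz : V z by near: z; exact: near_V.
  rewrite /trgam -(sum_gam oU (smH _) (@sH _) k Vz); apply: eq_bigr => i _.
  by rewrite gr// block_mxEdr.
rewrite derive_lshift.
rewrite (_ : (fun s => _) = fun s => \tr ('D_(frame R k) D x) * s + trgam G k x); last first.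
  apply/funext => s; rewrite scalar_l0 row_mxKr.
  by rewrite (trgam_hmet oU smoothG smoothD posG adjD (2 * s) k Ux); field.
have [_ ->] := is_deriveD (is_derive_mulr (is_derive_cst (\tr ('D_(frame R k) D x)) u (1 : R))
  (is_derive_id _ _)) (is_derive_cst (trgam G k x) u (1 : R)).
by rewrite mul0r add0r mulr1 addr0.
Unshelve. all: by end_near. Qed.

Let E0 := g0 Vy.
Let Er j := gr j Vy.

Let divK j : divergence H D x j = \sum_i ('D_(frame R i) D x) j i +
  \sum_l D x j l * trgam H l x - \tr (gam H j x *m D x).
Proof. exact: (divergence_gam oU smoothD j (smH _) (@uH _) (@sH _) Ux). Qed.

Let sumDgam j : \sum_i \sum_l D x j l * gam H i x l i = \sum_l D x j l * trgam H l x.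
Proof.
rewrite exchange_big; apply: eq_bigr => l _.
by rewrite -mulr_sumr (sum_gam oU (smH _) (@sH _) l Ux).
Qed.

Lemma ricci_ext_uu : ricci_tensor K y l0 l0 = - \tr (D x *m D x).
Proof.
rewrite (ricciE oV)// big_split_ord big_ord1/=.
rewrite {1}/riem subrr subrr addr0 mxE add0r -sumrN; apply: eq_bigr => i _.
rewrite riemE dgam_l0_rs block_mxEur mxE dgam_top dD_l0 subrr add0r.
rewrite E0 Er !mulmx_block !block_mxEur !(mul0mx, mulmx0, add0r, addr0) mxE sub0r; congr (- _).
by rewrite -row_mul mxE.
Qed.

Lemma ricci_ext_ju j : ricci_tensor K y (rs j) l0 = divergence H D x j - \tr ('D_(frame R j) D x).
Proof.
rewrite (ricciE oV)// big_split_ord big_ord1/=.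
have -> : riem K (lshift n 0) (rs j) y l0 (lshift n 0) = 0.
  rewrite riemE dgam_l0_rs block_mxEul mxE subr0 dgamE.
  have -> : 'D_(frame R (lshift n 0)) (fun z => gam K (rs j) z l0 (lshift n 0)) y = 0.
    rewrite -(derive_cst (0 : R) y (frame R (lshift n 0))); apply: near_eq_derive; near=> z.
    by rewrite gr; [rewrite block_mxEul mxE|near: z; exact: near_V].
  rewrite E0 Er !mulmx_block !block_mxEul.
  by rewrite !(mul0mx, mulmx0, add0r, addr0) subrr.
rewrite add0r divK.
rewrite (eq_bigr (fun i => ('D_(frame R i) D x) j i - ('D_(frame R j) D x) i i +
   (\sum_l D x j l * gam H i x l i) - (D x *m gam H j x) i i)); last first.
  move=> i _; rewrite riemE !dgam_top !dD_rs addrA; congr (_ - _ + _ - _).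
    rewrite !Er mulmx_block block_mxEur mul0mx add0r mxE.
    by apply: eq_bigr => l _; rewrite [row _ _ _ _]mxE.
  by rewrite !Er mulmx_block block_mxEur mul0mx add0r -row_mul mxE.
rewrite !(sumrB, big_split)/= -/(\tr (D x *m gam H j x)) (mxtrace_mulC (D x)).
rewrite sumDgam.
rewrite -/(\tr ('D_(frame R j) D x)).
move: (\tr _) (\tr _) (\sum_i _) (\sum_i _) => a b c d; ring.
Unshelve. all: by end_near. Qed.

(** Computed directly rather than through symmetry of the Ricci tensor: here the trace term comes
    from the height derivative of the connection ([dgam_trace]), while in [ricci_ext_ju] it comes
    from the tangential derivatives of [D]. *)
Lemma ricci_ext_uk k : ricci_tensor K y l0 (rs k) = divergence H D x k - \tr ('D_(frame R k) D x).
Proof.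
rewrite (ricciE oV)// big_split_ord big_ord1/=.
rewrite {1}/riem subrr subrr addr0 mxE add0r divK.
rewrite (eq_bigr (fun i => ('D_(frame R i) D x) k i - ('D_(frame R l0) (gam K (rs i)) y) (rs k)
  (rs i) +
   (\sum_l D x k l * gam H i x l i) - (gam H i x *m D x) k i)); last first.
  move=> i _; rewrite riemE dgam_l0_rs block_mxEdr addrA; congr (_ - _ + _ - _).
    by rewrite E0 Er mulmx_block block_mxEdr mul0mx add0r mxE.
  by rewrite E0 Er mulmx_block block_mxEdr mulmx0 add0r.
rewrite !(sumrB, big_split)/= dgam_trace.
rewrite sumDgam.
have -> : \sum_i (gam H i x *m D x) k i = \tr (gam H k x *m D x).
  apply: eq_bigr => i _; rewrite mxE [RHS]mxE; apply: eq_bigr => l _.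
  by rewrite (gam_torsion oU (smH _) (@sH _) i k l Ux).
move: (\tr _) (\tr _) (\sum_i _) (\sum_i _) => a b c d; ring.
Qed.

Lemma ricci_ext_jk j k : ricci_tensor K y (rs j) (rs k) =
  ricci_tensor H x j k - \tr (D x) * (D x *m H x) j k.
Proof.
rewrite (ricciE oV)// big_split_ord big_ord1/=.
(* The height derivative of the second fundamental form gives the factor [- 2], and the product of
   connection matrices gives back one term. *)
have -> : riem K (lshift n 0) (rs j) y (rs k) (lshift n 0) = - (D x *m (D x *m H x)) j k.
  rewrite riemE; transitivity (- 2 * (D x *m (D x *m H x)) j k - 0 +
      (0 - - (D x *m (D x *m H x)) j k)); last by ring.
  congr (_ - _ + (_ - _)); [exact: dgam_l0_left|exact: dgam_left_zero| |].
    by rewrite E0 Er mulmx_block block_mxEdl !mulmx0 addr0 mxE.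
  rewrite E0 Er mulmx_block block_mxEdl mul0mx add0r mulmxN [LHS]mxE [X in - X = _]mxE.
  congr (- _).
  have -> : D x *m (D x *m H x) = (D x *m H x) *m (D x)^T.
    by rewrite -[RHS]mulmxA; congr (_ *m _); exact: (adj_hmet adjD (2 * u) Ux).
  rewrite [RHS]mxE; apply: eq_bigr => l _.
  by rewrite [_^T _ _]mxE [row _ _ _ _]mxE [(D x)^T _ _]mxE mulrC.
rewrite (ricciE oU (smH _) (@uH _) j k Ux).
(* This is the Gauss equation. Its last product sums to [D x *m (D x *m H x)] and cancels the normal
   contribution just computed; the other one yields the factor [\tr (D x)]. *)
rewrite (eq_bigr (fun i => riem H i j x k i - (D x *m H x) j k * D x i i + (D x *m H x) i k * D x
  j i)); last first.
  move=> i _; rewrite !riemE !dgam_rs_rs.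
  rewrite !Er !mulmx_block !block_mxEdr !addmxE.
  have E a b : (- (row a (D x *m hm (2 * y 0 l0) x))^T *m row b (D x)) k i = -
    ((D x *m H x) a k * D x b i).
    by rewrite mulNmx mxE [X in - X]mxE big_ord1 [_^T _ _]mxE ![row _ _ _ _]mxE.
  rewrite !E; ring.
rewrite big_split sumrB/= -mulr_sumr -/(\tr (D x)).
have -> : \sum_i (D x *m H x) i k * D x j i = (D x *m (D x *m H x)) j k.
  by rewrite [RHS]mxE; apply: eq_bigr => i _; rewrite mulrC.
rewrite [\tr (D x) * _]mulrC; ring.
Qed.

End ExtensionRicci.

(** * Globalization *)

Section LocallyConstant.
Context {R : realType} {V : normedModType R}.

Lemma is_derive_line (W : normedModType R) (f : V -> W) x w (s : R) d :
  is_derive (x + s *: w) w f d -> is_derive s 1 (fun t => f (x + t *: w)) d.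
Proof.
move=> [fd E].
have Q : (fun h : R => h^-1 *: (((fun t => f (x + t *: w)) \o shift s) (h *: 1) - f (x + s *: w))) =
   (fun h : R => h^-1 *: ((f \o shift (x + s *: w)) (h *: w) - f (x + s *: w))).
  apply/funext => h /=; congr (_ *: (f _ - _)).
  by rewrite [h *: 1]mulr1 scalerDl addrCA.
by apply: DeriveDef; rewrite /derivable /derive Q.
Qed.

Lemma locally_constant (U : set V) (f : V -> R) x : open U -> U x ->
  (forall y v, U y -> is_derive y v f 0) -> \forall y \near x, f y = f x.
Proof.
move=> oU Ux fd.
have /nbhs_ballP[r /= r0 rU] : nbhs x U by exact: open_nbhs_nbhs.
near=> y.
have yr : ball x r y by near: y; exact: nbhsx_ballx.
have seg (s : R) : s \in `[0, 1]%R -> is_derive s 1 (fun t => f (x + t *: (y - x))) 0.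
  move=> /itvP s01; apply: is_derive_line; apply: fd; apply: rU.
  rewrite -ball_normE /= opprD addNKr normrN normrZ ger0_norm ?s01//.
  move: yr; rewrite -ball_normE /= distrC; apply: le_lt_trans.
  by rewrite ler_piMl ?s01.
have [c _] := @MVT_segment R (fun t => f (x + t *: (y - x))) (fun=> 0) 0 1 ler01
   (fun s s01 => seg s (subset_itv_oo_cc s01))
   (derivable_within_continuous (fun s s01 => @ex_derive _ _ _ _ _ _ _ (seg s s01))).
rewrite scale1r scale0r addr0 mul0r (addrC x) subrK => /eqP.
by rewrite subr_eq0 => /eqP.
Unshelve. all: by end_near. Qed.

End LocallyConstant.

Section Charts.
Context {R : realType} {n : nat} {N : topologicalType}.
Variables (A : atlas R n N) (g D : tensor2 A).
Hypothesis manifoldN : smooth_manifold A.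
Hypothesis metric_g : riemannian_metric g.
Hypothesis symmetric_D : symmetric_endomorphism_field g D.

Lemma chart_img_open i : open (chart_img (A := A) i).
Proof. by have [_ [_ [_ [H _]]]] := manifoldN; have [] := H i. Qed.

Lemma chart_smooth_metric i k : dCmx (chart_img i) k (g i).
Proof. by have [H _ _ _] := metric_g; exact: (classC_dC (@chart_img_open i) (H i k)). Qed.

Lemma chart_smooth_endo i k : dCmx (chart_img i) k (D i).
Proof. by have [[H _] _] := symmetric_D; exact: (classC_dC (@chart_img_open i) (H i k)). Qed.

Lemma chart_diff_endo i x : chart_img i x -> differentiable (D i) x.
Proof. by have [[H _] _] := symmetric_D => ix; have [fd _] := H i 1%N; exact: fd. Qed.

Lemma chart_posdef i x : chart_img i x -> posdefmx (g i x).
Proof. by have [_ _ H1 H2] := metric_g => ix; split=> [|v v0]; [exact: H1|exact: H2]. Qed.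

Lemma chart_adjoint i x : chart_img i x -> D i x *m g i x = g i x *m (D i x)^T.
Proof.
have [_ H] := symmetric_D => ix; apply/matrixP => a b.
have := H i x (delta_mx 0 a) (delta_mx 0 b) ix.
rewrite trmx_mul trmx_delta !mulmxA -!colE -mulmxA -[in RHS]mulmxA -!rowE.
by move=> /matrixP/(_ 0 0); rewrite ![col _ _ _ _]mxE ![row _ _ _ _]mxE.
Qed.

End Charts.

Section Global.
Context {R : realType} {n : nat} {N : topologicalType}.
Variables (A : atlas R n N) (g D : tensor2 A).
Hypothesis manifoldN : smooth_manifold A.
Hypothesis metric_g : riemannian_metric g.
Hypothesis symmetric_D : symmetric_endomorphism_field g D.

Notation l0 := (lshift n (ord0 : 'I_1)).
Let oU i : open (chart_img i) := @chart_img_open _ _ _ A manifoldN i.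
Let smg i k : dCmx (chart_img i) k (g i) := chart_smooth_metric manifoldN metric_g i k.
Let smD i k : dCmx (chart_img i) k (D i) := chart_smooth_endo manifoldN symmetric_D i k.
Let posg i x : chart_img i x -> posdefmx (g i x) := @chart_posdef _ _ _ _ _ metric_g i x.
Let adj i x : chart_img i x -> D i x *m g i x = g i x *m (D i x)^T := @chart_adjoint _ _ _ _ _ _
  symmetric_D i x.

Lemma deformation_hmet u i x : chart_img i x ->
  deformation g D u i x = hmet (g i) (D i) (2 * u) x.
Proof.
move=> ix; rewrite /deformation /hmet.
have [Q [l [_ Ql _]]] := eigenframe (posg (i := i)) (adj (i := i)) ix.
by rewrite -mulmxA -(expD_adj (adj (i := i)) u ix) mulmxA (expmxDZ _ _ Ql) mulr2n mulrDl mul1r.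
Qed.

Lemma deformed_ricci_hmet u i x : chart_img i x ->
  deformed_ricci g D u i x =
  ricci_tensor (hmet (g i) (D i) (2 * u)) x *m ginv (hmet (g i) (D i) (2 * u)) x.
Proof.
move=> ix; rewrite /deformed_ricci /ricci_operator /ginv (deformation_hmet u ix).
by rewrite (ricci_tensor_local (@oU i) (fun y => @deformation_hmet u i y) ix).
Qed.

Lemma extension_chart_img (i : chart_index A) y :
  chart_img (A := extension_atlas A) i y <-> chart_img (A := A) i (rsubmx y).
Proof.
split=> [[[u p]/= ip <-]|[p ip Ep]]; first by rewrite row_mxKr; exists p.
exists (lsubmx y 0 0, p) => //=.
by rewrite Ep -mx11_scalar hsubmxK.
Qed.

Lemma extension_ricci (i : chart_index A) y : chart_img (A := A) i (rsubmx y) ->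
  ricci_tensor (extension_metric g D i) y = ricci_tensor (extmet (g i) (D i)) y /\
  extension_metric g D i y = extmet (g i) (D i) y.
Proof.
have E z : chart_img (A := A) i (rsubmx z) -> extension_metric g D i z = extmet (g i) (D i) z.
  move=> iz; rewrite /extension_metric /extmet (deformation_hmet (lsubmx z 0 0) iz).
  by rewrite [lsubmx z 0 0]mxE.
move=> iy; split; last exact: E.
exact: (ricci_tensor_local (cylinder_open (@oU i)) E iy).
Qed.

Lemma einstein_withP c : einstein_with (extension_metric g D) c <->
  forall i x, chart_img i x ->
    [/\ \tr (D i x *m D i x) = - c,
        forall t k, divergence (hmet (g i) (D i) t) (D i) x k = \tr ('D_(frame R k) (D i) x) &
        forall t, ricci_tensor (hmet (g i) (D i) t) x *m ginv (hmet (g i) (D i) t) x =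
           \tr (D i x) *: D i x + c%:M].
Proof.
have unit_hm i t x (ix : chart_img i x) := hmet_unit (posg (i := i)) (adj (i := i)) t ix.
split=> [Ein i x ix|H i y /extension_chart_img iy].
  (* The point above [x] at height [t / 2], where the slice metric is [hmet] at [t]. *)
  pose y t : 'rV[R]_(1 + n) := row_mx (t / 2)%:M x.
  have xy t : rsubmx (y t) = x by rewrite row_mxKr.
  have iy t : chart_img i (rsubmx (y t)) by rewrite xy.
  have t2 t : 2 * y t 0 l0 = t by rewrite scalar_l0; field.
  have E t : ricci_tensor (extmet (g i) (D i)) (y t) = c *: extmet (g i) (D i) (y t).
    have [<- <-] := extension_ricci (iy t).
    by apply: Ein; apply/extension_chart_img.
  split=> [|t k|t].
  - have := ricci_ext_uu (@oU i) (smg i) (smD i) (posg (i := i)) (adj (i := i)) (iy 0).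
    by rewrite xy E mxE block_mxEul mxE eqxx mulr1 => ->; rewrite opprK.
  - have := ricci_ext_ju (@oU i) (smg i) (smD i) (posg (i := i)) (adj (i := i)) (iy t) k.
    rewrite xy t2 E mxE block_mxEdl mxE mulr0 => /esym/eqP.
    by rewrite subr_eq0 => /eqP.
  apply: (can_inj (mulmxK (unit_hm i t x ix))); rewrite mulmxKV ?unit_hm//.
  apply/matrixP => j k.
  have := ricci_ext_jk (@oU i) (smg i) (smD i) (posg (i := i)) (adj (i := i)) (iy t) j k.
  rewrite xy t2 E mxE block_mxEdr xy t2 => /eqP; rewrite eq_sym subr_eq => /eqP ->.
  rewrite mulmxDl -scalemxAl mul_scalar_mx addmxE [X in _ = X + _]mxE [X in _ = _ + X]mxE.
  by rewrite addrC.
have [E1 E2] := extension_ricci iy; rewrite E1 E2.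
have [T2 Tdiv Tric] := H i _ iy.
apply/matrixP => a b; rewrite [RHS]mxE.
case: (split_ordP a) => a' ->; case: (split_ordP b) => b' ->.
- rewrite (ord1 a') (ord1 b') (ricci_ext_uu (@oU i) (smg i) (smD i) (posg (i := i))
  (adj (i := i)) iy).
  by rewrite T2 opprK block_mxEul mxE eqxx mulr1.
- rewrite (ord1 a') (ricci_ext_uk (@oU i) (smg i) (smD i) (posg (i := i)) (adj (i := i)) iy).
  by rewrite Tdiv subrr block_mxEur mxE mulr0.
- rewrite (ord1 b') (ricci_ext_ju (@oU i) (smg i) (smD i) (posg (i := i)) (adj (i := i)) iy).
  by rewrite Tdiv subrr block_mxEdl mxE mulr0.
rewrite (ricci_ext_jk (@oU i) (smg i) (smD i) (posg (i := i)) (adj (i := i)) iy) block_mxEdr.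
set t := 2 * _.
rewrite -(mulmxKV (unit_hm i t _ iy) (ricci_tensor _ _)) Tric mulmxDl -scalemxAl mul_scalar_mx.
by rewrite addmxE [X in X + _ - _]mxE [X in _ + X - _]mxE addrC addKr.
Qed.

Lemma trace_exp_chart i j p k : chart_dom i p -> chart_dom j p ->
  \tr (D i (chart i p) ^+ k) = \tr (D j (chart j p) ^+ k).
Proof.
move=> ip jp.
have [_ [_ [_ [HA _]]]] := manifoldN.
have [_ tg _ _] := metric_g; have [[_ tD] _] := symmetric_D.
have ov : overlap i j (chart i p) by exists p.
have [_ _ _ _ inv] := HA i.
have tr_p : transition i j (chart i p) = chart j p by rewrite /transition inv.
(* The transformation law writes the invertible [g i] as a product with the Jacobian as a factor,
   which forces the Jacobian to be invertible; it then conjugates the two matrices of [D]. *)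
have Ju : 'J (transition i j) (chart i p) \in unitmx.
  have gu : g i (chart i p) \in unitmx.
    by apply: (unitG (posg (i := i)) (adj (i := i))); exists p.
  by move: gu; rewrite (tg i j _ ov) !unitmx_mul => /andP[/andP[]].
have := tD i j _ ov; rewrite tr_p => E.
rewrite -[LHS](congr1 _ (mulmxK Ju (D i (chart i p) ^+ k))).
by rewrite (exprmx_comm k E) mxtrace_mulC mulKmx.
Qed.

Lemma trace_exp_constant k : connected [set: N] ->
  (forall i x v, chart_img i x -> is_derive x v (fun y => \tr (D i y ^+ k)) 0) ->
  forall i j x y, chart_img i x -> chart_img j y -> \tr (D i x ^+ k) = \tr (D j y ^+ k).
Proof.
move=> cN dD i0 j0 _ _ [p0 ip0 <-] [q0 jq0 <-].
have [_ [_ [cover [HA _]]]] := manifoldN.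
have loc p i : chart_dom i p -> \forall q \near p, forall j, chart_dom j q ->
    \tr (D j (chart j q) ^+ k) = \tr (D i (chart i p) ^+ k).
  move=> ip; have [odom oimg cchart _ _] := HA i.
  have ix : chart_img i (chart i p) by exists p.
  have cp : {for p, continuous (chart i)}.
    by move: cchart; rewrite continuous_open_subspace// => /(_ p); apply; rewrite inE.
  have near1 : \forall q \near p, \tr (D i (chart i q) ^+ k) = \tr (D i (chart i p) ^+ k).
    exact: (cp _ (locally_constant oimg ix (fun y v iy => dD i y v iy))).
  have near2 : \forall q \near p, chart_dom i q by apply: open_nbhs_nbhs.
  near=> q => j jq.
  rewrite (@trace_exp_chart j i q k)//; last by near: q.
  by near: q.
pose c0 := \tr (D i0 (chart i0 p0) ^+ k).
(* [S] quantifies over all charts at [p]. By [trace_exp_chart] any one of them decides membership,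
   so with [loc] both [S] and its complement are open. *)
pose S := [set p | forall i, chart_dom i p -> \tr (D i (chart i p) ^+ k) = c0].
have oS : open S.
  rewrite openE => p Sp; have [i ip] := cover p.
  apply: filterS (loc p i ip) => q H j jq.
  by rewrite H//; exact: Sp.
have cS : closed S.
  rewrite -[S]setCK; apply: open_closedC; rewrite openE => p Sp.
  have [i ip] := cover p.
  apply: filterS (loc p i ip) => q H Sq; apply: Sp => j jp.
  have [j' jq] := cover q.
  by rewrite (@trace_exp_chart j i p k)// -(H j' jq); exact: Sq.
have ST : S = [set: N].
  apply: cN.
  - by exists p0 => i ip; exact: trace_exp_chart.
  - by exists S => //; rewrite setTI.
  - by exists S => //; rewrite setTI.
have : S q0 by rewrite ST.
by move=> /(_ j0 jq0) ->.
Unshelve. all: by end_near. Qed.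

(** Power sums and multiplicities determine each other for diagonalizable matrices. The traces are
    smooth in the point, so constancy of the eigenvalues becomes a statement about derivatives. *)
Lemma constant_eigenvaluesP : constant_eigenvalues D <->
  forall k i j x y, chart_img i x -> chart_img j y -> \tr (D i x ^+ k) = \tr (D j y ^+ k).
Proof.
split=> H.
  move=> k i j x y ix jy.
  have [Q [l [_ [Qu QD] _]]] := eigenframe (posg (i := i)) (adj (i := i)) ix.
  have [Q' [l' [_ [Qu' QD'] _]]] := eigenframe (posg (i := j)) (adj (i := j)) jy.
  rewrite (trace_diagonalizable_exp k Qu QD) (trace_diagonalizable_exp k Qu' QD').
  apply: card_power_sums => a.
  by rewrite -(rank_eigenspace a Qu QD) -(rank_eigenspace a Qu' QD'); exact: H.
move=> i j x y a ix jy.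
have [Q [l [_ [Qu QD] _]]] := eigenframe (posg (i := i)) (adj (i := i)) ix.
have [Q' [l' [_ [Qu' QD'] _]]] := eigenframe (posg (i := j)) (adj (i := j)) jy.
rewrite (rank_eigenspace a Qu QD) (rank_eigenspace a Qu' QD').
apply: power_sums_card => k.
by rewrite -(trace_diagonalizable_exp k Qu QD) -(trace_diagonalizable_exp k Qu' QD'); exact: H.
Qed.

End Global.

(** * The two implications *)

Section Main.
Context {R : realType} {n : nat} {N : topologicalType}.
Variables (A : atlas R n N) (g D : tensor2 A).
Hypothesis manifoldN : smooth_manifold A.
Hypothesis connectedN : connected [set: N].
Hypothesis metric_g : riemannian_metric g.
Hypothesis symmetric_D : symmetric_endomorphism_field g D.

Let oU i : open (chart_img i) := @chart_img_open _ _ _ A manifoldN i.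
Let smg i k : dCmx (chart_img i) k (g i) := chart_smooth_metric manifoldN metric_g i k.
Let smD i k : dCmx (chart_img i) k (D i) := chart_smooth_endo manifoldN symmetric_D i k.
Let posg i x : chart_img i x -> posdefmx (g i x) := @chart_posdef _ _ _ _ _ metric_g i x.
Let adj i x : chart_img i x -> D i x *m g i x = g i x *m (D i x)^T := @chart_adjoint _ _ _ _ _ _
  symmetric_D i x.

Lemma divergence_chart t i x k : chart_img i x ->
  divergence (hmet (g i) (D i) t) (D i) x k = divergence (g i) (D i) x k +
   t / 2 * (\sum_l D i x k l * \tr ('D_(frame R l) (D i) x) - \tr
     ('D_(frame R k) (D i) x *m D i x)).
Proof. exact: (divergence_hmet (@oU i) (smg i) (smD i) (posg (i := i)) (adj (i := i))). Qed.

Lemma trace_derive_endo i x k : chart_img i x ->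
  is_derive x (frame R k) (fun y => \tr (D i y)) (\tr ('D_(frame R k) (D i) x)).
Proof. by move=> ix; exact: is_derive_mxtrace (dCmx_is_derive k (smD i 1%N) ix). Qed.

Lemma einstein_eigenvalues c : einstein_with (extension_metric g D) c ->
  forall k i x v, chart_img i x -> is_derive x v (fun y => \tr (D i y ^+ k)) 0.
Proof.
move=> /(einstein_withP manifoldN metric_g symmetric_D) H k i x v ix.
apply: (derive_trace_exp (@oU i) (smg i) (smD i) (posg (i := i)) (adj (i := i)) (c := c)).
- by move=> y iy; have [] := H i y iy.
- by move=> t y j iy; have [_ ->] := H i y iy.
- by move=> t y iy; have [T _ ->] := H i y iy; rewrite T raddfN opprK.
- by move=> y iy; exact: (chart_diff_endo symmetric_D iy).
- exact: ix.
Qed.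

Lemma einstein_conditions c : einstein_with (extension_metric g D) c ->
  (constant_eigenvalues D /\ divergence_free g D) /\
  (ricci_stable g D /\ forall u i x, chart_img i x ->
    deformed_ricci g D u i x = \tr (D i x) *: D i x - (\tr (D i x *m D i x))%:M).
Proof.
move=> E; have dtr := einstein_eigenvalues E.
have H := (einstein_withP manifoldN metric_g symmetric_D c).1 E.
have Ric u i x : chart_img i x ->
    deformed_ricci g D u i x = \tr (D i x) *: D i x - (\tr (D i x *m D i x))%:M.
  move=> ix; have [T _ ricD] := H i x ix.
  by rewrite (deformed_ricci_hmet manifoldN metric_g symmetric_D u ix) ricD T raddfN opprK.
split; split.
- apply/(constant_eigenvaluesP metric_g symmetric_D) => k i j x y ix jy.
  exact: (trace_exp_constant manifoldN metric_g symmetric_D connectedN (dtr k) ix jy).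
- move=> i x k ix; have [_ divD _] := H i x ix.
  have := divD 0 k; rewrite divergence_chart// mul0r mul0r addr0 => ->.
  have [_ <-] := trace_derive_endo k ix.
  by have [_] := dtr 1%N i x (frame R k) ix.
- by move=> u u' i x ix; rewrite !Ric.
- exact: Ric.
Qed.

Lemma conditions_einstein : constant_eigenvalues D -> divergence_free g D ->
  (forall u i x, chart_img i x ->
    deformed_ricci g D u i x = \tr (D i x) *: D i x - (\tr (D i x *m D i x))%:M) ->
  einstein (extension_metric g D).
Proof.
move=> /(constant_eigenvaluesP metric_g symmetric_D) cD divD Ric.
have [[p _]|Nempty] := pselect (exists p : N, True); last first.
  (* On an empty manifold no point supplies the constant, and any value works. *)
  exists 0 => i y [[u p] _ _]; case: Nempty; by exists p.
have [_ [_ [cover _]]] := manifoldN; have [i0 i0p] := cover p.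
have ix0 : chart_img i0 (chart i0 p) by exists p.
pose c := - \tr (D i0 (chart i0 p) *m D i0 (chart i0 p)).
exists c; apply/(einstein_withP manifoldN metric_g symmetric_D) => i x ix.
have D2E j y : \tr (D j y *m D j y) = \tr (D j y ^+ 2) by rewrite expr2.
have trE : \tr (D i x *m D i x) = - c by rewrite opprK !D2E; exact: cD.
have cst_derive (f : 'rV[R]_n -> R) k : (forall y, chart_img i y -> f y = f x) ->
    'D_(frame R k) f x = 0.
  move=> fc; rewrite -(derive_cst (f x) x (frame R k)); apply: near_eq_derive.
  by near=> y; apply: fc; near: y; exact: (near_open (@oU i) ix).
have tr0 k : \tr ('D_(frame R k) (D i) x) = 0.
  have [_ <-] := trace_derive_endo k ix; apply: cst_derive => y iy.
  exact: (cD 1%N).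
have trD0 k : \tr ('D_(frame R k) (D i) x *m D i x) = 0.
  apply: (mulfI (_ : 2 != 0 :> R)); rewrite ?pnatr_eq0// mulr0.
  have [_ <-] := derive_trace_sqr (smD i) k ix; apply: cst_derive => y iy.
  by rewrite !D2E; exact: cD.
split=> // [t k|t].
  have tr_sum0 : \sum_l D i x k l * \tr ('D_(frame R l) (D i) x) = 0.
    by apply: big1 => l _; rewrite tr0 mulr0.
  by rewrite (divergence_chart t k ix) (divD i x k ix) tr0 trD0 tr_sum0 subrr mulr0 addr0.
have := Ric (t / 2) i x ix.
rewrite (deformed_ricci_hmet manifoldN metric_g symmetric_D _ ix).
have -> : 2 * (t / 2) = t by field.
by move=> ->; rewrite trE raddfN opprK.
Unshelve. all: by end_near. Qed.

End Main.

Theorem theorem1 (R : realType) (n : nat) (N : topologicalType)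
    (A : atlas R n N) (g D : tensor2 A)
    (n_gt1 : (1 < n)%N)
    (manifoldN : smooth_manifold A)
    (connectedN : connected [set: N])
    (metric_g : riemannian_metric g)
    (symmetric_D : symmetric_endomorphism_field g D) :
  (einstein (extension_metric g D) <->
     ((constant_eigenvalues D /\ divergence_free g D) /\
      (ricci_stable g D /\
       forall (u : R) (i : chart_index A) (x : 'rV[R]_n), chart_img i x ->
         deformed_ricci g D u i x =
           \tr (D i x) *: D i x - (\tr (D i x *m D i x))%:M))) /\
  (forall c : R, einstein_with (extension_metric g D) c ->
     forall (i : chart_index A) (x : 'rV[R]_n), chart_img i x ->
       c = - \tr (D i x *m D i x)).
Proof.
split; first split=> [[c E]|[[cD divD] [_ Ric]]].
- exact: (einstein_conditions manifoldN connectedN metric_g symmetric_D E).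
- exact: (conditions_einstein manifoldN metric_g symmetric_D cD divD Ric).
move=> c /(einstein_withP manifoldN metric_g symmetric_D) H i x ix.
by have [-> _ _] := H i x ix; rewrite opprK.
Qed.
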